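(* Let $q$ be a power of $3$, and fix $3/7 < \eta < 1$. Then for any monic $f \in \mathbb{F}_q[T]$ of large enough norm (in terms of $q$ and $\eta$), there exist $g, h \in \mathbb{F}_q[T]$ with $|g|, |h| \leq |f|^\eta$ such that $\mu(f+g) = 1$ and $\mu(f+h) = -1$.
   Context: The norm is $|f| = q^{\deg f}$ for nonzero $f\in\mathbb{F}_q[T]$, and $|0| = 0$. For monic $f$, $\mu(f) = 0$ if $P^2 \mid f$ for some monic irreducible $P$, and otherwise $\mu(f) = (-1)^{\#\{P : P \mid f\}}$ with $P$ ranging over monic irreducible polynomials. *)

(* Defs.v *)
From HB Require Import structures.
From mathcomp Require Import all_boot all_order all_algebra.
From mathcomp Require Import finmap.
From mathcomp Require Import qpoly.
From mathcomp Require Import boolp classical_sets functions cardinality.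
From mathcomp Require Import reals exp.

Set Implicit Arguments.
Unset Strict Implicit.
Unset Printing Implicit Defensive.

Import Order.TTheory GRing.Theory Num.Theory.

Local Open Scope classical_set_scope.
Local Open Scope ring_scope.

Section Moebius.
Variable F : finFieldType.
Implicit Types f P : {poly F}.

Definition pnorm f : nat := if f == 0 then 0%N else (#|F| ^ (size f).-1)%N.

Definition monic_irreducible P : Prop := P \is monic /\ irreducible_poly P.

Definition prime_divisors f : set {poly F} :=
  [set P | monic_irreducible P /\ P %| f].

(* [fset_set] returns the empty set on infinite sets; this matters only for
   [f = 0], where the first branch applies anyway. *)
Lemma finite_prime_divisors f : f != 0 -> finite_set (prime_divisors f).
Proof.
move=> f0.
apply: (@sub_finite_set _ _
  ((fun p : {poly_(size f) F} => p : {poly F}) @` setT)).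
  move=> P [_ Pf] /=.
  have sP : P \is a poly_of_size (size f) by rewrite qualifE /= dvdp_leq.
  by exists (NPoly sP).
exact/finite_image/finite_finset.
Qed.

Definition moebius f : int :=
  if `[< exists P, monic_irreducible P /\ P ^+ 2 %| f >] then 0
  else (-1) ^+ #|` fset_set (prime_divisors f)|.

End Moebius.

(* Main.v *)
Require Import Defs.
From mathcomp Require Import all_boot all_order all_algebra.
From mathcomp Require Import finmap closed_field separable finfield.
From mathcomp Require Import boolp classical_sets cardinality.
From mathcomp Require Import reals exp.
From mathcomp Require Import zify ring lra.

(** Write T for the variable. In characteristic 3 a cube has derivative zero,
    and this makes the Moebius function computable along some families: by
    Pellet's formula ([pellet]) it is, for squarefree polynomials, a quadratic
    residue symbol of the derivative. For F = X1 (S^2 (b + a)^3 + j) with varying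
    a, the derivative of S times the second factor does not depend on a, and
    reciprocity turns the Moebius function of F into a constant times the symbol
    of c + a modulo a fixed polynomial Q ([moebius_family]). So it suffices to
    find such a family inside the interval around f, with Q of small degree, and
    to show that the symbol takes both values on a short interval of a.

    For the family, [cube_approximation] gives f = X b^3 + E with X and E of
    small degree: f is u0^3 + T u1^3 + T^2 u2^3, and the pigeonhole principle
    provides a common denominator u, of degree h, for good approximations of the
    two smaller components divided by the leading one; X is essentially f u^3
    divided by the cube of the leading component. Then [both_signs_near] adjusts
    j so that X1 j approximates E. With D the degree allowed for F - f, the
    degree d of a may be about (D - deg X) / 3 and Q gets degree about deg E - D.

    For the symbol, [symbol_both_signs] shows that both values occur on the
    polynomials c + a with deg a at most d as soon as 2 deg Q is at most 5 d, up
    to lower order terms. Suppose the symbol is constant there. If Q divides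
    c N + M with short N and M, comparing two elements of the interval whose
    ratio is prescribed shows that the symbol of a monic Y of suitable degree
    modulo Q depends only on Y modulo N. This contradicts the nontriviality of
    quadratic characters on monic polynomials of degree about log(deg f), which
    [quadratic_character_nontrivial] proves by Stepanov's method. If there is no
    such short vector (N, M), then, for a factor l of Q of small degree, the
    geometry of the lattice provides a rather short one for which Q / l divides
    c N + M but Q does not. The same comparison then forces a quadratic
    polynomial with two distinct roots over the residue field of l to take
    values of one quadratic character only, which is absurd.

    The condition 2 deg Q <= 5 d reads 6 deg E + 5 deg X <= 11 D. Here deg X is
    about 3 h, and with the parameter c of the approximation deg E is at most
    about the larger of 3 c - 3 h and 3 h, where h is at most 2 (deg f / 3 - c).
    Taking c = 11 D / 18 this is satisfied exactly when D is at least 3/7 of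
    deg f ([both_signs_degree]). Every coprimality condition met on the way is
    arranged by the sieve [sieve_okP] at the cost of o(deg f) in the degrees:
    only irreducible factors of degree at most L have to be treated one by one,
    and they are controlled modulo a polynomial of degree about q^L. *)

Set Implicit Arguments.
Unset Strict Implicit.
Unset Printing Implicit Defensive.

Import Order.TTheory GRing.Theory Num.Theory.

Local Open Scope ring_scope.

(** * The symbol defined by a product over roots *)

Section RootProduct.
Variable F : finFieldType.

Definition clo : countClosedFieldType :=
  projT1 (countable_algebraic_closure F).
Definition emb : {rmorphism F -> clo} :=
  proj1_sig (projT2 (countable_algebraic_closure F)).

Local Notation q := #|F|.
Local Notation "p ^K" := (map_poly emb p) (at level 2, format "p ^K").
Implicit Types (A B C : {poly F}) (x : clo).

Definition rts A : seq clo := sval (closed_field_poly_normal A^K).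

(** This is the resultant of A and B when A is monic. *)
Definition resp A B : clo := \prod_(a <- rts A) (B^K).[a].

(** The Jacobi symbol of B modulo a monic A, with values 0, 1, -1 in the
    algebraic closure: a product over roots makes multiplicativity and
    reciprocity formal. *)
Definition jac A B : clo := resp A B ^+ (q.-1)./2.

Lemma rtsE A : A \is monic -> A^K = \prod_(a <- rts A) ('X - a%:P).
Proof.
move=> mA; have := svalP (closed_field_poly_normal A^K).
by rewrite -/(rts A) lead_coef_map (monicP mA) rmorph1 scale1r.
Qed.

Lemma mem_rts A x : A \is monic -> (x \in rts A) = root A^K x.
Proof. by move=> mA; rewrite rtsE // root_prod_XsubC. Qed.

Lemma size_rts A : A \is monic -> size (rts A) = (size A).-1.
Proof.
by move=> mA; rewrite -(size_map_poly emb A) rtsE // size_prod_XsubC.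
Qed.

Lemma rts_mul A B : A \is monic -> B \is monic ->
  perm_eq (rts (A * B)) (rts A ++ rts B).
Proof.
move=> mA mB; apply: prod_XsubC_eq.
by rewrite big_cat /= -!rtsE ?rmorphM // monicMl.
Qed.

Lemma resp_mull A B C : A \is monic -> B \is monic ->
  resp (A * B) C = resp A C * resp B C.
Proof. by move=> mA mB; rewrite /resp (perm_big _ (rts_mul mA mB)) big_cat. Qed.

Lemma resp_mulr A B C : resp A (B * C) = resp A B * resp A C.
Proof. by rewrite /resp -big_split; apply: eq_bigr => x _; rewrite rmorphM hornerM. Qed.

Lemma resp1l A : resp 1 A = 1.
Proof.
have := size_rts (monic1 F); rewrite size_poly1 => /size0nil h.
by rewrite /resp h big_nil.
Qed.

Lemma resp1 A : resp A 1 = 1.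
Proof. by rewrite /resp big1 // => x _; rewrite rmorph1 hornerC. Qed.

Lemma resp_mod A B C : A \is monic -> A %| B - C -> resp A B = resp A C.
Proof.
move=> mA d; rewrite /resp; apply: eq_big_seq => x; rewrite mem_rts // => /rootP rx.
apply/eqP; rewrite -subr_eq0 -hornerN -hornerD -rmorphN -rmorphD /=.
by case/dvdpP: d => D ->; rewrite rmorphM hornerM rx mulr0.
Qed.

(** Both sides are the product of all a - b up to sign. *)
Lemma resp_recip A B : A \is monic -> B \is monic ->
  resp A B = (-1) ^+ ((size A).-1 * (size B).-1) * resp B A.
Proof.
move=> mA mB; rewrite /resp (rtsE mA) (rtsE mB).
under eq_bigr => a _ do rewrite horner_prod.
under [X in _ * X]eq_bigr => b _ do rewrite horner_prod.
rewrite exchange_big /= -(size_rts mA) -(size_rts mB) mulnC.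
transitivity (\prod_(b <- rts B) ((-1) ^+ size (rts A) *
    \prod_(a <- rts A) ('X - a%:P).[b])).
  apply: eq_bigr => b _; elim: (rts A) => [|a s IH] /=.
    by rewrite !big_nil mul1r.
  rewrite !big_cons IH !hornerXsubC exprS; ring.
rewrite big_split /=; congr (_ * _).
by rewrite big_const_seq count_predT iter_mulr_1 mulnC exprM.
Qed.

Lemma resp_neq0 A B : A \is monic -> (resp A B != 0) = coprimep A B.
Proof.
move=> mA; rewrite /resp -(coprimep_map emb) [in RHS](rtsE mA).
apply/idP/idP => [h|h].
  elim: (rts A) h => [|a s IH]; first by rewrite !big_nil coprime1p.
  by rewrite !big_cons mulf_eq0 negb_or coprimepMl [coprimep ('X - _) _]coprimep_sym coprimep_XsubC => /andP[-> /IH ->].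
elim: (rts A) h => [|a s IH]; first by rewrite !big_nil oner_neq0.
by rewrite !big_cons mulf_eq0 negb_or coprimepMl [coprimep ('X - _) _]coprimep_sym coprimep_XsubC => /andP[-> /IH ->].
Qed.

Hypothesis F3 : exists k, q = (3 ^ k)%N.

Lemma pchar3 : 3%N \in [pchar F].
Proof.
case: F3 => k qE.
exact: card_finPcharP qE _.
Qed.

Lemma pchar3_clo : 3%N \in [pchar clo].
Proof. by rewrite (fmorph_pchar emb) pchar3. Qed.

Lemma pchar_nat_card : [pchar clo].-nat q.
Proof.
have [k ->] := F3; rewrite pnatX; apply/orP; left.
by rewrite pnatE // pchar3_clo.
Qed.

Lemma card_odd : odd q.
Proof. by have [k ->] := F3; rewrite oddX orbT. Qed.

Lemma half_cardK : ((q.-1)./2.*2 = q.-1)%N.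
Proof. by rewrite even_halfK // -subn1 oddB ?card_odd // (ltnW (finNzRing_gt1 F)). Qed.

Lemma frob_horner A x r :
  (A^K).[x] ^+ (q ^ r) = (A^K).[x ^+ (q ^ r)].
Proof.
have qn : [pchar clo].-nat (q ^ r)%N by rewrite pnatX pchar_nat_card.
elim/poly_ind: A => [|A c IH].
  by rewrite rmorph0 !horner0 expr0n gtn_eqF // expn_gt0 (ltnW (finNzRing_gt1 F)).
rewrite rmorphD rmorphM /= map_polyX map_polyC !hornerE (exprDn_pchar _ _ qn).
rewrite exprMn IH -rmorphXn; congr (_ + emb _).
by elim: r {qn IH} => // r IH; rewrite expnSr exprM IH expf_card.
Qed.

Lemma emb_fixed x : x ^+ q = x -> exists y, x = emb y.
Proof.
move=> xq; have := congr1 (map_poly emb) (finField_genPoly F).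
rewrite rmorphB rmorphXn /= map_polyX rmorph_prod /= => /(congr1 (horner^~ x)).
rewrite !hornerE xq subrr horner_prod => /esym/eqP.
rewrite prodf_seq_eq0 => /hasP[y _] /=.
by rewrite rmorphB /= map_polyX map_polyC !hornerE subr_eq0 => /eqP ->; exists y.
Qed.

(** A polynomial over the closure whose coefficients are fixed by Frobenius
    comes from the base field. *)
Lemma map_emb_fixed (G : {poly clo}) :
  (forall i, G`_i ^+ q = G`_i) -> exists A, G = A^K.
Proof.
move=> Gq; pose c i := sval (cid (emb_fixed (Gq i))).
exists (\poly_(i < size G) c i); apply/polyP => i.
rewrite coef_map coef_poly; case: ltnP => [_|h] /=; last by rewrite rmorph0 nth_default.
by rewrite {1}(svalP (cid (emb_fixed (Gq i)))).
Qed.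

Lemma pchar_nat_cardX r : [pchar clo].-nat (q ^ r)%N.
Proof. by rewrite pnatX pchar_nat_card. Qed.

Lemma frobB r x y : (x - y) ^+ (q ^ r) = x ^+ (q ^ r) - y ^+ (q ^ r).
Proof.
rewrite (exprDn_pchar _ _ (pchar_nat_cardX r)) exprNn -signr_odd oddX card_odd.
by rewrite orbT expr1 mulN1r.
Qed.

Lemma frob_inj r : injective (fun x : clo => x ^+ (q ^ r)).
Proof.
move=> x y /= h; apply/eqP; rewrite -subr_eq0.
by have /eqP := frobB r x y; rewrite h subrr expf_eq0 => /andP[].
Qed.

Lemma coef_prod_frob (s : seq clo) i :
  (\prod_(a <- s) ('X - a%:P))`_i ^+ q = (\prod_(a <- s) ('X - (a ^+ q)%:P))`_i.
Proof.
elim: s i => [|a s IH] i.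
  by rewrite !big_nil coef1; case: eqP => _; rewrite ?expr1n ?expr0n -?lt0n ?(gtn_eqF (ltnW (finNzRing_gt1 F))).
rewrite !big_cons !mulrBl !coefB !coefXM !coefCM.
rewrite -(expn1 q) frobB expn1 exprMn !IH; congr (_ - _).
by case: eqP => // _; rewrite expr0n (gtn_eqF (ltnW (finNzRing_gt1 F))).
Qed.

Lemma rts_frob A : A \is monic -> perm_eq [seq x ^+ q | x <- rts A] (rts A).
Proof.
move=> mA; apply: prod_XsubC_eq; rewrite -rtsE //.
apply/polyP => i; rewrite big_map -coef_prod_frob -rtsE // coef_map.
by rewrite -[RHS](congr1 emb (expf_card A`_i)) rmorphXn.
Qed.

(** Frobenius permutes the roots of A, so the resultant lies in F. *)
Lemma resp_frob A B : A \is monic -> resp A B ^+ q = resp A B.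
Proof.
move=> mA; rewrite {2}/resp -(perm_big _ (rts_frob mA)) big_map /resp -prodrXl.
by apply: eq_bigr => x _; rewrite -{1 2}(expn1 q) frob_horner.
Qed.

Lemma jacMl A B C : A \is monic -> B \is monic ->
  jac (A * B) C = jac A C * jac B C.
Proof. by move=> mA mB; rewrite /jac resp_mull // exprMn. Qed.

Lemma jacM A B C : jac A (B * C) = jac A B * jac A C.
Proof. by rewrite /jac resp_mulr exprMn. Qed.

Lemma jac1l A : jac 1 A = 1.
Proof. by rewrite /jac resp1l expr1n. Qed.

Lemma jac1 A : jac A 1 = 1.
Proof. by rewrite /jac resp1 expr1n. Qed.

Lemma jacX A B n : jac A (B ^+ n) = jac A B ^+ n.
Proof. by elim: n => [|n IH]; rewrite ?jac1 // !exprS jacM IH. Qed.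

Lemma jac_mod A B C : A \is monic -> A %| B - C -> jac A B = jac A C.
Proof. by move=> mA d; rewrite /jac (resp_mod mA d). Qed.

Lemma half_card_gt0 : (0 < (q.-1)./2)%N.
Proof. 
have := half_cardK; have := finNzRing_gt1 F; by case: ((q.-1)./2) => //; case: #|F| => [|[|n]].
Qed.

Lemma jac_neq0 A B : A \is monic -> (jac A B != 0) = coprimep A B.
Proof. by move=> mA; rewrite /jac expf_eq0 half_card_gt0 /= resp_neq0. Qed.

Lemma jac_sqr A B : A \is monic -> coprimep A B -> jac A B ^+ 2 = 1.
Proof.
move=> mA cAB; rewrite /jac -exprM muln2 half_cardK.
have h : resp A B != 0 by rewrite resp_neq0.
apply: (mulfI h); rewrite -exprS mulr1 prednK ?resp_frob //.
exact: ltnW (finNzRing_gt1 F).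
Qed.

Lemma jac_pm1 A B : A \is monic -> coprimep A B -> jac A B = 1 \/ jac A B = -1.
Proof.
move=> mA cAB; have := jac_sqr mA cAB => /eqP; rewrite sqrf_eq1.
by case/orP => /eqP ->; [left|right].
Qed.

Lemma clo_neq1N : (-1 : clo) != 1.
Proof.
rewrite -subr_eq0 -opprD oppr_eq0 -(dvdn_pcharf pchar3_clo 2) //.
Qed.

(** The reciprocity sign: the quadratic character of -1 in the base field. *)
Definition chim1 : clo := (-1) ^+ (q.-1)./2.

Lemma chim1_sqr : chim1 ^+ 2 = 1.
Proof. by rewrite /chim1 -exprM mulnC exprM sqrrN !expr1n. Qed.

Lemma jac_recip A B : A \is monic -> B \is monic ->
  jac A B = chim1 ^+ ((size A).-1 * (size B).-1) * jac B A.
Proof. by move=> mA mB; rewrite /jac resp_recip // exprMn -!exprM mulnC. Qed.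

End RootProduct.

(** * Irreducible factors and squarefree polynomials *)

Section PolynomialSizes.
Variable F : finFieldType.
Implicit Types A B : {poly F}.

Definition sz A : nat := size A.

Lemma szM A B : A != 0 -> B != 0 -> size (A * B) = (size A + size B).-1.
Proof. exact: size_mul. Qed.

Lemma sz_dvd A B : B != 0 -> A %| B -> (size A <= size B)%N.
Proof. exact: dvdp_leq. Qed.

Lemma sz_gt0 A : A != 0 -> (0 < size A)%N.
Proof. by rewrite size_poly_gt0. Qed.

Lemma sz_mod A B : B != 0 -> (size (A %% B)%R < size B)%N.
Proof. by rewrite ltn_modp. Qed.

Lemma szD A B : (size (A + B)%R <= maxn (size A) (size B))%N.
Proof. exact: size_polyD. Qed.

Lemma szB A B : (size (A - B)%R <= maxn (size A) (size B))%N.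
Proof. by rewrite -[size B]size_polyN; apply: size_polyD. Qed.

Lemma szM_leq A B : (size (A * B)%R <= (size A + size B).-1)%N.
Proof. exact: size_polyMleq. Qed.

End PolynomialSizes.

(** Arithmetic on sizes. The same polynomial may occur with its operations
    taken from different but convertible algebraic structures: the sizes are
    first folded and identified up to these structures. *)
Ltac same_poly a b := first [constr_eq a b | lazymatch a with
  | @GRing.add _ ?x ?y => lazymatch b with
      @GRing.add _ ?x' ?y' => same_poly x x'; same_poly y y' end
  | @GRing.mul _ ?x ?y => lazymatch b with
      @GRing.mul _ ?x' ?y' => same_poly x x'; same_poly y y' end
  | @GRing.opp _ ?x => lazymatch b with @GRing.opp _ ?x' => same_poly x x' end
  | @GRing.exp _ ?x ?n => lazymatch b with
      @GRing.exp _ ?x' ?n => same_poly x x' end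
  | @GRing.scale _ _ ?c ?x => lazymatch b with
      @GRing.scale _ _ ?c ?x' => same_poly x x' end
  | @polyX _ => lazymatch b with @polyX _ => idtac end
  end].

Ltac slia := cbv beta;
  repeat match goal with
  | H : is_true (leq _ _) |- _ => revert H
  | H : @eq nat _ _ |- _ => revert H
  end;
  repeat match goal with |- context [@size ?T (@polyseq ?R ?p)] =>
    change (@size T (@polyseq R p)) with (sz p) end;
  repeat match goal with |- context [sz ?a] => match goal with |- context [sz ?b] =>
    tryif constr_eq a b then fail else (same_poly a b; change (sz b) with (sz a))
  end end;
  repeat match goal with |- context [sz ?a] => generalize (sz a) end;
  repeat match goal with H : ?T |- _ => lazymatch T with nat => fail | _ => clear H end end;
  lia.

Lemma dvdP (F : finFieldType) (A B : {poly F}) :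
  A %| B -> exists C : {poly F}, B = C * A.
Proof. by case/dvdpP=> C; exists C. Qed.

Section Factors.
Variable F : finFieldType.
Implicit Types A B C P R : {poly F}.
Local Notation mi := (@monic_irreducible F).

Lemma mi_size P : mi P -> (1 < size P)%N.
Proof. by case=> _ []. Qed.

Lemma mi_monic P : mi P -> P \is monic. Proof. by case. Qed.

Lemma mi_neq0 P : mi P -> P != 0.
Proof. by case=> /monic_neq0. Qed.

Lemma mi_factor A : size A != 1%N -> exists2 P : {poly F}, mi P & P %| A.
Proof.
have [->|A0 sA] := eqVneq A 0.
  exists 'X; last exact: dvdp0.
  split; first exact: monicX.
  by have := irredp_XsubC (0 : F); rewrite subr0.
pose p n := `[< exists B, [/\ size B = n, B %| A & (1 < n)%N] >].
have [|n /asboolP[B [sB dB n1]] nmin] := @find_ex_minn p.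
  exists (size A); apply/asboolP; exists A; split => //.
  by have := size_poly_gt0 A; rewrite A0; case: (size A) sA => [|[]].
have B0 : B != 0 by rewrite -size_poly_gt0 sB; lia.
exists ((lead_coef B)^-1 *: B); last by rewrite dvdpZl // invr_eq0 lead_coef_eq0.
split; first by rewrite monicE lead_coefZ mulVf // lead_coef_eq0.
have l0 : (lead_coef B)^-1 != 0 by rewrite invr_eq0 lead_coef_eq0.
split=> [|D sD]; first by rewrite size_scale // sB.
rewrite dvdpZr // => dD; rewrite -dvdp_size_eqp ?dvdpZr // size_scale //.
have sD1 : (1 < size D)%N.
  have : D != 0 by apply: contraTneq dD => ->; rewrite dvd0p.
  by rewrite -size_poly_gt0; case: (size D) sD => [|[]].
rewrite eqn_leq dvdp_leq //= sB; apply: nmin; apply/asboolP.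
by exists D; split => //; apply: dvdp_trans dB.
Qed.

Lemma mi_coprime P A : mi P -> coprimep P A = ~~ (P %| A).
Proof. by case=> _ iP; rewrite irreducible_poly_coprime. Qed.

Lemma coprimep_mi A B :
  (forall P, mi P -> P %| A -> P %| B -> False) -> coprimep A B.
Proof.
move=> h; rewrite /coprimep; apply/negPn/negP => /mi_factor[P mP].
by rewrite dvdp_gcd => /andP[]; apply: h.
Qed.

Lemma mi_notboth A B P : mi P -> coprimep A B -> P %| A -> P %| B -> False.
Proof.
move=> mP cAB dA dB; have : P %| gcdp A B by rewrite dvdp_gcd dA.
move: cAB; rewrite /coprimep => /size_poly1P[c c0 ->] /dvdp_leq.
rewrite polyC_eq0 c0 size_polyC c0 => /(_ isT).
by rewrite leqNgt mi_size.
Qed.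

Lemma mi_dvdM P A B : mi P -> (P %| A * B) = (P %| A) || (P %| B).
Proof.
by move=> mP; rewrite -[LHS]negbK -mi_coprime // coprimepMr !mi_coprime // negb_and !negbK.
Qed.

Lemma mi_dvdX P A n : mi P -> (0 < n)%N -> (P %| A ^+ n) = (P %| A).
Proof.
move=> mP; case: n => // n _; elim: n => [|n IH]; first by rewrite expr1.
by rewrite exprS mi_dvdM // IH orbb.
Qed.

Lemma mi_dvd_eq P R : mi P -> mi R -> (P %| R) = (P == R).
Proof.
move=> mP mR; apply/idP/eqP => [d|->] //.
have /(apply_irredp (proj2 mR)) : size P != 1%N by have := mi_size mP; lia.
by move=> /(_ d); rewrite eqp_monic ?(mi_monic mP) ?(mi_monic mR) // => /eqP.
Qed.

Lemma mi_dvd1 P : mi P -> (P %| 1) = false.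
Proof. by move=> mP; rewrite dvdp1 gtn_eqF // mi_size. Qed.

Lemma monic_ind (T : {poly F} -> Prop) :
  T 1 -> (forall P A, mi P -> A \is monic -> T A -> T (P * A)) ->
  forall A, A \is monic -> T A.
Proof.
move=> T1 TS A; have [n] := ubnP (size A); elim: n A => // n IH A sA mA.
have [/eqP s1|s1] := boolP (size A == 1%N).
  by move: mA; rewrite (size1_polyC (eq_leq s1)) monicE lead_coefC => /eqP ->.
have [P mP /dvdpP[B EA]] := mi_factor s1.
have mB : B \is monic by move: mA; rewrite EA monicMr // (mi_monic mP).
rewrite EA mulrC; apply: TS => //; apply: IH => //.
have := mi_size mP; have := monic_neq0 mB; rewrite -size_poly_gt0.
by move: sA; rewrite EA size_Mmonic ?(mi_monic mP) ?monic_neq0 //; lia.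
Qed.

Definition sqf R : Prop := forall P, mi P -> ~~ (P ^+ 2 %| R).

Lemma sqf_neq0 R : sqf R -> R != 0.
Proof.
move=> sR; apply/eqP => R0; have [|P mP _] := @mi_factor 0; first by rewrite size_poly0.
by have := sR _ mP; rewrite R0 dvdp0.
Qed.

Lemma sqf1 : sqf 1.
Proof.
move=> P mP; apply/negP; rewrite expr2 => h.
by have := dvdp_trans (dvdp_mulr P (dvdpp P)) h; rewrite mi_dvd1.
Qed.

Lemma sqf_dvd A R : sqf R -> A %| R -> sqf A.
Proof. by move=> sR d P mP; apply: contra (sR P mP) => /dvdp_trans; apply. Qed.

Lemma sqf_coprime A B : sqf (A * B) -> coprimep A B.
Proof.
move=> s; apply: coprimep_mi => P mP dA dB; have := s _ mP.
by rewrite expr2 dvdp_mul.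
Qed.

Lemma sqf_mul A B : sqf A -> sqf B -> coprimep A B -> sqf (A * B).
Proof.
move=> sA sB cAB P mP; apply/negP => d.
have [dA|nA] := boolP (P %| A).
  have nB : coprimep (P ^+ 2) B.
    by apply: coprimep_expl; rewrite mi_coprime //; apply/negP; apply: mi_notboth dA.
  by move: d; rewrite Gauss_dvdpl // (negPf (sA _ mP)).
have nB : coprimep (P ^+ 2) A by apply: coprimep_expl; rewrite mi_coprime.
by move: d; rewrite Gauss_dvdpr // (negPf (sB _ mP)).
Qed.

Lemma sqf_mi P : mi P -> sqf P.
Proof.
move=> mP R mR; apply/negP => d.
have /eqP E : R == P by rewrite -mi_dvd_eq //; apply: dvdp_trans d; rewrite expr2 dvdp_mulr.
have := sz_dvd (mi_neq0 mP) d; rewrite E expr2 szM ?mi_neq0 //.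
have := mi_size mP; lia.
Qed.

(** A squarefree polynomial divides whatever all its irreducible factors
    divide. *)
Lemma sqf_dvdp R A : sqf R -> (forall P, mi P -> P %| R -> P %| A) -> R %| A.
Proof.
move=> sR; have R0 := sqf_neq0 sR.
have l0 : (lead_coef R)^-1 != 0 by rewrite invr_eq0 lead_coef_eq0.
have mR : (lead_coef R)^-1 *: R \is monic.
  by rewrite monicE lead_coefZ mulVf // lead_coef_eq0.
rewrite -[R %| A](dvdpZl _ _ l0) => h.
have {}h P : mi P -> P %| (lead_coef R)^-1 *: R -> P %| A.
  by rewrite dvdpZr //; apply: h.
have : sqf ((lead_coef R)^-1 *: R).
  by apply: (sqf_dvd sR); rewrite dvdpZl.
move: mR h; move: (_ *: R); apply: monic_ind => [h _|P B mP mB IH h s].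
  exact: dvd1p.
rewrite Gauss_dvdp ?(sqf_coprime s) // h ?dvdp_mulr //=.
apply: IH => [P' mP' d|]; first by apply: h; rewrite ?dvdp_mull.
by apply: (sqf_dvd s); rewrite dvdp_mull.
Qed.

Lemma sqf_dvdX R A n : sqf R -> R %| A ^+ n -> R %| A.
Proof.
move=> sR d; apply: sqf_dvdp => // P mP dP.
by have := dvdp_trans dP d; case: n {d} => [|n]; rewrite ?mi_dvd1 // mi_dvdX.
Qed.

(** The product of the distinct monic irreducible factors. *)
Lemma radical A : A != 0 -> exists R : {poly F}, [/\ R \is monic, sqf R, R %| A &
  forall P, mi P -> (P %| A) = (P %| R)].
Proof.
move=> A0; have l0 : (lead_coef A)^-1 != 0 by rewrite invr_eq0 lead_coef_eq0.
have mA : (lead_coef A)^-1 *: A \is monic.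
  by rewrite monicE lead_coefZ mulVf // lead_coef_eq0.
have [R [mR sR dR h]] : exists R : {poly F}, [/\ R \is monic, sqf R,
    R %| (lead_coef A)^-1 *: A &
    forall P, mi P -> (P %| (lead_coef A)^-1 *: A) = (P %| R)].
  move: mA; move: (_ *: A); apply: monic_ind => [|P B mP mB [R [mR sR dR h]]].
    by exists 1; split; rewrite ?monic1 ?dvd1p //; apply: sqf1.
  have [dP|nP] := boolP (P %| R).
    exists R; split => //; first exact: dvdp_mull.
    move=> P' mP'; rewrite mi_dvdM // -h //; have [|//] := boolP (P' %| P).
    by rewrite mi_dvd_eq // => /eqP ->; rewrite h.
  exists (P * R); split; first by rewrite monicMr // (mi_monic mP).
  - by apply: sqf_mul => //; [exact: sqf_mi | rewrite mi_coprime].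
  - by rewrite dvdp_mul.
  by move=> P' mP'; rewrite !mi_dvdM // h.
exists R; split => //; first by move: dR; rewrite dvdpZr.
by move=> P mP; rewrite -h // dvdpZr.
Qed.

Lemma dvdp_sizeX A R n : A != 0 -> (size A <= n.+1)%N ->
  (forall P, mi P -> P %| A -> P %| R) -> A %| R ^+ n.
Proof.
move=> A0; have l0 : (lead_coef A)^-1 != 0 by rewrite invr_eq0 lead_coef_eq0.
have mA : (lead_coef A)^-1 *: A \is monic.
  by rewrite monicE lead_coefZ mulVf // lead_coef_eq0.
rewrite -[size A](size_scale _ l0) -[A %| _](dvdpZl _ _ l0) => sA h.
have {}h P : mi P -> P %| (lead_coef A)^-1 *: A -> P %| R.
  by rewrite dvdpZr //; apply: h.
move: mA n sA h; move: (_ *: A); apply: monic_ind => [n _ _|P B mP mB IH n sB h].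
  exact: dvd1p.
have := sz_gt0 (monic_neq0 mB); have := mi_size mP.
move: sB; rewrite szM ?(mi_neq0 mP) ?(monic_neq0 mB) //.
case: n => [|n] sPB sP sB; first lia.
rewrite exprS; apply: dvdp_mul; first by apply: h; rewrite ?dvdp_mulr.
have sB' : (size B <= n.+1)%N by lia.
by apply: (IH _ sB') => P' mP' d; apply: h; rewrite ?dvdp_mull.
Qed.

Lemma moebius1 : moebius (1 : {poly F}) = 1.
Proof.
rewrite /moebius; case: asboolP => [[P [mP d]]|_].
  by have := sqf1 mP; rewrite d.
rewrite (_ : prime_divisors 1 = set0) ?fset_set0 ?cardfs0 //.
by apply/seteqP; split => // P [mP /=]; rewrite mi_dvd1.
Qed.

Lemma moebiusM P A : mi P -> sqf (P * A) -> moebius (P * A) = - moebius A.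
Proof.
move=> mP s; have sA : sqf A by apply: (sqf_dvd s); rewrite dvdp_mull.
rewrite /moebius; case: asboolP => [[P' [mP' d]]|_].
  by have := s _ mP'; rewrite d.
case: asboolP => [[P' [mP' d]]|_]; first by have := sA _ mP'; rewrite d.
have -> : prime_divisors (P * A) = (P |` prime_divisors A)%classic.
  apply/seteqP; split => P' /= => [[mP']|[->|[mP' d]]].
  - by rewrite mi_dvdM // => /orP[|]; [rewrite mi_dvd_eq // => /eqP ->; left|right].
  - by split => //; apply: dvdp_mulr.
  - by split => //; apply: dvdp_mull.
have fA := finite_prime_divisors (sqf_neq0 sA).
rewrite fset_setU1 // cardfsU1 in_fset_set // (_ : _ \notin _) ?exprS ?mulN1r //.
apply/negP; rewrite inE => -[_ dA].
by have := sqf_coprime s; rewrite mi_coprime // dA.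
Qed.

End Factors.

(** * Frobenius orbits, Euler's criterion and Pellet's formula *)

Section Orbits.
Variable F : finFieldType.
Local Notation q := #|F|.
Local Notation K := (clo F).
Local Notation "p ^K" := (map_poly (emb F) p) (at level 2, format "p ^K").
Local Notation mi := (@monic_irreducible F).
Hypothesis F3 : exists k, q = (3 ^ k)%N.
Implicit Types (A B P Y : {poly F}) (x : K) (s : seq K).

Definition orb x n : seq K := [seq x ^+ (q ^ i) | i <- iota 0 n].

Lemma size_orb x n : size (orb x n) = n.
Proof. by rewrite size_map size_iota. Qed.

Lemma orb_rot x n : x ^+ (q ^ n) = x ->
  [seq a ^+ q | a <- orb x n] = rot 1 (orb x n).
Proof.
case: n => // n xn.
transitivity [seq x ^+ (q ^ i) | i <- iota 1 n.+1].
  rewrite /orb -map_comp -[1%N]addn0 iotaDl -map_comp.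
  by apply: eq_map => i /=; rewrite -exprM -expnSr.
rewrite (_ : iota 1 n.+1 = rcons (iota 1 n) n.+1); last first.
  by rewrite -[in LHS](addn1 n) iotaD cats1 add1n.
rewrite map_rcons /orb /= rot1_cons.
by rewrite expn0 expr1 xn.
Qed.

Lemma orbit_poly x n : x ^+ (q ^ n) = x ->
  exists Y : {poly F}, [/\ Y \is monic, perm_eq (rts Y) (orb x n) & size Y = n.+1].
Proof.
move=> xn; have [i|Y EY] := @map_emb_fixed F (\prod_(a <- orb x n) ('X - a%:P)).
  rewrite coef_prod_frob // -(big_map (fun a => a ^+ q) predT (fun a => 'X - a%:P)).
  by rewrite orb_rot // (perm_big (orb x n)) // perm_rot.
have mY : Y \is monic by rewrite -(map_monic (emb F)) -EY monic_prod_XsubC.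
exists Y; split => //; last first.
  by rewrite -(size_map_poly (emb F)) -EY size_prod_XsubC size_orb.
by apply: prod_XsubC_eq; rewrite -rtsE.
Qed.

Lemma half_pow n : ((\sum_(i < n) q ^ i) * (q.-1)./2)%N = ((q ^ n).-1)./2.
Proof.
by rewrite predn_exp -{2}(half_cardK F3) -doubleMl doubleK mulnC.
Qed.

Lemma jac_orbit Y B x n : perm_eq (rts Y) (orb x n) ->
  jac Y B = (B^K).[x] ^+ ((q ^ n).-1)./2.
Proof.
move=> pY; rewrite /jac /resp (perm_big _ pY) big_map -half_pow exprM; congr (_ ^+ _).
rewrite -(big_mkord xpredT (fun i => q ^ i)%N) expr_sum /index_iota subn0.
by apply: eq_bigr => i _; rewrite frob_horner.
Qed.

(** The orbit of x under Frobenius is finite, and the product over it has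
    coefficients in F and divides P. *)
Lemma irr_orbit P x : mi P -> x \in rts P ->
  perm_eq (rts P) (orb x (size P).-1) /\ uniq (orb x (size P).-1).
Proof.
move=> mP xP; have moP := mi_monic mP; set n := (size P).-1.
have orbP i : x ^+ (q ^ i) \in rts P.
  by move: xP; rewrite !mem_rts // /root -frob_horner // expf_eq0 => ->; rewrite andbT expn_gt0 (ltnW (finNzRing_gt1 F)).
have per i j : (i < j)%N -> x ^+ (q ^ i) = x ^+ (q ^ j) -> x ^+ (q ^ (j - i)) = x.
  move=> ij E; apply: (frob_inj F3 (r := i)) => /=.
  by rewrite -exprM -expnD subnK // ltnW.
pose p m := (0 < m)%N && (x ^+ (q ^ m) == x).
have [|m /andP[m0 /eqP xm] mmin] := @ex_minnP p.
  have : ~~ uniq (orb x n.+1).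
    apply/negP => /uniq_leq_size h; have := h (rts P); rewrite size_orb size_rts // ltnn.
    suff hs : {subset orb x n.+1 <= rts P} by move/(_ hs).
    by move=> _ /mapP[i _ ->].
  case/(uniqPn 0) => i [j [ij]]; rewrite size_orb => jn.
  rewrite !(nth_map 0%N) ?size_iota ?(ltn_trans ij) // !nth_iota ?(ltn_trans ij) // !add0n.
  by move/(per _ _ ij) => E; exists (j - i)%N; rewrite /p subn_gt0 ij E eqxx.
have um : uniq (orb x m).
  apply/negPn/negP => /(uniqPn 0) [i [j [ij]]]; rewrite size_orb => jn.
  rewrite !(nth_map 0%N) ?size_iota ?(ltn_trans ij) // !nth_iota ?(ltn_trans ij) // !add0n.
  move/(per _ _ ij) => E; have := mmin (j - i)%N.
  by rewrite /p subn_gt0 ij E eqxx => /(_ isT); lia.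
have [Y [mY pY sY]] := orbit_poly xm.
have YP : Y %| P.
  rewrite -(dvdp_map (emb F)) (rtsE mY) (perm_big _ pY); apply: uniq_roots_dvdp.
    by apply/allP => _ /mapP[i _ ->]; rewrite -mem_rts.
  by rewrite uniq_rootsE.
have EY : Y = P.
  apply/eqP; rewrite -eqp_monic //; apply: (apply_irredp (proj2 mP)) => //.
  by rewrite sY; case: (m) m0.
by rewrite /n -EY sY.
Qed.

(** Euler's criterion over the residue field of P. *)
Lemma jac_euler P B x : mi P -> x \in rts P ->
  jac P B = (B^K).[x] ^+ ((q ^ (size P).-1).-1)./2.
Proof. by move=> mP xP; apply: jac_orbit; case: (irr_orbit mP xP). Qed.

Lemma mi_root P : mi P -> exists x, x \in rts P.
Proof.
move=> mP; have := size_rts (mi_monic mP); have := mi_size mP.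
case: (rts P) => [|x s] /=; first by case: (size P) => [|[]].
by move=> _ _; exists x; rewrite inE eqxx.
Qed.

Fixpoint vand s : K := if s is a :: s' then \prod_(b <- s') (a - b) * vand s' else 1.

(** The resultant of a product of linear factors with its derivative. *)
Lemma disc_vand s :
  \prod_(a <- s) (\prod_(b <- s) ('X - b%:P))^`().[a] =
  (-1) ^+ 'C(size s, 2) * vand s ^+ 2.
Proof.
elim: s => [|a s IH]; first by rewrite big_nil /= expr1n mulr1.
rewrite !big_cons /= binS bin1 exprD exprMn.
set G := \prod_(b <- s) ('X - b%:P).
have -> : \prod_(j <- s) (('X - a%:P) * G)^`().[j] =
    \prod_(j <- s) (j - a) * \prod_(j <- s) G^`().[j].
  rewrite -big_split; apply: eq_big_seq => j js /=.
  have Gj : G.[j] = 0 by apply/rootP; rewrite root_prod_XsubC.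
  by rewrite derivM derivXsubC !hornerE Gj add0r.
rewrite IH derivM derivXsubC !hornerE subrr mul0r addr0 horner_prod.
have -> : \prod_(j <- s) (j - a) = (-1) ^+ size s * \prod_(j <- s) (a - j).
  elim: (s) => [|b t IHt] /=; first by rewrite !big_nil mul1r.
  by rewrite !big_cons IHt exprS; ring.
have -> : \prod_(i <- s) ('X - i%:P).[a] = \prod_(i <- s) (a - i).
  by apply: eq_bigr => j _; rewrite !hornerE.
rewrite /=; ring.
Qed.

Lemma vand_frob s : vand [seq a ^+ q | a <- s] = vand s ^+ q.
Proof.
elim: s => [|a s IH] /=; first by rewrite expr1n.
rewrite big_map IH exprMn -prodrXl; congr (_ * _); apply: eq_bigr => b _.
by have := frobB F3 1 a b; rewrite expn1.
Qed.

Lemma vand_rcons s a : vand (rcons s a) = vand s * \prod_(b <- s) (b - a).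
Proof.
elim: s => [|b s IH] /=; first by rewrite !big_nil.
by rewrite IH -cats1 big_cat big_seq1 big_cons /=; ring.
Qed.

Lemma vand_rot1 a s : vand (rot 1 (a :: s)) = (-1) ^+ size s * vand (a :: s).
Proof.
rewrite rot1_cons vand_rcons /= mulrC mulrA; congr (_ * _).
elim: s => [|b t IHt] /=; first by rewrite !big_nil mul1r.
by rewrite !big_cons IHt exprS; ring.
Qed.

Lemma vand_neq0 s : uniq s -> vand s != 0.
Proof.
elim: s => [|a s IH] /=; first by rewrite oner_neq0.
case/andP=> na us; rewrite mulf_neq0 ?IH // prodf_seq_neq0.
by apply/allP => b bs /=; rewrite subr_eq0; apply: contra na => /eqP ->.
Qed.

Lemma binD2 a b : 'C(a + b, 2) = ('C(a, 2) + 'C(b, 2) + a * b)%N.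
Proof.
elim: a => [|a IH]; first by rewrite add0n mul0n addn0.
by rewrite addSn !binS !bin1 IH mulSn; lia.
Qed.

Lemma root_frob P x : mi P -> x \in rts P -> x ^+ (q ^ (size P).-1) = x.
Proof.
move=> mP xP; have [pP uP] := irr_orbit mP xP.
have : x ^+ (q ^ (size P).-1) \in rts P.
  move: xP; rewrite !mem_rts ?(mi_monic mP) // /root -frob_horner // expf_eq0 => ->.
  by rewrite andbT expn_gt0 (ltnW (finNzRing_gt1 F)).
rewrite (perm_mem pP) => /mapP[i]; rewrite mem_iota add0n => /andP[_ iP] E.
have i0 : i = 0%N; last by rewrite E i0 expn0 expr1.
have Ei : x ^+ (q ^ ((size P).-1 - i)) = x.
  apply: (frob_inj F3 (r := i)) => /=.
  by rewrite -exprM -expnD subnK ?E // ltnW.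
case: (posnP i) => // i0; have := uP.
have lt : ((size P).-1 - i < (size P).-1)%N by lia.
have lt0 : (0 < (size P).-1)%N by lia.
move/(uniqP 0)/(_ ((size P).-1 - i)%N 0%N); rewrite !inE !size_orb => /(_ lt lt0).
rewrite !(nth_map 0%N) ?size_iota // !nth_iota // !add0n Ei expn0 expr1 => /(_ erefl).
lia.
Qed.

(** The discriminant of P is the square of the Vandermonde product of its
    roots, and Frobenius permutes these roots cyclically, an odd permutation
    exactly when the degree is even. *)
Lemma pellet_mi P : mi P ->
  jac P P^`() * (-1) ^+ (size P).-1 * chim1 F ^+ 'C((size P).-1, 2) = -1.
Proof.
move=> mP; have [x xP] := mi_root mP; have [pP uP] := irr_orbit mP xP.
have xn := root_frob mP xP.
have jE : jac P P^`() = chim1 F ^+ 'C((size P).-1, 2) *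
    vand (orb x (size P).-1) ^+ q.-1.
  rewrite /jac /resp -deriv_map (rtsE (mi_monic mP)) !(perm_big _ pP) /=.
  rewrite disc_vand size_orb exprMn /chim1 -!exprM mulnC.
  by rewrite mul2n half_cardK.
have vE : vand (orb x (size P).-1) ^+ q.-1 = - (-1) ^+ (size P).-1.
  apply: (mulfI (vand_neq0 uP)).
  rewrite -exprS prednK ?(ltnW (finNzRing_gt1 F)) // -vand_frob orb_rot //.
  have := mi_size mP; case: (size P) => [|[|n]] // _ /=.
  by rewrite vand_rot1 size_map size_iota exprS /=; ring.
rewrite jE vE; set c := chim1 F ^+ _; set d := (-1) ^+ _.
have c2 : c ^+ 2 = 1 by rewrite -exprM mulnC exprM chim1_sqr expr1n.
have d2 : d ^+ 2 = 1 by rewrite -exprM mulnC exprM sqrrN !expr1n.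
transitivity (- (c ^+ 2 * d ^+ 2)); first by ring.
by rewrite c2 d2 mulr1.
Qed.

(** Pellet's formula. Both sides are multiplicative over coprime factors, the
    right one because the two mixed symbols cancel by reciprocity up to the sign
    by which the binomial coefficients fail to add. *)
Lemma pellet A : A \is monic -> sqf A ->
  (moebius A)%:~R = jac A A^`() * (-1) ^+ (size A).-1 * chim1 F ^+ 'C((size A).-1, 2).
Proof.
move: A; apply: monic_ind => [_|P A mP mA IH s].
  by rewrite moebius1 jac1l size_poly1 /= !mulr1.
have moP := mi_monic mP; have cPA := sqf_coprime s.
have sA : sqf A by apply: (sqf_dvd s); rewrite dvdp_mull.
rewrite moebiusM // rmorphN /= (IH sA) jacMl //.
rewrite (@jac_mod _ P (P * A)^`() (P^`() * A)) ?moP //; last first.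
  by rewrite derivM addrAC subrr add0r dvdp_mulr.
rewrite (@jac_mod _ A (P * A)^`() (P * A^`())) //; last first.
  by rewrite derivM addrK dvdp_mull.
rewrite !jacM (jac_recip moP mA).
have -> : (size (P * A)).-1 = ((size P).-1 + (size A).-1)%N.
  rewrite szM ?monic_neq0 //.
  have := sz_gt0 (monic_neq0 moP); have := sz_gt0 (monic_neq0 mA); lia.
have cAP : coprimep A P by rewrite coprimep_sym.
have := pellet_mi mP; have := jac_sqr F3 mA cAP.
rewrite binD2 !exprD; set u := jac A P; set c := chim1 F ^+ (_ * _).
have : c ^+ 2 = 1 by rewrite -exprM mulnC exprM chim1_sqr expr1n.
set a := jac P _; set b := jac A _; set d := chim1 F ^+ _; set e := chim1 F ^+ _.
set f := (-1) ^+ _; set g := (-1) ^+ _ => c2 u2 h.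
transitivity ((a * f * d) * (b * g * e) * c ^+ 2 * u ^+ 2); last by ring.
by rewrite h c2 u2; ring.
Qed.

End Orbits.

(** * Residues: square roots, cube roots and a sieve *)

Section Residues.
Variable F : finFieldType.
Local Notation q := #|F|.
Local Notation K := (clo F).
Local Notation "p ^K" := (map_poly (emb F) p) (at level 2, format "p ^K").
Local Notation mi := (@monic_irreducible F).
Implicit Types (A B P R Y k z : {poly F}).

Lemma bezout_coprime A B : coprimep A B -> exists u v : {poly F}, u * A + v * B = 1.
Proof. by case/Bezout_eq1_coprimepP=> -[u v] /= E; exists u, v. Qed.

Lemma crt A B u v : coprimep A B -> exists z : {poly F}, A %| z - u /\ B %| z - v.
Proof.
case/bezout_coprime=> s [t E]; exists (u * (t * B) + v * (s * A)); split.
  rewrite (_ : _ - u = (v * s - u * s) * A) ?dvdp_mull //.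
  by rewrite -{2}[u]mulr1 -E; ring.
rewrite (_ : _ - v = (u * t - v * t) * B) ?dvdp_mull //.
by rewrite -{2}[v]mulr1 -E; ring.
Qed.

Lemma inv_mod A R : coprimep A R -> exists B : {poly F}, R %| A * B - 1.
Proof.
case/bezout_coprime=> u [v E]; exists u.
by rewrite (_ : _ - 1 = - v * R) ?dvdp_mull // -E; ring.
Qed.

Lemma coprimep_congr A B R : R %| A - B -> coprimep A R = coprimep B R.
Proof.
case/dvdpP=> C E; have -> : A = C * R + B by rewrite -E subrK.
by rewrite ![coprimep _ R]coprimep_sym coprimep_addl_mul.
Qed.

Section Char3.
Hypothesis F3 : exists e : nat, q = (3 ^ e)%N.

Lemma cubeB A B : (A - B) ^+ 3 = A ^+ 3 - B ^+ 3.
Proof.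
have three : 3%:R = 0 :> {poly F}.
  by rewrite -polyC_natr (pcharf0 (pchar3 F3)).
transitivity (A ^+ 3 - B ^+ 3 - 3%:R * (A ^+ 2 * B - A * B ^+ 2)); first ring.
by rewrite three mul0r subr0.
Qed.

Lemma cubeD A B : (A + B) ^+ 3 = A ^+ 3 + B ^+ 3.
Proof. by have := cubeB A (- B); rewrite !opprK => ->; ring. Qed.

Lemma cubeX e A B : (A - B) ^+ (3 ^ e) = A ^+ (3 ^ e) - B ^+ (3 ^ e).
Proof.
elim: e => [|e IH]; first by rewrite !expr1.
by rewrite !expnSr !exprM IH cubeB.
Qed.

Lemma size_small n (B : {poly F}) R : (size B <= n)%N -> (n < size R)%N -> R %| B -> B = 0.
Proof.
move=> sB sR d; apply/eqP; apply: contraTT d => B0; apply/negP => /(sz_dvd B0); lia.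
Qed.

(** Cubing is additive with trivial kernel modulo a squarefree polynomial, so
    it permutes the finite ring of residues. *)
Lemma cube_root_mod R B : sqf R ->
  exists A : {poly F}, (size A <= (size R).-1)%N /\ R %| A ^+ 3 - B.
Proof.
move=> sR; have R0 := sqf_neq0 sR; set n := (size R).-1.
have nR : (n < size R)%N by have := sz_gt0 R0; rewrite /n; lia.
have szm (C : {poly F}) : (size (C %% R)%R <= n)%N by have := sz_mod C R0; rewrite /n; slia.
pose f (A : {poly_n F}) : {poly_n F} := npolyp n ((A : {poly F}) ^+ 3 %% R).
have fE (A : {poly_n F}) : f A = (A : {poly F}) ^+ 3 %% R :> {poly F} by rewrite /f npolypK.
have finj : injective f.
  move=> A C /(congr1 val); rewrite /= !fE => E; apply/val_inj/eqP => /=.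
  rewrite -subr_eq0; apply/eqP; apply: (size_small (n := n) _ nR).
    by rewrite (leq_trans (size_polyD _ _)) // geq_max size_polyN !size_npoly.
  by apply: (sqf_dvdX (n := 3) sR); rewrite cubeB /dvdp modpD modpN E subrr.
have [g fK gK] := injF_bij finj.
exists (g (npolyp n (B %% R))); split; first exact: size_npoly.
by rewrite /dvdp modpD modpN -fE gK npolypK // subrr.
Qed.

Lemma mi_dvd_root P B (x : K) : mi P -> x \in rts P -> (P %| B) = root B^K x.
Proof.
move=> mP xP; have moP := mi_monic mP; apply/idP/idP => [/dvdpP[C ->]|rx].
  by rewrite rmorphM rootM -(mem_rts _ moP) xP orbT.
apply/negPn; rewrite -mi_coprime // -resp_neq0 // /resp prodf_seq_neq0.
by apply/negP => /allP/(_ _ xP) /=; rewrite (rootP rx) eqxx.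
Qed.

Lemma mi_dvd_XqX P : mi P -> P %| 'X^(q ^ (size P).-1) - 'X.
Proof.
move=> mP; have [x xP] := mi_root mP; rewrite (mi_dvd_root _ mP xP).
by rewrite rmorphB rmorphXn /= map_polyX /root !hornerE root_frob // subrr.
Qed.

(** The square root of Y(x) in the closure is fixed by the Frobenius of the
    residue field by Euler's criterion; this field has q^n elements, so they
    are the values at x of the polynomials of degree less than n. *)
Lemma jac1_sqr_mi P Y : mi P -> jac P Y = 1 -> exists z : {poly F}, P %| Y - z ^+ 2.
Proof.
move=> mP; have [x xP] := mi_root mP; rewrite (jac_euler F3 _ mP xP).
set n := (size P).-1 => j1.
have [z0 z0E] : exists z0 : K, z0 ^+ 2 = (Y^K).[x].
  have /closed_rootP[z0] : size ('X^2 - ((Y^K).[x])%:P) != 1%N.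
    by rewrite size_XnsubC.
  by rewrite /root !hornerE subr_eq0 => /eqP; exists z0.
have q0 : (0 < q ^ n)%N by rewrite expn_gt0 (ltnW (finNzRing_gt1 F)).
have oq : odd (q ^ n) by rewrite oddX card_odd // orbT.
have z0f : z0 ^+ (q ^ n) = z0.
  rewrite -(prednK q0) exprS -[(q ^ n).-1]even_halfK; last by rewrite -subn1 oddB // oq.
  by rewrite -mul2n exprM z0E j1 mulr1.
pose s : seq K := [seq ((val z)^K).[x] | z : {poly_n F}].
have us : uniq s.
  rewrite map_inj_in_uniq ?enum_uniq // => z t _ _ E; apply/val_inj/eqP => /=.
  rewrite -subr_eq0; apply/eqP; apply: (size_small (n := n) (R := P)).
  - by rewrite (leq_trans (size_polyD _ _)) // geq_max size_polyN !size_npoly.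
  - by have := mi_size mP; rewrite /n; lia.
  by rewrite (mi_dvd_root _ mP xP) rmorphB /root !hornerE E subrr.
have [zs|nz] := boolP (z0 \in s).
  case/mapP: zs => z _ Ez; exists (val z).
  rewrite (mi_dvd_root _ mP xP) rmorphB rmorphXn /root !hornerE.
  by rewrite -z0E Ez subrr.
pose G : {poly K} := 'X^(q ^ n) - 'X.
have qn1 : (1 < q ^ n)%N.
  rewrite -(expn0 q) ltn_exp2l ?finNzRing_gt1 // /n; have := mi_size mP; slia.
have sG : size G = (q ^ n).+1.
  by rewrite size_polyDl ?size_polyXn // size_polyN size_polyX ltnS.
have : (size (z0 :: s) < size G)%N.
  apply: max_poly_roots; first by rewrite -size_poly_gt0 sG.
    rewrite /= {1}/root !hornerE z0f subrr eqxx /=; apply/allP => _ /mapP[z _ ->].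
    by rewrite /root !hornerE frob_horner // root_frob // subrr.
  by rewrite /= nz us.
by rewrite sG /= size_map -cardE card_npoly ltnS ltnn.
Qed.

Lemma jac1_sqr R Y : R \is monic -> sqf R ->
  (forall P, mi P -> P %| R -> jac P Y = 1) -> exists z : {poly F}, R %| Y - z ^+ 2.
Proof.
move: R; apply: monic_ind => [_ _|P R mP mR IH s h].
  by exists 0; apply: dvd1p.
have [||z zE] := IH; first by apply: (sqf_dvd s); rewrite dvdp_mull.
  by move=> P' mP' d; apply: h; rewrite ?dvdp_mull.
have [|t tE] := @jac1_sqr_mi P Y mP; first by apply: h; rewrite ?dvdp_mulr.
have cPR := sqf_coprime s; have [w [w1 w2]] := crt t z cPR.
exists w; rewrite Gauss_dvdp //; apply/andP; split.
  rewrite (_ : _ - _ = Y - t ^+ 2 - (w - t) * (w + t)); last ring.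
  by rewrite dvdp_sub // dvdp_mulr.
rewrite (_ : _ - _ = Y - z ^+ 2 - (w - z) * (w + z)); last ring.
by rewrite dvdp_sub // dvdp_mulr.
Qed.

End Char3.

Lemma pigeon_seq (T : finType) (U : eqType) (l : seq U) (r : T -> U -> Prop) :
  (forall x, exists2 u, u \in l & r x u) ->
  (forall x y u, r x u -> r y u -> x = y) -> (#|T| <= size l)%N.
Proof.
move=> h inj; pose f x := s2val (cid2 (h x)).
have fl x : f x \in l by rewrite /f; case: cid2.
have fr x : r x (f x) by rewrite /f; case: cid2.
have finj : injective f by move=> x y E; apply: (inj _ _ (f x)) => //; rewrite E.
rewrite cardE -(size_map f); apply: uniq_leq_size.
  by rewrite map_inj_uniq ?enum_uniq.
by move=> _ /mapP[x _ ->].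
Qed.

Lemma large_factors L R : R != 0 -> exists ps : seq {poly F},
  (size ps * L < size R)%N /\
  forall P, mi P -> P %| R -> (L < size P)%N -> P \in ps.
Proof.
move=> R0; have l0 : (lead_coef R)^-1 != 0 by rewrite invr_eq0 lead_coef_eq0.
have mR : (lead_coef R)^-1 *: R \is monic.
  by rewrite monicE lead_coefZ mulVf // lead_coef_eq0.
suff gen A : A \is monic -> exists ps : seq {poly F},
    (size ps * L < size A)%N /\
    forall P, mi P -> P %| A -> (L < size P)%N -> P \in ps.
  have [ps []] := gen _ mR; rewrite size_scale // => s h.
  by exists ps; split => // P mP d; apply: h; rewrite // dvdpZr.
move: A; apply: monic_ind => [|P A mP mA [ps [s h]]].
  by exists [::]; rewrite size_poly1; split => // P mP; rewrite mi_dvd1.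
have sPA : size (P * A) = (size P + size A).-1 by rewrite szM ?(mi_neq0 mP) ?(monic_neq0 mA).
have sP := mi_size mP; have sA := sz_gt0 (monic_neq0 mA).
have [lP|lP] := ltnP L (size P).
  exists (P :: ps); split; first by rewrite sPA /= mulSn; slia.
  move=> Q mQ; rewrite mi_dvdM // inE => /orP[|d lQ]; first by rewrite mi_dvd_eq // => ->.
  by rewrite h // orbT.
exists ps; split; first by rewrite sPA; slia.
move=> Q mQ; rewrite mi_dvdM // => /orP[|d lQ]; last by rewrite h.
by rewrite mi_dvd_eq // => /eqP ->; rewrite ltnNge lP.
Qed.

(** Two coprimality conditions are imposed on the same k, because a solution of
    a1 Y1 - a2 Y2 = E moves along a1 + k Y2 and a2 + k Y1. *)
Definition sieve_ok D rho := forall R1 R2 A1 A2 B1 B2 : {poly F},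
  R1 != 0 -> R2 != 0 -> (size R1 + size R2 <= D)%N ->
  (forall P, mi P -> P %| R1 -> P %| A1 -> P %| B1 -> False) ->
  (forall P, mi P -> P %| R2 -> P %| A2 -> P %| B2 -> False) ->
  exists k : {poly F}, [/\ (size k <= rho)%N, coprimep (A1 + k * B1) R1 &
                coprimep (A2 + k * B2) R2].

Section Sieve.
Hypothesis F3 : exists e : nat, q = (3 ^ e)%N.
Variables R1 R2 A1 A2 B1 B2 : {poly F}.
Hypothesis ok1 : forall P, mi P -> P %| R1 -> P %| A1 -> P %| B1 -> False.
Hypothesis ok2 : forall P, mi P -> P %| R2 -> P %| A2 -> P %| B2 -> False.

Let bad (i : bool) P k := if i then P %| R1 /\ P %| A1 + k * B1
                          else P %| R2 /\ P %| A2 + k * B2.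

Let bad_inj i P k k' : mi P -> bad i P k -> bad i P k' -> P %| k - k'.
Proof.
have gen A B : (P %| A -> P %| B -> False) ->
    mi P -> P %| A + k * B -> P %| A + k' * B -> P %| k - k'.
  move=> h mP d d'; have := dvdp_sub d d'.
  rewrite (_ : _ - _ = (k - k') * B); last ring.
  rewrite mi_dvdM // => /orP[//|dB]; case: h => //.
  by move: d; rewrite dvdp_addl // dvdp_mull.
by move=> mP; case: i => -[dR d] [_ d']; apply: gen d d' => //; [apply: ok1|apply: ok2].
Qed.

(** Three residues 0, 1, -1 are available at each irreducible factor and at
    most two are excluded. *)
Let small_factors W : W \is monic ->
  exists k, forall i P, mi P -> P %| W -> ~ bad i P k.
Proof.
move: W; apply: monic_ind => [|P W mP mW [k hk]].
  by exists 0 => i P mP; rewrite mi_dvd1.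
have [dP|nP] := boolP (P %| W).
  exists k => i Q mQ; rewrite mi_dvdM // => /orP[|d]; last exact: hk.
  by rewrite mi_dvd_eq // => /eqP ->; apply: hk.
have badW i Q (c : F) : mi Q -> Q %| W -> ~ bad i Q (k + c%:P * W).
  move=> mQ dQ hb; apply: (hk i Q mQ dQ); move: hb.
  have aux A B : (Q %| A + (k + c%:P * W) * B) -> Q %| A + k * B.
    rewrite mulrDl addrA -mulrA mulrCA => h; move: h; rewrite dvdp_addl //.
    by rewrite dvdp_mulr.
  by rewrite /bad; case: i => -[? /aux].
suff [c hc] : exists c : F, forall i, ~ bad i P (k + c%:P * W).
  exists (k + c%:P * W) => i Q mQ; rewrite mi_dvdM // => /orP[|d]; last exact: badW.
  by rewrite mi_dvd_eq // => /eqP ->.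
have cinj i (c c' : F) : bad i P (k + c%:P * W) -> bad i P (k + c'%:P * W) -> c = c'.
  move=> b b'; have := bad_inj mP b b'.
  rewrite (_ : _ - _ = (c - c')%:P * W); last by rewrite polyCB; ring.
  rewrite mi_dvdM // (negPf nP) orbF => d; apply/eqP; rewrite -subr_eq0.
  apply: contraTT d => c0; apply/negP => d.
  by have := sz_dvd (B := (c - c')%:P) _ d; rewrite polyC_eq0 c0 size_polyC c0 leqNgt mi_size // => /(_ isT).
apply: contrapT => /forallNP nc.
have ex c : exists i, bad i P (k + c%:P * W).
  by have /existsNP[i /contrapT b] := nc c; exists i.
have one0 : (1 : F) <> 0 by apply/eqP/oner_neq0.
have mone0 : (-1 : F) <> 0 by apply/eqP; rewrite oppr_eq0 oner_neq0.
have mone1 : (-1 : F) <> 1.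
  apply/eqP; rewrite -subr_eq0 -opprD oppr_eq0 -(dvdn_pcharf (pchar3 F3) 2) //.
case: (ex 0) (ex 1) (ex (-1)) => [[] b0] [[] b1] [[] b2].
- exact: one0 (cinj _ _ _ b1 b0).
- exact: one0 (cinj _ _ _ b1 b0).
- exact: mone0 (cinj _ _ _ b2 b0).
- exact: mone1 (cinj _ _ _ b2 b1).
- exact: mone1 (cinj _ _ _ b2 b1).
- exact: mone0 (cinj _ _ _ b2 b0).
- exact: one0 (cinj _ _ _ b1 b0).
- exact: one0 (cinj _ _ _ b1 b0).
Qed.

(** Irreducible factors of degree at most L are handled one after the other,
    modulo a polynomial W which all of them divide; each of the fewer than
    q^(L+1) larger factors then excludes a single s of degree at most L in
    k + sW. *)
Lemma sieve_step L : R1 != 0 -> R2 != 0 ->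
  (size R1 + size R2 <= L.+1 * q ^ L.+1)%N ->
  exists k : {poly F}, [/\ (size k <= q ^ L.+1 + L.+1)%N, coprimep (A1 + k * B1) R1 &
                coprimep (A2 + k * B2) R2].
Proof.
move=> R10 R20 sR.
suff [k [sk hk]] : exists k, (size k <= q ^ L.+1 + L.+1)%N /\
    forall i P, mi P -> ~ bad i P k.
  exists k; split => //; apply: coprimep_mi => P mP d dR.
    exact: (hk true P).
  exact: (hk false P).
have q1 := finNzRing_gt1 F.
have [W [mW sW hW]] : exists W : {poly F}, [/\ W \is monic, (size W <= q ^ L.+1)%N &
    forall P, mi P -> (size P <= L.+1)%N -> P %| W].
  elim: (L) => [|l [W [mW sW hW]]].
    exists 1; split; rewrite ?monic1 ?size_poly1 ?expn1 ?(ltnW q1) //.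
    by move=> P /mi_size; lia.
  have qp : (1 < q ^ l.+1)%N by rewrite -(expn0 q) ltn_exp2l.
  have sV : size ('X^(q ^ l.+1) - 'X : {poly F}) = (q ^ l.+1).+1.
    by rewrite size_polyDl ?size_polyXn // size_polyN size_polyX ltnS.
  have mV : 'X^(q ^ l.+1) - 'X \is @monic F.
    by rewrite monicE lead_coefDl ?lead_coefXn // size_polyN size_polyX size_polyXn ltnS.
  exists (W * ('X^(q ^ l.+1) - 'X)); split; first by rewrite monicMr.
    rewrite szM ?monic_neq0 // sV.
    have : (2 * q ^ l.+1 <= q ^ l.+2)%N by rewrite [(q ^ l.+2)%N]expnS leq_mul2r q1 orbT.
    lia.
  move=> P mP; rewrite leq_eqVlt => /orP[/eqP sP|]; last first.
    by rewrite ltnS => sP; rewrite dvdp_mulr // hW.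
  by rewrite dvdp_mull //; have := mi_dvd_XqX F3 mP; rewrite sP.
have [k0 hk0] := small_factors mW; pose k := k0 %% W.
have W0 := monic_neq0 mW.
have hk (s : {poly F}) i P : mi P -> P %| W -> ~ bad i P (k + s * W).
  move=> mP dW hb; apply: (hk0 i P mP dW); move: hb.
  have aux A B : (P %| A + (k + s * W) * B) -> P %| A + k0 * B.
    rewrite [in X in _ -> X](divp_eq k0 W) -/k; set d := k0 %/ W.
    rewrite (_ : A + (d * W + k) * B = A + (k + s * W) * B + (d - s) * B * W); last ring.
    by move=> h; rewrite dvdp_add // dvdp_mull.
  by rewrite /bad; case: i => -[? /aux].
have [ps1 [sps1 hps1]] := large_factors L.+1 R10.
have [ps2 [sps2 hps2]] := large_factors L.+1 R20.
pose l := [seq (true, P) | P <- ps1] ++ [seq (false, P) | P <- ps2].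
have sl : (size l < q ^ L.+1)%N.
  rewrite size_cat !size_map; move: sR sps1 sps2; nia.
have : exists s : {poly_(L.+1) F}, forall i P, mi P -> ~ bad i P (k + (val s) * W).
  apply: contrapT => /forallNP nh.
  pose r (s : {poly_(L.+1) F}) (u : bool * {poly F}) :=
    [/\ mi u.2, (L.+1 < size u.2)%N & bad u.1 u.2 (k + val s * W)].
  have : (#|{poly_(L.+1) F}| <= size l)%N.
    apply: (pigeon_seq (r := r)) => [s|s s' [i P] [/= mP sP b] [_ _ /= b']].
      have /existsNP[i /existsNP[P]] := nh s.
      move/not_implyP=> [mP /contrapT b].
      have sP : (L.+1 < size P)%N.
        by rewrite ltnNge; apply/negP => /(hW _ mP) /(hk (val s) i _ mP).
      exists (i, P); last by split.
      rewrite mem_cat; apply/orP.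
      case: i b => -[dR _]; [left|right]; apply: map_f; [exact: hps1|exact: hps2].
    have nW : ~~ (P %| W) by apply/negP => /(hk (val s) i _ mP).
    have := bad_inj mP b b'.
    rewrite (_ : _ - _ = (val s - val s') * W); last ring.
    rewrite mi_dvdM // (negPf nW) orbF => d; apply/val_inj/eqP => /=.
    rewrite -subr_eq0; apply/eqP; apply: (size_small _ sP d).
    by rewrite (leq_trans (size_polyD _ _)) // geq_max size_polyN !size_npoly.
  by rewrite card_npoly leqNgt sl.
case=> s hs; exists (k + val s * W); split => //.
rewrite (leq_trans (size_polyD _ _)) // geq_max; apply/andP; split.
  by have := sz_mod k0 W0; rewrite -/k; slia.
by have := szM_leq (val s) W; have ss : (size (val s) <= L.+1)%N := size_npoly s; slia.
Qed.

End Sieve.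

Lemma sieve_okP D L rho : (exists e : nat, q = (3 ^ e)%N) ->
  (D <= L.+1 * q ^ L.+1)%N -> (q ^ L.+1 + L.+1 <= rho)%N -> sieve_ok D rho.
Proof.
move=> F3 DL Lr R1 R2 A1 A2 B1 B2 R10 R20 sR ok1 ok2.
have [|k [sk c1 c2]] := sieve_step F3 ok1 ok2 (L := L) R10 R20; first exact: leq_trans DL.
by exists k; split => //; apply: leq_trans Lr.
Qed.

End Residues.

(** * Nontriviality of a quadratic character on monic polynomials of given degree *)

Section Bivariate.
Variable F : finFieldType.
Implicit Types (E G : {poly {poly F}}) (B R u w p : {poly F}).
Local Notation mi := (@monic_irreducible F).

Definition coef_bounded n E := forall i, (size (E`_i)%R <= n)%N.

Lemma coef_boundedM m n E G :
  coef_bounded m E -> coef_bounded n G -> coef_bounded (m + n) (E * G).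
Proof.
move=> bE bG i; rewrite coefM; apply: (leq_trans (size_sum _ _ _)).
apply/bigmax_leqP => j _; apply: (leq_trans (szM_leq _ _)).
have := bE j; have := bG (i - j)%N; slia.
Qed.

Lemma coef_boundedB m n E G :
  coef_bounded m E -> coef_bounded n G -> coef_bounded (maxn m n) (E - G).
Proof.
move=> bE bG i; rewrite coefB (leq_trans (szB _ _)) // geq_max.
by rewrite !leq_max bE bG orbT.
Qed.

Lemma coef_boundedW m n E : (m <= n)%N -> coef_bounded m E -> coef_bounded n E.
Proof. by move=> mn b i; apply: leq_trans mn. Qed.

(** Substituting a power X^n for y loses nothing when the coefficients have
    degree below n: the blocks do not overlap. *)
Lemma horner_Xn_inj n E : coef_bounded n E -> E.['X^n] = 0 -> E = 0.
Proof.
elim/poly_ind: E => // E c IH b; rewrite !hornerE => E0.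
have sc : (size c <= n)%N by have := b 0%N; rewrite coefD coefMX coefC add0r.
have c0 : c = 0.
  apply/polyP => i; rewrite coef0; case: (ltnP i n) => [lin|lni].
    by have := congr1 (fun u : {poly F} => u`_i) E0; rewrite coefD coefMXn lin add0r coef0.
  by rewrite nth_default // (leq_trans sc).
have E10 : E.['X^n] = 0.
  apply/eqP; move: E0; rewrite c0 addr0 => /eqP; rewrite mulf_eq0.
  by rewrite (negPf (monic_neq0 (monicXn _ n))) orbF.
rewrite c0 IH ?mul0r ?addr0 // => i.
by have := b i.+1; rewrite c0 addr0 coefMX.
Qed.

(** The exponent of p is even on the left and odd on the right. *)
Lemma sqr_neq_simple p B u w : mi p -> p %| B -> ~~ (p ^+ 2 %| B) -> w != 0 ->
  u ^+ 2 <> B * w ^+ 2.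
Proof.
move=> mp dB nB; have [n] := ubnP (size w); elim: n u w => // n IH u w sw w0 E.
have p0 := mi_neq0 mp; case/dvdpP: dB => C EB.
have /dvdpP[v Ev] : p %| u.
  by rewrite -(mi_dvdX _ mp (isT : (0 < 2)%N)) E EB -mulrA mulrCA dvdp_mulr.
have E1 : p * v ^+ 2 = C * w ^+ 2.
  by apply: (mulfI p0); move: E; rewrite Ev EB => E; transitivity ((v * p) ^+ 2); [ring | rewrite E; ring].
have : p %| C * w ^+ 2 by rewrite -E1 dvdp_mulr.
rewrite mi_dvdM // => /orP[dC|].
  by case/negP: nB; rewrite EB expr2 dvdp_mul.
rewrite mi_dvdX // => /dvdpP[t Et].
have t0 : t != 0 by apply: contraNneq w0 => t0; rewrite Et t0 mul0r.
apply: (IH v t) => //.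
  by have := mi_size mp; have := sz_gt0 t0; move: sw; rewrite Et szM //; slia.
by apply: (mulfI p0); rewrite E1 Et EB; ring.
Qed.

End Bivariate.

Section QuadraticCharacter.
Variable F : finFieldType.
Local Notation q := #|F|.
Local Notation K := (clo F).
Local Notation "p ^K" := (map_poly (emb F) p) (at level 2, format "p ^K").
Local Notation mi := (@monic_irreducible F).
Hypothesis F3 : exists e : nat, q = (3 ^ e)%N.
Implicit Types (B R Y p : {poly F}).

Lemma pchar3_nat (R : comNzRingType) e : 3%N \in [pchar R] -> [pchar R].-nat (3 ^ e)%N.
Proof. by move=> R3; rewrite pnatX; apply/orP; left; rewrite pnatE. Qed.

Lemma frob3_sum (R : comNzRingType) (I : finType) (f : I -> R) e : 3%N \in [pchar R] ->
  (\sum_i f i) ^+ (3 ^ e) = \sum_i f i ^+ (3 ^ e).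
Proof.
move=> R3; apply: (big_morph (fun x => x ^+ (3 ^ e))) => [x y|].
  by rewrite exprDn_pchar // pchar3_nat.
by rewrite expr0n gtn_eqF // expn_gt0.
Qed.

Lemma pchar3_poly : 3%N \in [pchar {poly F}].
Proof. by rewrite pchar_poly pchar3. Qed.

(** More unknown coefficients than equations: the map is additive because of
    the exponents 3^e. *)
Lemma auxiliary_relation e n A B :
  ((3 ^ e * A + n + size B * 3 ^ e) < A * (2 * n))%N ->
  exists a c : 'I_n -> {poly F},
    [/\ forall i, (size (a i) <= A)%N /\ (size (c i) <= A)%N,
        exists i, a i != 0 \/ c i != 0 &
        \sum_i (a i ^+ (3 ^ e) * 'X^i +
                c i ^+ (3 ^ e) * 'X^i * B ^+ ((3 ^ e).+1)./2) = 0].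
Proof.
set P := (3 ^ e)%N; set M := (_ + _)%N => lt.
have P0 : (0 < P)%N by rewrite expn_gt0.
pose phi (x : {ffun 'I_n * bool -> {poly_A F}}) : {poly F} :=
  \sum_i ((val (x (i, false))) ^+ P * 'X^i +
          (val (x (i, true))) ^+ P * 'X^i * B ^+ (P.+1)./2).
have szX (a : {poly F}) i : (size a <= A)%N -> (i < n)%N ->
    (size (a ^+ P * 'X^i)%R <= P * A + n)%N.
  move=> sa lin; apply: (leq_trans (szM_leq _ _)).
  have := size_poly_exp_leq a P; rewrite size_polyXn.
  have : ((size a).-1 * P <= P * A.-1)%N by rewrite mulnC leq_mul //; slia.
  case: (A) sa => [|A'] sa; slia.
have sphi x : (size (phi x) <= M)%N.
  apply: (leq_trans (size_sum _ _ _)); apply/bigmax_leqP => i _.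
  apply: (leq_trans (szD _ _)); rewrite geq_max; apply/andP; split.
    by apply: leq_trans (szX _ _ _ (ltn_ord i)) _; [exact: size_npoly | rewrite /M; slia].
  apply: (leq_trans (szM_leq _ _)).
  have h : (size (val (x (i, true)) ^+ P * 'X^i)%R <= P * A + n)%N.
    by apply: szX (ltn_ord i); apply: size_npoly.
  have := size_poly_exp_leq B (P.+1)./2.
  have : ((size B).-1 * (P.+1)./2 <= size B * P)%N by apply: leq_mul; slia.
  rewrite /M; slia.
have [x [y [xy E]]] : exists x y, x <> y /\ phi x = phi y.
  apply: contrapT => nh; have inj : injective (fun x => npolyp M (phi x)).
    move=> x y /(congr1 val) /=; rewrite !npolypK // => E.
    by apply: contrapT => xy; apply: nh; exists x, y.
  have := leq_card _ inj; rewrite card_ffun card_prod card_bool card_ord !card_npoly.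
  rewrite -expnM leq_exp2l ?finNzRing_gt1 // leqNgt [(n * 2)%N]mulnC /M.
  by rewrite lt.
exists (fun i => val (x (i, false)) - val (y (i, false))).
exists (fun i => val (x (i, true)) - val (y (i, true))); split.
- move=> i; split; apply: (leq_trans (szB _ _)); rewrite geq_max; apply/andP; split; exact: size_npoly.
- apply: contrapT => /forallNP nh; apply: xy; apply/ffunP => -[i b]; apply: val_inj.
  have /not_orP[/negP/negPn/eqP h1 /negP/negPn/eqP h2] := nh i.
  by apply/eqP; rewrite -subr_eq0; case: b; rewrite ?h1 ?h2.
transitivity (phi x - phi y); last by rewrite E subrr.
rewrite /phi -sumrB; apply: eq_bigr => i _.
by rewrite !(cubeX F3); ring.
Qed.

Lemma fixed_points r : (0 < r)%N ->
  exists s : seq K, [/\ uniq s, size s = (q ^ r)%N & forall x, x \in s -> x ^+ (q ^ r) = x].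
Proof.
move=> r0; set m := (q ^ r)%N.
have m1 : (1 < m)%N by rewrite -(expn0 q) ltn_exp2l ?finNzRing_gt1.
have sG : size ('X^m - 'X : {poly F}) = m.+1.
  by rewrite size_polyDl ?size_polyXn // size_polyN size_polyX ltnS.
have mG : 'X^m - 'X \is @monic F.
  by rewrite monicE lead_coefDl ?lead_coefXn // size_polyN size_polyX size_polyXn ltnS.
exists (rts ('X^m - 'X)); split; last 2 first.
- by rewrite size_rts // sG.
- move=> x; rewrite mem_rts // rmorphB rmorphXn /= map_polyX /root !hornerE subr_eq0.
  by move/eqP.
have m0 : m%:R = 0 :> F.
  apply/eqP; rewrite /m natrX expf_eq0 r0 /=; have := finNzRing_gt1 F.
  have [[|e] ->] := F3; first by rewrite expn0.
  by move=> _; rewrite natrX expf_eq0 (pcharf0 (pchar3 F3)) eqxx.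
rewrite -separable_prod_XsubC -rtsE // separable_map separable_poly.unlock.
rewrite derivB derivXn derivX -mulr_natl -polyC_natr m0 polyC0 mul0r sub0r.
have -> : -1 = (-1 : F) *: 1 :> {poly F} by rewrite scaleN1r.
by rewrite coprimepZr ?oppr_eq0 ?oner_neq0 ?coprimep1.
Qed.

(** Stepanov's method. If the symbol of B is 1 at every monic Y of degree r
    prime to R, then B(x)^((Q-1)/2) = 1 with Q = q^r at all x in the field of
    Q elements outside the roots of R. Write Q = 3^e Q'. Under that condition
    the polynomial g = sum_i (a_i + c_i B^((1+Q')/2)) X^(iQ') has at these x
    the 3^e-th power sum_i (a_i^(3^e) + c_i^(3^e) B^((3^e+1)/2)) x^i, which
    the auxiliary relation makes 0. As g has degree below Q - deg R, it is 0;
    separating the powers of X^Q', this makes B a square up to a constant. *)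
Lemma quadratic_character_nontrivial B R p r e :
  mi p -> p %| B -> ~~ (p ^+ 2 %| B) -> B %| R -> R != 0 ->
  (2 * size B < 3 ^ e)%N ->
  (3 ^ e * (2 * (3 ^ e * (size B + 2)) + 2 * size B + size R + 1) <= q ^ r)%N ->
  exists Y : {poly F}, [/\ Y \is monic, size Y = r.+1, coprimep Y R & jac Y B = -1].
Proof.
move=> mp pB npB BR R0 Pe big; apply: contrapT => /forallNP none.
set P := (3 ^ e)%N in Pe big *; set b := size B in Pe big *.
have B0 : B != 0 by apply: contraNneq R0 => B0; rewrite -dvd0p -B0.
have P0 : (0 < P)%N by rewrite expn_gt0.
have b0 : (0 < b)%N := sz_gt0 B0.
have r0 : (0 < r)%N.
  by rewrite lt0n; apply/eqP => r0; move: big; rewrite r0 expn0; nia.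
have [Q' [EQ oQ']] : exists Q', (q ^ r = P * Q')%N /\ exists e', Q' = (3 ^ e')%N.
  have [k qE] := F3; have E : (q ^ r = 3 ^ (k * r))%N by rewrite qE expnM.
  have le : (e <= k * r)%N.
    rewrite -(@leq_exp2l 3) // -E; apply: leq_trans big; rewrite -/P; nia.
  by exists (3 ^ (k * r - e))%N; split; [rewrite E /P -expnD subnKC | exists (k * r - e)%N].
set A := (P * (b + 2))%N in big.
have Q'big : (2 * A + 2 * b + size R + 1 <= Q')%N.
  by move: big; rewrite EQ leq_pmul2l.
set n := (P - b)%N; set t := (Q'.+1)./2; set h := (P.+1)./2.
have [|a [c [sac nz rel]]] := @auxiliary_relation e n A B.
  by rewrite -/P /n /A -/b; nia.
rewrite -/P -/h in rel.
have frobK (x : K) (i : nat) : x ^+ (q ^ r) = x -> x ^+ (i * (q ^ r)) = x ^+ i.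
  by move=> xQ; rewrite mulnC exprM xQ.
have jB (x : K) : x ^+ (q ^ r) = x -> ~~ root R^K x -> (B^K).[x] ^+ ((q ^ r).-1)./2 = 1.
  move=> xr nR; have [Y [mY pY sY]] := orbit_poly F3 xr.
  have cYR : coprimep Y R.
    rewrite -resp_neq0 // /resp (perm_big _ pY) big_map prodf_seq_neq0.
    by apply/allP => i _ /=; rewrite -frob_horner // expf_neq0.
  rewrite -(jac_orbit F3 _ pY).
  have cYB : coprimep Y B by apply: coprimep_dvdl BR cYR.
  case: (jac_pm1 F3 mY cYB) => // j; case: (none Y); split => //.
pose g := \sum_(i < n) (a i + c i * B ^+ t) * 'X^(i * Q').
have hE : ((q ^ r).-1./2 + h)%N = (t * P)%N.
  have [e' Ee'] := oQ'; have oP : odd P by rewrite oddX orbT.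
  have oQ : odd Q' by rewrite Ee' oddX orbT.
  have oq : odd (q ^ r) by rewrite EQ oddM oP oQ.
  have e1 : h.*2 = P.+1 by rewrite /h even_halfK //= oP.
  have e2 : t.*2 = Q'.+1 by rewrite /t even_halfK //= oQ.
  have e3 : ((q ^ r).-1)./2.*2 = (q ^ r).-1.
    by rewrite even_halfK // -subn1 oddB ?oq // expn_gt0 (ltnW (finNzRing_gt1 F)).
  apply/eqP; rewrite -(eqn_pmul2l (isT : (0 < 2)%N)) mulnDr !mul2n e1 e3 doubleMl e2 EQ.
  have PQ0 : (0 < P * Q')%N by rewrite -EQ expn_gt0 (ltnW (finNzRing_gt1 F)).
  rewrite mulSn [(Q' * P)%N]mulnC; apply/eqP; move: PQ0; set m := (P * Q')%N; lia.
have groot (x : K) : x ^+ (q ^ r) = x -> ~~ root R^K x -> root g^K x.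
  move=> xr nR; suff : (g^K).[x] ^+ P == 0 by rewrite expf_eq0 P0.
  have := congr1 (fun u => (map_poly (emb F) u).[x]) rel.
  rewrite /= rmorph0 horner0 => rel0; rewrite -rel0 /g !rmorph_sum !horner_sum.
  rewrite frob3_sum ?pchar3_clo //; apply/eqP; apply: eq_bigr => i _.
  rewrite !rmorphM !rmorphD !rmorphM !rmorphXn /= !map_polyX !hornerE.
  rewrite exprMn exprDn_pchar ?pchar3_nat ?pchar3_clo // exprMn -!exprM.
  rewrite -mulnA [(Q' * _)%N]mulnC -EQ frobK // -hE exprD jB // mul1r.
  by rewrite -/P; ring.
have sg : (size (g * R)%R <= q ^ r)%N.
  apply: (leq_trans (szM_leq _ _)).
  suff : (size g <= 2 * A + 2 * b + (P - 1) * Q')%N by rewrite EQ; nia.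
  apply: (leq_trans (size_sum _ _ _)); apply/bigmax_leqP => i _.
  apply: (leq_trans (szM_leq _ _)); rewrite size_polyXn.
  have h1 := szD (a i) (c i * B ^+ t); have h2 := szM_leq (c i) (B ^+ t).
  have h3 := size_poly_exp_leq B t; have [h4 h5] := sac i.
  have iQ : (i * Q' <= (n - 1) * Q')%N by rewrite leq_mul2r; have := ltn_ord i; lia.
  have bt : ((size B).-1 * t <= (b - 1) * Q')%N.
    by rewrite leq_mul // -?subn1 // /t; lia.
  have e1 : ((n - 1) * Q' + (b - 1) * Q' <= (P - 1) * Q')%N.
    by rewrite -mulnDl leq_mul2r /n; lia.
  slia.
have g0 : g = 0.
  suff gR : g * R = 0 by move/eqP: gR; rewrite mulf_eq0 (negPf R0) orbF => /eqP.
  have [s [us ss fs]] := fixed_points r0.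
  apply/eqP; apply: contraTT sg => gR; rewrite -ltnNge -ss -(size_map_poly (emb F)).
  apply: max_poly_roots => //; first by rewrite map_poly_eq0.
  apply/allP => x xs; rewrite rmorphM rootM /=.
  have [//|nR] := boolP (root R^K x); first by rewrite orbT.
  by rewrite groot // fs.
pose ay : {poly {poly F}} := \sum_(i < n) (a i)%:P * 'X^i.
pose cy : {poly {poly F}} := \sum_(i < n) (c i)%:P * 'X^i.
pose By : {poly {poly F}} := \sum_(i < b) ((B`_i) ^+ Q')%:P%:P * 'X^i.
have coef_y (f : 'I_n -> {poly F}) (i : nat) : (\sum_(j < n) (f j)%:P * 'X^j)`_i =
    if insub i is Some j then f j else 0 :> {poly F}.
  rewrite coef_sum; case: insubP => [j _ <-|ni].
    rewrite (bigD1 j) //= coefCM coefXn eqxx mulr1 big1 ?addr0 // => k kj.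
    by rewrite coefCM coefXn eq_sym (negPf (_ : k != j :> nat)) ?mulr0.
  rewrite big1 // => k _; rewrite coefCM coefXn; case: eqP => [E|]; last by rewrite mulr0.
  by move: ni; rewrite E ltn_ord.
have ba : coef_bounded A ay.
  by move=> i; rewrite coef_y; case: insub => [j|]; rewrite ?size_poly0 //; case: (sac j).
have bc : coef_bounded A cy.
  by move=> i; rewrite coef_y; case: insub => [j|]; rewrite ?size_poly0 //; case: (sac j).
have bB : coef_bounded 1 By.
  move=> i; rewrite coef_sum; apply: (leq_trans (size_sum _ _ _)).
  apply/bigmax_leqP => j _; rewrite coefCM coefXn; case: eqP => _.
    by rewrite mulr1 size_polyC leq_b1.
  by rewrite mulr0 size_poly0.
have bBC : coef_bounded b (B%:P : {poly {poly F}}).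
  by move=> i; rewrite coefC; case: eqP; rewrite ?size_poly0.
have ayE : ay.['X^Q'] = \sum_(i < n) a i * 'X^(i * Q').
  rewrite /ay horner_sum; apply: eq_bigr => i _.
  by rewrite !hornerE -exprM mulnC.
have cyE : cy.['X^Q'] = \sum_(i < n) c i * 'X^(i * Q').
  rewrite /cy horner_sum; apply: eq_bigr => i _.
  by rewrite !hornerE -exprM mulnC.
have ByE : By.['X^Q'] = B ^+ Q'.
  have [e' Ee'] := oQ'; rewrite [in RHS]Ee' -[in RHS](coefK B) poly_def frob3_sum ?pchar3_poly //.
  rewrite /By horner_sum; apply: eq_bigr => i _; rewrite !hornerE exprZn -mul_polyC.
  by rewrite -Ee' -!exprM mulnC.
have E1 : ay ^+ 2 - B%:P * By * cy ^+ 2 = 0.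
  apply: (@horner_Xn_inj _ Q').
    apply: (@coef_boundedW _ (maxn (A + A) (b + 1 + (A + A)))); first by lia.
    by apply: coef_boundedB; rewrite ?expr2; repeat apply: coef_boundedM.
  rewrite !hornerE ayE cyE ByE.
  have -> : \sum_(i < n) a i * 'X^(i * Q') = - (B ^+ t * \sum_(i < n) c i * 'X^(i * Q')).
    apply/eqP; rewrite -subr_eq0 opprK mulr_sumr -big_split /= -[X in _ == X]g0.
    by apply/eqP; apply: eq_bigr => i _ /=; ring.
  rewrite -exprS (_ : Q'.+1 = t * 2)%N; first by rewrite exprM /=; ring.
  have [e' Ee'] := oQ'; have oQ : odd Q' by rewrite Ee' oddX orbT.
  by rewrite muln2 /t even_halfK //= oQ.
have E2 : ay ^+ 2 = B%:P * By * cy ^+ 2 by apply/eqP; rewrite -subr_eq0 E1.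
have cy0 : cy != 0.
  apply/eqP => cy0; have ay0 : ay = 0.
    have ay2 : ay ^+ 2 = 0 by rewrite E2 cy0 expr0n mulr0.
    by apply/eqP; move/eqP: ay2; rewrite expf_eq0.
  have [i] := nz; have ayi : ay`_i = a i by rewrite /ay coef_y valK.
  have cyi : cy`_i = c i by rewrite /cy coef_y valK.
  by rewrite -ayi -cyi ay0 cy0 !coef0 eqxx => -[].
have := congr1 lead_coef E2; rewrite !expr2 !lead_coefM lead_coefC -!expr2.
have [d d0 ->] : exists2 d : F, d != 0 & lead_coef By = d%:P.
  have By0 : By != 0.
    apply: contraNneq B0 => By0; have := ByE; rewrite By0 horner0 => /esym/eqP.
    by rewrite expf_eq0 => /andP[].
  have l0 : lead_coef By != 0 by rewrite lead_coef_eq0.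
  have s1 : (size (lead_coef By) <= 1)%N by apply: bB.
  exists (lead_coef By)`_0; last exact: size1_polyC.
  by rewrite -polyC_eq0 -size1_polyC.
move=> E3; apply: (@sqr_neq_simple _ p (d%:P * B) (lead_coef ay) (lead_coef cy)) => //.
- by rewrite dvdp_mull.
- by rewrite mul_polyC dvdpZr.
- by rewrite lead_coef_eq0.
by rewrite E3; ring.
Qed.

(** The nontriviality in the form in which it is used, uniform in B and R; the
    factor p witnesses that B is not a square up to a constant. *)
Definition character_ok D r := forall B R p, mi p -> p %| B -> ~~ (p ^+ 2 %| B) ->
  B %| R -> R != 0 -> (size R <= D)%N ->
  exists Y : {poly F}, [/\ Y \is monic, size Y = r.+1, coprimep Y R & jac Y B = -1].

Lemma character_okP D r e : (2 * D < 3 ^ e)%N ->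
  (3 ^ e * (2 * (3 ^ e * (D + 2)) + 3 * D + 1) <= q ^ r)%N -> character_ok D r.
Proof.
move=> De big B R p mp pB nB BR R0 sR.
have sB : (size B <= D)%N by apply: leq_trans sR; apply: sz_dvd.
apply: (quadratic_character_nontrivial (p := p) (e := e)) => //; first lia.
apply: leq_trans big; rewrite leq_mul //.
have : (3 ^ e * (size B + 2) <= 3 ^ e * (D + 2))%N by rewrite leq_mul // leq_add2r.
slia.
Qed.

End QuadraticCharacter.

(** * Short combinations of two moduli and approximate square roots *)

Section Tools.
Variable F : finFieldType.
Local Notation q := #|F|.
Local Notation mi := (@monic_irreducible F).
Hypothesis F3 : exists e : nat, q = (3 ^ e)%N.
Implicit Types (A B E R Y N k z s : {poly F}).

Lemma size_divM A B C m n : B != 0 -> A = C * B -> size B = m.+1 ->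
  (size A <= n + m)%N -> (size C <= n)%N.
Proof.
move=> B0 EA sB; have [->|C0] := eqVneq C 0; first by rewrite size_poly0.
by rewrite EA szM // sB; slia.
Qed.

(** Reducing a solution modulo Y2 bounds a1, and a2 follows. *)
Lemma bezout_small Y1 Y2 E v d : coprimep Y1 Y2 -> size Y1 = v.+1 -> size Y2 = v.+1 ->
  (v <= d)%N -> (size E <= d + v)%N ->
  exists a1 a2 : {poly F}, [/\ a1 * Y1 - a2 * Y2 = E, (size a1 <= d)%N & (size a2 <= d)%N].
Proof.
move=> cY s1 s2 vd sE; have [u [w uw]] := bezout_coprime cY.
have Y20 : Y2 != 0 by rewrite -size_poly_gt0 s2.
pose a1 : {poly F} := (u * E) %% Y2.
have sa1 : (size a1 <= v)%N by have := sz_mod (u * E) Y20; rewrite -/a1 s2; slia.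
have /dvdP[a2 Ea2] : Y2 %| a1 * Y1 - E.
  have -> : a1 * Y1 - E = - (((u * E) %/ Y2) * Y1 + w * E) * Y2.
    have -> : a1 = u * E - ((u * E) %/ Y2) * Y2.
      by apply/eqP; rewrite eq_sym subr_eq addrC; apply/eqP/divp_eq.
    by rewrite -{3}[E]mul1r -uw; ring.
  by rewrite dvdp_mull.
exists a1, a2; split; first by rewrite -Ea2; ring.
  by slia.
apply: (size_divM Y20 Ea2 s2).
have h1 := szB (a1 * Y1) E; have h2 := szM_leq a1 Y1; slia.
Qed.

Lemma size_leq_coef A m : (size A <= m.+1)%N -> A`_m = 0 -> (size A <= m)%N.
Proof.
move=> sA A0; apply/leq_sizeP => j; rewrite leq_eqVlt => /orP[/eqP <- //|mj].
by rewrite nth_default // (leq_trans sA).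
Qed.

Lemma two_unit : (2%:R : F) != 0.
Proof. by rewrite -(dvdn_pcharf (pchar3 F3)). Qed.

(** The square root expansion at infinity, one coefficient at a time; 2 is
    invertible. *)
Lemma approx_sqrt A w : A \is monic -> size A = (w + w).+1 ->
  exists s : {poly F}, [/\ s \is monic, size s = w.+1 & (size (A - s ^+ 2)%R <= w)%N].
Proof.
move=> mA sA.
suff main j : (j <= w)%N -> exists s : {poly F},
    [/\ s \is monic, size s = w.+1 & (size (A - s ^+ 2)%R <= w + w - j)%N].
  by have [s [ms ss sAs]] := main w (leqnn w); exists s; split => //; rewrite addnK in sAs.
elim: j => [_|j IH jw].
    exists 'X^w; split; rewrite ?monicXn ?size_polyXn // subn0.
    apply: size_leq_coef.
      have := szB A ('X^w ^+ 2); rewrite -exprM size_polyXn sA muln2 -addnn; slia.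
    rewrite coefB -exprM coefXn muln2 -addnn eqxx.
    by have := monicP mA; rewrite lead_coefE sA /= => ->; rewrite subrr.
have [s [ms ss sAs]] := IH (ltnW jw).
  pose m := (w + w - j.+1)%N; have Em : (w + w - j)%N = m.+1 by rewrite /m; lia.
  pose g := (A - s ^+ 2)`_m / 2%:R; pose i := (w - j.+1)%N.
  exists (s + g *: 'X^i).
  have sg : (size (g *: 'X^i : {poly F}) <= i.+1)%N.
    by apply: (leq_trans (size_scale_leq _ _)); rewrite size_polyXn.
  have lt : (size (g *: 'X^i : {poly F}) < size s)%N by rewrite ss ltnS (leq_trans sg) // /i; lia.
  split; first by rewrite monicE lead_coefDl // (monicP ms).
    by rewrite size_polyDl.
  rewrite Em in sAs; rewrite (_ : (w + w - j.+1)%N = m) //; apply: size_leq_coef.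
    have -> : A - (s + g *: 'X^i) ^+ 2 = A - s ^+ 2 - (g *: 'X^i * (s + s + g *: 'X^i)) by ring.
    have h1 := szB (A - s ^+ 2) (g *: 'X^i * (s + s + g *: 'X^i)).
    have h2 := szM_leq (g *: 'X^i) (s + s + g *: 'X^i).
    have h3 := szD (s + s) (g *: 'X^i); have h4 := szD s s.
    move: sg lt; rewrite /m /i; slia.
  have -> : A - (s + g *: 'X^i) ^+ 2 = A - s ^+ 2 - (g + g) *: ('X^i * s) - g ^+ 2 *: 'X^(i + i).
    by rewrite -!mul_polyC exprD polyCD polyC_exp; ring.
  rewrite !coefB !coefZ coefXn coefXnM.
  have -> : (m == i + i)%N = false by rewrite /m /i; lia.
  have -> : (m < i)%N = false by rewrite /m /i; lia.
  have -> : (m - i = w)%N by rewrite /m /i; lia.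
  have -> : s`_w = 1 by have := monicP ms; rewrite lead_coefE ss.
  have -> : g + g = (A - s ^+ 2)`_m.
    by rewrite /g -mulrDr -mulr2n -[_ *+ 2]mulr_natl divff ?two_unit // mulr1.
  by rewrite -coefB mulr1 mulr0 subr0 subrr.
Qed.

Lemma monic_shift n k : (size k <= n)%N -> 'X^n + k \is @monic F /\ size ('X^n + k) = n.+1.
Proof.
move=> sk; have lt : (size k < size ('X^n : {poly F}))%N by rewrite size_polyXn.
by rewrite monicE lead_coefDl // lead_coefXn size_polyDl // size_polyXn.
Qed.

End Tools.

(** * A constant symbol on a short interval would be induced from a small modulus *)

Section FactorLists.
Variable F : finFieldType.
Local Notation q := #|F|.
Local Notation mi := (@monic_irreducible F).
Hypothesis F3 : exists e : nat, q = (3 ^ e)%N.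
Implicit Types (A B E R Y N P y z s : {poly F}) (ps ys : seq {poly F}).

Lemma factor_list R : R \is monic -> sqf R -> exists ps,
  R = \prod_(P <- ps) P /\ forall P, P \in ps -> mi P.
Proof.
move: R; apply: monic_ind => [_|P A mP mA IH s].
  by exists [::]; rewrite big_nil.
have [|ps [EA mps]] := IH; first by apply: (sqf_dvd s); rewrite dvdp_mull.
exists (P :: ps); rewrite big_cons EA; split => // P'.
by rewrite inE => /orP[/eqP ->|/mps].
Qed.

Lemma prod_monic ys : {in ys, forall y, y \is monic} -> \prod_(y <- ys) y \is monic.
Proof. by move=> h; rewrite big_seq; apply: monic_prod => y /h. Qed.

Lemma prod_coprime ys R : {in ys, forall y, coprimep y R} -> coprimep (\prod_(y <- ys) y) R.
Proof.
move=> h; rewrite big_seq; apply: (big_ind (fun u => coprimep u R)) => //.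
  by rewrite coprime1p.
by move=> u v cu cv; rewrite coprimepMl cu.
Qed.

(** Induction on the list: if the product found for B has symbol -1 at P, the
    product found for P B has distinct symbols at P and B, and one of it and
    its product with the previous one will do. *)
Lemma independent_characters D r ps B R P0 : character_ok F D r ->
  {in ps, forall P, mi P} -> mi P0 -> P0 \notin ps -> P0 %| B -> ~~ (P0 ^+ 2 %| B) ->
  B * \prod_(P <- ps) P %| R -> R != 0 -> (size R <= D)%N ->
  exists ys, [/\ {in ys, forall y, [/\ y \is monic, size y = r.+1 & coprimep y R]},
    {in ps, forall P, jac (\prod_(y <- ys) y) P = 1} & jac (\prod_(y <- ys) y) B = -1].
Proof.
move=> ok; elim: ps B => [|P ps IH] B mps mP0 nP0 P0B nB dR R0 sR.
  move: dR; rewrite big_nil mulr1 => dR.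
  have [Y [mY sY cY jY]] := ok B R P0 mP0 P0B nB dR R0 sR.
  by exists [:: Y]; rewrite big_seq1; split => // y; rewrite inE => /eqP ->.
have mP : mi P by apply: mps; rewrite inE eqxx.
have mps' : {in ps, forall P, mi P} by move=> P' h; apply: mps; rewrite inE h orbT.
move: nP0; rewrite inE negb_or => /andP[P0P nP0].
rewrite big_cons in dR.
have dR' : B * \prod_(P <- ps) P %| R.
  by apply: dvdp_trans dR; rewrite mulrCA dvdp_mull.
have [ys [hys jys jB]] := IH B mps' mP0 nP0 P0B nB dR' R0 sR.
have PR : P %| R by apply: dvdp_trans dR; rewrite mulrCA dvdp_mulr.
have BR : B %| R by apply: dvdp_trans dR; rewrite dvdp_mulr.
have pm zs C : {in zs, forall y, [/\ y \is monic, size y = r.+1 & coprimep y R]} ->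
    C %| R -> jac (\prod_(y <- zs) y) C = 1 \/ jac (\prod_(y <- zs) y) C = -1.
  move=> hz CR; apply: (jac_pm1 F3); first by apply: prod_monic => y /hz[].
  by apply: (coprimep_dvdl CR); apply: prod_coprime => y /hz[].
case: (pm ys P hys PR) => jP.
  by exists ys; split => // P'; rewrite inE => /orP[/eqP ->|/jys].
have [|||||ys' [hys' jys' jPB]] := IH (P * B) mps' mP0 nP0 => //.
- exact: dvdp_mull.
- have cP : coprimep (P0 ^+ 2) P by rewrite coprimep_expl // mi_coprime // mi_dvd_eq.
  by rewrite Gauss_dvdpr.
- by rewrite -mulrA mulrCA.
have h12 : {in ys ++ ys', forall y, [/\ y \is monic, size y = r.+1 & coprimep y R]}.
  by move=> y; rewrite mem_cat => /orP[/hys|/hys'].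
rewrite jacM in jPB.
have j12 C : jac (\prod_(y <- ys ++ ys') y) C =
    jac (\prod_(y <- ys) y) C * jac (\prod_(y <- ys') y) C.
  by rewrite big_cat jacMl //; apply: prod_monic => y; [move/hys=> [] | move/hys'=> []].
case: (pm ys' P hys' PR) => jP'.
  exists ys'; split => // [P'|]; first by rewrite inE => /orP[/eqP ->|/jys'].
  by move: jPB; rewrite jP' mul1r.
exists (ys ++ ys'); split => // [P'|]; rewrite j12.
  rewrite inE => /orP[/eqP ->|h]; first by rewrite jP jP' mulrNN mulr1.
  by rewrite jys // jys' // mulr1.
by move: jPB; rewrite jP' mulN1r => /oppr_inj ->; rewrite jB mulr1.
Qed.

End FactorLists.

Section ConstantSymbol.
Variable F : finFieldType.
Local Notation q := #|F|.
Local Notation K := (clo F).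
Local Notation mi := (@monic_irreducible F).
Hypothesis F3 : exists e : nat, q = (3 ^ e)%N.
Implicit Types (A B E Y N P y z s : {poly F}) (ps ys : seq {poly F}).

Variables (D rho d : nat).
Hypothesis sieve : sieve_ok F D rho.
Variables (Q R c : {poly F}) (sigma : K).
Hypotheses (mQ : Q \is monic) (QR : Q %| R) (R0 : R != 0).
Hypothesis budget : (2 * size R + 2 * d + 10 <= D)%N.
Hypothesis const : forall a : {poly F}, (size a <= d)%N -> coprimep (c + a) R ->
  jac Q (c + a) = sigma.

Lemma jacQ_neq0 Y : coprimep Y R -> jac Q Y != 0.
Proof.
by move=> cY; rewrite jac_neq0 //; rewrite coprimep_sym; apply: coprimep_dvdl cY.
Qed.

(** For suitable a1 and a2 in the interval, (c + a1) Y1 and (c + a2) Y2 differ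
    by a multiple of Q; cancel the symbols of c + a1 and c + a2. *)
Lemma symbol_congr N M Y1 Y2 z v : Q %| c * N + M ->
  coprimep Y1 Y2 -> coprimep Y1 R -> coprimep Y2 R ->
  size Y1 = v.+1 -> size Y2 = v.+1 -> Y1 - Y2 = z * N -> (v + rho <= d)%N ->
  (size (z * M)%R <= d + v)%N -> jac Q Y1 = jac Q Y2.
Proof.
move=> QN c12 c1 c2 s1 s2 EN vd sE.
have vd' : (v <= d)%N by apply: leq_trans vd; rewrite leq_addr.
have [a1 [a2 [Ea sa1 sa2]]] := bezout_small c12 s1 s2 vd' sE.
have [|||k [sk k1 k2]] := sieve (R1 := R) (R2 := R) (A1 := c + a1) (A2 := c + a2)
    (B1 := Y2) (B2 := Y1) R0 R0.
- slia.
- by move=> P mP dP _ d2; apply: (mi_notboth mP c2).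
- by move=> P mP dP _ d2; apply: (mi_notboth mP c1).
have j1 : jac Q (c + a1 + k * Y2) = sigma.
  rewrite -addrA const ?addrA //; have := szD a1 (k * Y2); have := szM_leq k Y2; slia.
have j2 : jac Q (c + a2 + k * Y1) = sigma.
  rewrite -addrA const ?addrA //; have := szD a2 (k * Y1); have := szM_leq k Y1; slia.
have s0 : sigma != 0 by rewrite -j1 jacQ_neq0.
apply: (mulfI s0); rewrite -{1}j1 -j2 -!jacM; apply: jac_mod => //.
have -> : (c + a1 + k * Y2) * Y1 - (c + a2 + k * Y1) * Y2 = z * (c * N + M).
  transitivity (c * (Y1 - Y2) + (a1 * Y1 - a2 * Y2)); first ring.
  by rewrite EN Ea; ring.
by rewrite dvdp_mull.
Qed.

Variables (N M : {poly F}) (n : nat).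
Hypotheses (N0 : N != 0) (QN : Q %| c * N + M).
Hypotheses (sN : (size N <= n)%N) (sM : (size M < d + n)%N).
Hypothesis room : (2 * n + 5 * rho <= d)%N.

Let w := (n + rho)%N.

(** One step: multiplying the class of A modulo N by y / y0 multiplies the
    symbol by that of y. *)
Let step w0 A y : w0 \is monic -> size w0 = rho.+1 -> coprimep w0 R -> coprimep w0 N ->
  A \is monic -> size A = (w + w).+1 -> coprimep A R -> coprimep A N -> coprimep A w0 ->
  y \is monic -> size y = (rho + rho).+1 -> coprimep y R -> coprimep y N -> coprimep y w0 ->
  exists A' : {poly F}, [/\ A' \is monic, size A' = (w + w).+1,
    [/\ coprimep A' R, coprimep A' N & coprimep A' w0],
    N %| y * A - w0 ^+ 2 * A' & jac Q A' = jac Q y * jac Q A].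
Proof.
move=> mw0 sw0 w0R w0N mA sA AR AN Aw0 my sy yR yN yw0.
pose y0 : {poly F} := w0 ^+ 2; rewrite -/y0.
have y0m : y0 \is monic by rewrite monic_exp.
have y00 := monic_neq0 y0m; have w00 := monic_neq0 mw0.
have sy0 : size y0 = (rho + rho).+1 by rewrite /y0 expr2 szM ?w00 // sw0 addnS.
have cy0 B : coprimep w0 B -> coprimep y0 B by apply: coprimep_expl.
have cy0r B : coprimep B w0 -> coprimep B y0 by apply: coprimep_expr.
have [i iE] : exists i : {poly F}, y0 %| N * i - 1.
  by apply: inv_mod; rewrite coprimep_sym cy0.
pose z0 : {poly F} := (y * A * i) %% y0.
have sz0 : (size z0 <= rho + rho)%N by have := sz_mod (y * A * i) y00; rewrite sy0 -/z0; slia.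
have [A2 EA2] : exists A2 : {poly F}, y * A - z0 * N = A2 * y0.
  apply: dvdP; rewrite (_ : y * A - z0 * N =
    - (y * A) * (N * i - 1) + (y * A * i - z0) * N); last by ring.
  apply: dvdp_add; first by rewrite dvdp_mull.
  apply: dvdp_mulr.
  by rewrite {1}(divp_eq (y * A * i) y0) addrK dvdp_mull.
pose G : {poly F} := y * A * R * N * y0.
have G0 : G != 0 by rewrite !mulf_neq0 // monic_neq0.
have sG : (size G + size (1%R : {poly F}) <= D)%N.
  have h1 := szM_leq (y * A * R * N) y0; have h2 := szM_leq (y * A * R) N.
  have h3 := szM_leq (y * A) R; have h4 := szM_leq y A.
  move: budget room sA; rewrite /w size_poly1 /G; slia.
have [||k [sk ck _]] := sieve (A1 := A2) (B1 := - N) (A2 := 0) (B2 := 0) G0 (oner_neq0 _) sG.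
- move=> P mP dG dA; rewrite dvdpNr => dN.
  have : P %| y * A.
    have -> : y * A = A2 * y0 + z0 * N by rewrite -EA2 subrK.
    by apply: dvdp_add; [apply: dvdp_mulr|apply: dvdp_mull].
  rewrite mi_dvdM // => /orP[h|h]; first exact: (mi_notboth mP yN h dN).
  exact: (mi_notboth mP AN h dN).
- by move=> P mP; rewrite mi_dvd1.
pose A' : {poly F} := A2 + k * - N; pose z : {poly F} := z0 + k * y0.
have Ez : y * A - y0 * A' = z * N.
  transitivity (A2 * y0 + z0 * N - y0 * A'); first by rewrite -EA2 subrK.
  by rewrite /A' /z; ring.
have szz : (size z <= rho + rho + rho)%N.
  by have := szD z0 (k * y0); have := szM_leq k y0; rewrite sy0 -/z; slia.
have myA : y * A \is monic by rewrite monicMr.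
have syA : size (y * A) = (rho + rho + w + w).+1.
  by rewrite szM ?monic_neq0 // sy sA; slia.
have Ey : y0 * A' = y * A - z * N by rewrite -Ez; ring.
have lt : (size (- (z * N))%R < size (y * A)%R)%N.
  by rewrite size_polyN syA /w; have := szM_leq z N; slia.
have my0A' : y0 * A' \is monic by rewrite Ey monicE lead_coefDl // (monicP myA).
have sy0A' : size (y0 * A') = (rho + rho + w + w).+1 by rewrite Ey size_polyDl // syA.
have mA' : A' \is monic by move: my0A'; rewrite monicMl.
have sA' : size A' = (w + w).+1.
  have := szM y00 (monic_neq0 mA'); rewrite sy0A' sy0; have := sz_gt0 (monic_neq0 mA'); slia.
move: ck; rewrite -/A' /G !coprimepMr => /andP[/andP[/andP[/andP[A'y A'A] A'R] A'N] A'y0].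
have A'w0 : coprimep A' w0 by case/andP: A'y0.
exists A'; split => //; first by rewrite Ez dvdp_mull.
have : jac Q (y * A) = jac Q (y0 * A').
  apply: (symbol_congr (v := (rho + rho + w + w)%N) QN _ _ _ syA sy0A' Ez).
  - rewrite coprimepMl !coprimepMr [coprimep y A']coprimep_sym [coprimep A A']coprimep_sym.
    by rewrite A'y A'A yw0 Aw0.
  - by rewrite coprimepMl yR.
  - by rewrite coprimepMl cy0.
  - by move: room; rewrite /w; slia.
  by have := szM_leq z M; rewrite /w; slia.
have wQ : coprimep Q w0 by rewrite coprimep_sym; apply: coprimep_dvdl w0R.
by rewrite !jacM => ->; rewrite -expr2 (jac_sqr F3) // mul1r.
Qed.

Let steps w0 ys A : w0 \is monic -> size w0 = rho.+1 -> coprimep w0 R -> coprimep w0 N ->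
  A \is monic -> size A = (w + w).+1 -> coprimep A R -> coprimep A N -> coprimep A w0 ->
  {in ys, forall y, [/\ y \is monic, size y = (rho + rho).+1 & coprimep y (R * N * w0)]} ->
  exists A' : {poly F}, [/\ A' \is monic, size A' = (w + w).+1,
    [/\ coprimep A' R, coprimep A' N & coprimep A' w0],
    N %| \prod_(y <- ys) y * A - (w0 ^+ 2) ^+ size ys * A' &
    jac Q A' = jac Q (\prod_(y <- ys) y) * jac Q A].
Proof.
move=> mw0 sw0 w0R w0N; elim: ys A => [|y ys IH] A mA sA AR AN Aw0 hys.
  exists A; rewrite big_nil; split => //; last by rewrite jac1 mul1r.
  by rewrite expr0 subrr dvdp0.
have [|my sy] := hys y; first by rewrite inE eqxx.
rewrite !coprimepMr => /andP[/andP[yR yN] yw0].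
have [A1 [mA1 sA1 [A1R A1N A1w0] d1 j1]] := step mw0 sw0 w0R w0N mA sA AR AN Aw0 my sy yR yN yw0.
have [|A' [mA' sA' cA' d' j']] := IH A1 mA1 sA1 A1R A1N A1w0.
  by move=> y' h; apply: hys; rewrite inE h orbT.
exists A'; split => //; last by rewrite j' j1 big_cons jacM; ring.
rewrite big_cons /= exprS.
set p := \prod_(_ <- _) _ in d' *; set e := _ ^+ size ys in d' *.
rewrite (_ : _ - _ = p * (y * A - w0 ^+ 2 * A1) + w0 ^+ 2 * (p * A1 - e * A')); last ring.
by rewrite dvdp_add ?dvdp_mull.
Qed.

(** If the symbol were constant, it would depend only on the class modulo N
    for monic polynomials of degree 2w. Steps with a product Y having symbol 1
    modulo the factors of N and -1 modulo Q, each taken an odd number 3^j of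
    times so that Y^(3^j) becomes a square modulo N, lead from a square to some
    A which is a square modulo N but has symbol -1; a square of a polynomial
    close to the square root of A has symbol 1 and the same class. *)
Lemma constant_symbol_small P0 : character_ok F D (rho + rho) ->
  mi P0 -> P0 %| Q -> ~~ (P0 ^+ 2 %| Q) -> ~~ (P0 %| N) -> False.
Proof.
move=> ok mP0 P0Q nP0Q P0N.
have RN0 : R * N != 0 by rewrite mulf_neq0.
have sRN : (size (R * N)%R <= size R + n)%N by have := szM_leq R N; slia.
have dn : (3 * n + 6 * rho <= 2 * d)%N by slia.
have [|||w1 [sw1 cw0 _]] := sieve (R1 := R * N) (R2 := 1) (A1 := 'X^rho) (B1 := 1)
    (A2 := 0) (B2 := 0) RN0 (oner_neq0 _); rewrite ?size_poly1.
- slia.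
- by move=> P mP _ _; rewrite mi_dvd1.
- by move=> P mP; rewrite mi_dvd1.
pose w0 : {poly F} := 'X^rho + w1 * 1; rewrite -/w0 in cw0.
have [mw0 sw0] : w0 \is monic /\ size w0 = rho.+1 by rewrite /w0 mulr1; apply: monic_shift.
have [w0R w0N] : coprimep w0 R /\ coprimep w0 N.
  by move: cw0; rewrite coprimepMr => /andP.
have w00 := monic_neq0 mw0.
pose G : {poly F} := R * N * w0.
have G0 : G != 0 by rewrite mulf_neq0.
have sG : (size G <= size R + n + rho)%N by have := szM_leq (R * N) w0; rewrite sw0 /G; slia.
have [|||a1 [sa1 ca0 _]] := sieve (R1 := G) (R2 := 1) (A1 := 'X^w) (B1 := 1)
    (A2 := 0) (B2 := 0) G0 (oner_neq0 _); rewrite ?size_poly1.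
- slia.
- by move=> P mP _ _; rewrite mi_dvd1.
- by move=> P mP; rewrite mi_dvd1.
pose a0 : {poly F} := 'X^w + a1 * 1; rewrite -/a0 in ca0.
have [ma0 sa0] : a0 \is monic /\ size a0 = w.+1.
  by rewrite /a0 mulr1; apply: monic_shift; rewrite (leq_trans sa1) // /w leq_addl.
move: ca0; rewrite !coprimepMr => /andP[/andP[a0R a0N] a0w0].
have [Nr [mNr sNr NrN hNr]] := radical N0.
have [ps [Eps mps]] := factor_list mNr sNr.
have [||||||ys [hys jps jQ]] := independent_characters (ps := ps) (B := Q) (R := G) (P0 := P0) F3 ok mps mP0.
- apply/negP => h; case/negP: P0N; rewrite hNr // Eps.
  by rewrite (big_rem P0) //= dvdp_mulr.
- exact: P0Q.
- exact: nP0Q.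
- by rewrite -Eps /G -mulrA dvdp_mul // dvdp_mulr.
- exact: G0.
- slia.
set Y := \prod_(y <- ys) y in jps jQ.
have mY : Y \is monic by apply: prod_monic => y /hys[].
have eY : exists m, (size Y).-1 = m.*2.
  rewrite /Y; elim: (ys) hys => [|y t IH] h; first by exists 0%N; rewrite big_nil size_poly1.
  have [|my sy _] := h y; first by rewrite inE eqxx.
  have ht : {in t, forall y, [/\ y \is monic, size y = (rho + rho).+1 & coprimep y G]}.
    by move=> y' hy'; apply: h; rewrite inE hy' orbT.
  have [m Em] := IH ht; exists (m + rho)%N.
  have mt : \prod_(y <- t) y \is monic by apply: prod_monic => y' /ht[].
  rewrite big_cons szM ?monic_neq0 // sy; have := sz_gt0 (monic_neq0 mt).
  by rewrite -!muln2 in Em *; slia.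
have flip B : B \is monic -> jac B Y = jac Y B.
  move=> mB; rewrite (jac_recip mB mY); have [m ->] := eY.
  by rewrite -muln2 mulnA mulnC exprM chim1_sqr expr1n mul1r.
have [zeta zE] : exists z : {poly F}, Nr %| Y - z ^+ 2.
  apply: (jac1_sqr F3) => // P mP dP; rewrite flip ?mi_monic //; apply: jps.
  have := dP; rewrite Eps big_seq; elim/big_rec: _ => [|P' x P'ps IH].
    by rewrite mi_dvd1.
  have mP' := mps _ P'ps; rewrite mi_dvdM // => /orP[|//].
  by rewrite mi_dvd_eq // => /eqP ->.
pose J := (3 ^ n)%N.
have NJ : N %| Y ^+ J - (zeta ^+ J) ^+ 2.
  rewrite -exprM [(J * 2)%N]mulnC exprM /J -(cubeX F3); apply: dvdp_sizeX => //.
    by apply: (leq_trans sN); rewrite ltnW // ltnS ltnW // ltn_expl.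
  by move=> P mP; rewrite hNr // => /dvdp_trans; apply.
pose ys' := flatten (nseq J ys).
have EY' : \prod_(y <- ys') y = Y ^+ J.
  rewrite /ys'; elim: (J) => [|j IH]; first by rewrite big_nil.
  by rewrite /= big_cat /= IH exprS.
have hys' : {in ys', forall y, [/\ y \is monic, size y = (rho + rho).+1 & coprimep y (R * N * w0)]}.
  by move=> y /flattenP[t]; rewrite mem_nseq => /andP[_ /eqP ->] /hys.
have mA0 : a0 ^+ 2 \is monic by rewrite monic_exp.
have sA0 : size (a0 ^+ 2) = (w + w).+1 by rewrite expr2 szM ?monic_neq0 // sa0; slia.
have [A [mA sA [AR AN Aw0] dA jA]] := steps mw0 sw0 w0R w0N mA0 sA0
   (coprimep_expl _ a0R) (coprimep_expl _ a0N) (coprimep_expl _ a0w0) hys'.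
have a0Q : coprimep Q a0 by rewrite coprimep_sym; apply: coprimep_dvdl a0R.
have jAm1 : jac Q A = -1.
  by rewrite jA EY' !jacX (jac_sqr F3) // mulr1 flip // jQ -signr_odd oddX orbT expr1.
have [i iE] : exists i : {poly F}, N %| w0 ^+ size ys' * i - 1.
  by apply: inv_mod; apply: coprimep_expl.
pose v := zeta ^+ J * a0 * i.
have Av : N %| A - v ^+ 2.
  rewrite EY' in dA; set e := w0 ^+ size ys' in iE.
  have Ee : (w0 ^+ 2) ^+ size ys' = e ^+ 2 by rewrite -!exprM mulnC.
  rewrite Ee in dA.
  rewrite (_ : _ - _ = - (Y ^+ J * a0 ^+ 2 - e ^+ 2 * A) * i ^+ 2
     + (Y ^+ J - (zeta ^+ J) ^+ 2) * (a0 * i) ^+ 2 - A * (e * i + 1) * (e * i - 1));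
    last by rewrite /v; ring.
  rewrite dvdp_sub ?dvdp_add //; last by rewrite dvdp_mull.
    by rewrite mulNr dvdpNr dvdp_mulr.
  by rewrite dvdp_mulr.
have [s [ms ss sAs]] := approx_sqrt F3 mA sA.
pose e : {poly F} := (v - s) %% N.
have se : (size e < size N)%N by apply: sz_mod.
have vse : N %| v - (s + e).
  by rewrite opprD addrA {1}(divp_eq (v - s) N) -/e addrK dvdp_mull.
have A00 := monic_neq0 mA.
have AR0 : A * R != 0 by rewrite mulf_neq0.
have AN_ P : mi P -> P %| s + e -> P %| N -> False.
  move=> mP ds dN; apply: (mi_notboth mP AN _ dN).
  have dv : P %| v.
    by rewrite -[v](subrK (s + e)) dvdp_add // (dvdp_trans dN).
  rewrite -[A](subrK (v ^+ 2)); apply: dvdp_add; first exact: dvdp_trans dN Av.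
  by rewrite mi_dvdX.
have [|||k [sk ck _]] := sieve (R1 := A * R) (R2 := 1) (A1 := s + e) (B1 := N)
    (A2 := 0) (B2 := 0) AR0 (oner_neq0 _); rewrite ?size_poly1.
- by have := szM_leq A R; rewrite sA /w; slia.
- by move=> P mP _; apply: AN_.
- by move=> P mP; rewrite mi_dvd1.
pose f : {poly F} := e + k * N; pose b : {poly F} := s + f.
have Eb : b = s + e + k * N by rewrite /b /f addrA.
have sf : (size f <= rho + (size N).-1)%N.
  by have := szD e (k * N); have := szM_leq k N; rewrite -/f; slia.
have lt : (size f < size s)%N by rewrite ss /w; slia.
have mb : b \is monic by rewrite monicE lead_coefDl // (monicP ms).
have sb : size b = w.+1 by rewrite size_polyDl.
have sb2 : size (b ^+ 2) = (w + w).+1 by rewrite expr2 szM ?monic_neq0 // sb; slia.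
move: ck; rewrite -Eb coprimepMr => /andP[bA bR].
have [z Ez] : exists z : {poly F}, A - b ^+ 2 = z * N.
  apply: dvdP; rewrite (_ : _ - _ = A - v ^+ 2 + (v - (s + e) - k * N) * (v + b));
    last by rewrite Eb; ring.
  by rewrite dvdp_add // dvdp_mulr // dvdp_sub // dvdp_mull.
have szz : (size z <= rho + w)%N.
  have NS : size N = (size N).-1.+1 by have := sz_gt0 N0; slia.
  apply: (size_divM N0 Ez NS).
  rewrite (_ : _ - _ = A - s ^+ 2 - f * (s + s + f)); last by rewrite /b; ring.
  have h1 := szB (A - s ^+ 2) (f * (s + s + f)); have h2 := szM_leq f (s + s + f).
  by have h3 := szD (s + s) f; have h4 := szD s s; slia.
have : jac Q A = jac Q (b ^+ 2).
  apply: (symbol_congr (v := (w + w)%N) QN _ _ _ sA sb2 Ez) => //.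
  - by rewrite coprimep_sym coprimep_expl.
  - exact: coprimep_expl.
  - by move: room; rewrite /w; slia.
  by have := szM_leq z M; move: room; rewrite /w; slia.
have bQ : coprimep Q b by rewrite coprimep_sym; apply: coprimep_dvdl bR.
rewrite jacX (jac_sqr F3) // jAm1 => /eqP; apply/negP; exact: clo_neq1N.
Qed.

End ConstantSymbol.

(** * Both values of the symbol on a short interval *)

Section ShortVectors.
Variable F : finFieldType.
Local Notation q := #|F|.
Implicit Types (N M Q c : {poly F}).

Lemma short_vector Q c a b : Q != 0 -> ((size Q).-1 < a + b)%N ->
  exists N M : {poly F}, [/\ (size N <= a)%N, (size M <= b)%N, (N != 0) || (M != 0) & Q %| c * N + M].
Proof.
move=> Q0 lt; set m := (size Q).-1 in lt.
have szm (C : {poly F}) : (size (C %% Q)%R <= m)%N by have := sz_mod C Q0; rewrite /m; slia.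
pose f (x : {poly_a F} * {poly_b F}) : {poly_m F} := npolyp m ((c * val x.1 + val x.2) %% Q).
have [x [y [xy E]]] : exists x y, x <> y /\ f x = f y.
  apply: contrapT => nh; have inj : injective f.
    by move=> x y E; apply: contrapT => xy; apply: nh; exists x, y.
  have := leq_card _ inj; rewrite card_prod !card_npoly -expnD leq_exp2l ?finNzRing_gt1 //.
  by rewrite leqNgt lt.
exists (val x.1 - val y.1), (val x.2 - val y.2); split.
- by apply: (leq_trans (szB _ _)); rewrite geq_max; apply/andP; split; exact: size_npoly.
- by apply: (leq_trans (szB _ _)); rewrite geq_max; apply/andP; split; exact: size_npoly.
- apply: contrapT => /negP; rewrite negb_or !negbK !subr_eq0 => /andP[/eqP e1 /eqP e2].
  apply: xy; case: (x) (y) e1 e2 => [x1 x2] [y1 y2] /= e1 e2.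
  by congr pair; apply: val_inj.
move: E => /(congr1 val) /=; rewrite !npolypK // => E.
rewrite (_ : _ + _ = c * val x.1 + val x.2 - (c * val y.1 + val y.2)); last by ring.
by rewrite /dvdp modpD modpN E subrr.
Qed.

Lemma dvdp_small0 Q N : Q %| N -> (size N < size Q)%N -> N = 0.
Proof.
move=> d lt; apply/eqP; apply: contraTT lt => N0; rewrite -leqNgt; exact: sz_dvd.
Qed.

(** Let (N1, M1) be a shortest vector of the lattice attached to Q, of norm s.
    Every vector of that lattice of norm at most deg Q - d - s + 2 is
    proportional to it, so reduction modulo N1 or M1 leaves too few of them:
    pigeonhole produces a vector of the larger lattice attached to Q1 outside
    the lattice attached to Q. *)
Lemma vector_outside Q Q1 c d s0 : Q1 != 0 -> (size Q1 < size Q)%N ->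
  (0 < s0)%N -> (0 < d)%N ->
  (forall N M, N != 0 -> Q %| c * N + M -> (size N <= s0)%N -> (size M < d + s0)%N -> False) ->
  (size Q <= s0 + size Q1)%N ->
  exists (N M : {poly F}) (n : nat), [/\ N != 0, Q1 %| c * N + M, ~~ (Q %| c * N + M),
    (size N <= n)%N /\ (size M < d + n)%N & (n + s0 + d < size Q + 1)%N].
Proof.
move=> Q10 Q1Q s00 d0 none sQ1.
have Q0 : Q != 0 by rewrite -size_poly_gt0; slia.
set m := (size Q).-1.
have mE : size Q = m.+1 by rewrite /m; slia.
pose p s := `[< exists N M, [/\ N != 0, Q %| c * N + M, (size N <= s)%N & (size M < d + s)%N] >].
have [|s /asboolP[N1 [M1 [N10 QN1 sN1 sM1]]] smin] := @find_ex_minn p.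
  exists (size Q); apply/asboolP; exists Q, 0; split; rewrite ?addr0 ?dvdp_mull ?size_poly0 //.
  by rewrite addn_gt0 d0.
have mins N M : N != 0 -> Q %| c * N + M -> (size N < s)%N -> (size M < d + s.-1)%N -> False.
  move=> N0 QN sN sM; have : (s <= s.-1)%N.
    apply: smin; apply/asboolP; exists N, M; split => //; slia.
  slia.
have s0s : (s0 < s)%N.
  rewrite ltnNge; apply/negP => ss0; apply: (none N1 M1) => //; slia.
have dm : (d < m)%N.
  rewrite ltnNge; apply/negP => md; apply: (none 1 (- c %% Q)).
  - exact: oner_neq0.
  - have -> : c * 1 + (- c) %% Q = - ((- c) %/ Q) * Q.
      by rewrite -[(- c) %% Q](addKr (((- c) %/ Q) * Q)) -divp_eq; ring.
    exact: dvdp_mull.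
  - by rewrite size_poly1.
  have := sz_mod (- c) Q0; slia.
have s2 : (2 * s <= m + 3 - d)%N.
  (* pigeonhole in the lattice of Q bounds its shortest vector *)
  pose s' := ((m + 3 - d)./2)%N.
  have [s'1 s'2] : (2 * s' <= m + 3 - d)%N /\ (m + 3 - d <= 2 * s' + 1)%N.
    by rewrite /s'; have := odd_double_half (m + 3 - d); case: odd; rewrite -muln2; lia.
  have [|N [M [sN sM nz QN]]] := @short_vector Q c s' (d + s').-1 Q0.
    rewrite -/m; lia.
  have N0 : N != 0.
    apply/eqP => N0; move: nz QN; rewrite N0 eqxx mulr0 add0r /= => M0 QM.
    have := sz_dvd M0 QM; slia.
  suff : (s <= s')%N by lia.
  by apply: smin; apply/asboolP; exists N, M; split => //; slia.
pose n := (m + 2 - s - d)%N; have nE : n = (m + 2 - s - d)%N by [].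
have det N M : Q %| c * N + M -> Q %| N1 * M - N * M1.
  move=> QN; rewrite (_ : _ - _ = N1 * (c * N + M) - N * (c * N1 + M1)); last by ring.
  by rewrite dvdp_sub // dvdp_mull.
have fin N M : (N != 0) || (M != 0) -> Q1 %| c * N + M -> ~~ (Q %| c * N + M) ->
    (size N <= n)%N -> (size M < d + n)%N ->
    exists (N M : {poly F}) (n : nat), [/\ N != 0, Q1 %| c * N + M, ~~ (Q %| c * N + M),
    (size N <= n)%N /\ (size M < d + n)%N & (n + s0 + d < size Q + 1)%N].
  move=> nz Q1N nQN sN sM; exists N, M, n; split => //; last by slia.
  apply/eqP => N0; move: nz Q1N; rewrite N0 eqxx mulr0 add0r /= => M0 QM.
  by have := sz_dvd M0 QM; move: sM; slia.
(* s is attained by N1 or by M1: reduce modulo that one *)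
have [lt|ge] := ltnP (size N1) s; last first.
  have sN1' : size N1 = s by slia.
  have [|N [M [sN sM nz QN]]] := @short_vector Q1 c s.-1 (d + n).-1 Q10.
    by slia.
  apply: (fin N M nz QN) => //; last 2 first.
  - by slia.
  - by slia.
  apply/negP => QN'; have /dvdp_small0 E := det _ _ QN'.
  have {}E : N1 * M = N * M1.
    apply/eqP; rewrite -subr_eq0 E //.
    have h1 := szB (N1 * M) (N * M1); have h2 := szM_leq N1 M; have h3 := szM_leq N M1.
    by slia.
  have [N0|N0] := eqVneq N 0.
    move: nz E; rewrite N0 eqxx mul0r /= => M0 /eqP.
    by rewrite mulf_eq0 (negPf N10) (negPf M0).
  apply: (mins N M) => //; first by slia.
  have [->|M0] := eqVneq M 0; first by rewrite size_poly0 addn_gt0 d0.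
  have := congr1 (fun u : {poly F} => size u) E; rewrite /= szM //.
  by have := szM_leq N M1; have := sz_gt0 M0; slia.
have sM1' : (size M1 = (d + s).-1)%N.
  apply/eqP; rewrite eqn_leq; apply/andP; split; first by slia.
  by rewrite leqNgt; apply/negP => h; apply: (mins N1 M1) => //; slia.
have M10 : M1 != 0 by rewrite -size_poly_gt0 sM1'; lia.
have [|N [M [sN sM nz QN]]] := @short_vector Q1 c n (d + s).-2 Q10.
  by slia.
apply: (fin N M nz QN) => //; last first.
  by slia.
apply/negP => QN'; have /dvdp_small0 E := det _ _ QN'.
have {}E : N1 * M = N * M1.
  apply/eqP; rewrite -subr_eq0 E //.
  have h1 := szB (N1 * M) (N * M1); have h2 := szM_leq N1 M; have h3 := szM_leq N M1.
  by slia.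
have [M0|M0] := eqVneq M 0.
  move: nz E; rewrite M0 eqxx mulr0 orbF => N0 /esym/eqP.
  by rewrite mulf_eq0 (negPf M10) (negPf N0).
have N0 : N != 0.
  by apply/eqP => N0; move/eqP: E; rewrite N0 mul0r mulf_eq0 (negPf N10) (negPf M0).
apply: (mins N M) => //; last by slia.
have := congr1 (fun u : {poly F} => size u) E; rewrite /= !szM //.
by have := sz_gt0 M0; have := sz_gt0 N0; have := sz_gt0 N10; slia.
Qed.

End ShortVectors.

Section BothSigns.
Variable F : finFieldType.
Local Notation q := #|F|.
Local Notation mi := (@monic_irreducible F).
Hypothesis F3 : exists e : nat, q = (3 ^ e)%N.
Implicit Types (A B N M P R c a l s : {poly F}).

(** The value 1 needs an s other than 0 and 1, such as the square of the
    variable; the value -1 comes from a monic of even degree, for which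
    reciprocity has no sign. *)
Lemma character_values D rho l (e : clo F) : character_ok F D (rho + rho) -> mi l -> (2 < size l)%N ->
  (size l <= D)%N -> (e = 1 \/ e = -1) ->
  exists s : {poly F}, [/\ jac l s = e, coprimep l s & coprimep l (1 - s)].
Proof.
move=> ok ml sl lD [->|->].
  have clX A : A != 0 -> (size A <= 2)%N -> coprimep l A.
    by move=> A0 sA; rewrite mi_coprime //; apply/negP => /(sz_dvd A0); slia.
  have cX : coprimep l 'X by apply: clX; rewrite ?size_polyX // polyX_eq0.
  exists ('X ^+ 2); split; first by rewrite jacX (jac_sqr F3) // mi_monic.
    exact: coprimep_expr.
  rewrite (_ : 1 - _ = - (('X - 1%:P) * ('X + 1%:P))); last by rewrite polyC1; ring.
  rewrite -scaleN1r coprimepZr ?oppr_eq0 ?oner_neq0 // coprimepMr.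
  by rewrite !clX // ?monic_neq0 ?monicXsubC ?monicXaddC ?size_XsubC ?size_XaddC.
have nl : ~~ (l ^+ 2 %| l) by apply: sqf_mi.
have [Y [mY sY cY jY]] := ok l l l ml (dvdpp l) nl (dvdpp l) (mi_neq0 ml) lD.
exists Y; have jlY : jac l Y = -1.
  rewrite (jac_recip (mi_monic ml) mY) sY /= addnn -muln2 mulnA mulnC exprM chim1_sqr.
  by rewrite expr1n mul1r.
have clY : coprimep l Y by rewrite coprimep_sym.
split => //; rewrite mi_coprime //; apply/negP => d.
have := jlY; rewrite -(@jac_mod _ l 1 Y) ?mi_monic // jac1 => /eqP.
by rewrite eq_sym (negPf (clo_neq1N F3)).
Qed.

(** Take Y1 - Y2 = N and elements u = c + a1 and v = c + a2 of the interval with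
    u Y1 - v Y2 = c N + M =: delta. As Q1 divides delta and u, v have the same
    symbol modulo Q, the symbol of u v modulo l is the one of Y1 Y2 modulo Q1.
    But on the conic u Y1 - v Y2 = delta over the residue field of l, where delta
    is not 0, the ratio s = v Y2 / (u Y1) is a free parameter other than 1, and
    u v Y1 Y2 is s times a square: both signs occur. *)
Lemma constant_symbol_large D rho d l Ro Q1 c sigma N M n :
  sieve_ok F D rho -> character_ok F D (rho + rho) -> mi l -> (2 < size l)%N ->
  ~~ (l %| Ro) -> Ro != 0 -> Q1 \is monic -> Q1 %| Ro ->
  (2 * size (l * Ro)%R + 2 * d + 10 <= D)%N ->
  (forall a, (size a <= d)%N -> coprimep (c + a) (l * Ro) -> jac (l * Q1) (c + a) = sigma) ->
  N != 0 -> Q1 %| c * N + M -> ~~ (l * Q1 %| c * N + M) -> coprimep l Q1 ->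
  (size N <= n)%N -> (size M < d + n)%N -> (n + rho + rho + size l <= d)%N -> False.
Proof.
move=> sieve ok ml sl lRo Ro0 mQ1 Q1Ro budget const N0 Q1N nQN clQ1 sN sM room.
have l0 := mi_neq0 ml; have mol := mi_monic ml.
pose R : {poly F} := l * Ro; rewrite -/R in budget const.
have R0 : R != 0 by rewrite mulf_neq0.
have sR : (size l <= size R)%N by apply: sz_dvd => //; rewrite dvdp_mulr.
pose v := (n + rho)%N.
have RN0 : R * N != 0 by rewrite mulf_neq0.
have [|||k0 [sk0 c1 c2]] := sieve (R * N) R 'X^v ('X^v - N) 1 1 RN0 R0.
- by have := szM_leq R N; slia.
- by move=> P mP _ _; rewrite mi_dvd1.
- by move=> P mP _ _; rewrite mi_dvd1.
pose Y1 : {poly F} := 'X^v + k0; pose Y2 : {poly F} := 'X^v + (k0 - N).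
rewrite mulr1 -/Y1 in c1; rewrite mulr1 -addrA [- N + _]addrC -/Y2 in c2.
have [mY1 sY1] : Y1 \is monic /\ size Y1 = v.+1.
  by apply: monic_shift; rewrite (leq_trans sk0) // /v leq_addl.
have [mY2 sY2] : Y2 \is monic /\ size Y2 = v.+1.
  by apply: monic_shift; have := szB k0 N; rewrite /v; slia.
move: c1; rewrite coprimepMr => /andP[Y1R Y1N].
have EN : Y1 - Y2 = N by rewrite /Y1 /Y2; ring.
have Y12 : coprimep Y1 Y2.
  apply: coprimep_mi => P mP d1 d2; apply: (mi_notboth mP Y1N d1).
  by rewrite -EN dvdp_sub.
have vd : (v <= d)%N by rewrite /v; slia.
have [|a1 [a2 [Ea sa1 sa2]]] := bezout_small Y12 sY1 sY2 (E := M) vd.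
  by rewrite /v; slia.
pose delta : {poly F} := c * N + M.
have rel (k : {poly F}) : (c + a1 + k * Y2) * Y1 - (c + a2 + k * Y1) * Y2 = delta.
  transitivity (c * (Y1 - Y2) + (a1 * Y1 - a2 * Y2)); first ring.
  by rewrite EN Ea.
have ldelta : coprimep l delta.
  rewrite mi_coprime //; apply/negP => ld; case/negP: nQN.
  by rewrite Gauss_dvdp // ld.
have clR A : coprimep A R -> coprimep l A.
  by move=> cA; rewrite coprimep_sym; apply: coprimep_dvdl cA; rewrite dvdp_mulr.
have cQ1R A : coprimep A R -> coprimep Q1 A.
  by move=> cA; rewrite coprimep_sym; apply: coprimep_dvdl cA; rewrite dvdp_mull.
have tau (k : {poly F}) : (size k < rho + size l)%N -> coprimep (c + a1 + k * Y2) R ->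
    coprimep (c + a2 + k * Y1) R ->
    jac l ((c + a1 + k * Y2) * (c + a2 + k * Y1)) = jac Q1 (Y1 * Y2).
  move=> sk cu cv.
  have j1 : jac (l * Q1) (c + a1 + k * Y2) = sigma.
    rewrite -addrA const ?addrA //; have := szD a1 (k * Y2); have := szM_leq k Y2.
    by rewrite sY2 /v; slia.
  have j2 : jac (l * Q1) (c + a2 + k * Y1) = sigma.
    rewrite -addrA const ?addrA //; have := szD a2 (k * Y1); have := szM_leq k Y1.
    by rewrite sY1 /v; slia.
  have j3 : jac Q1 (c + a1 + k * Y2) * jac Q1 Y1 = jac Q1 (c + a2 + k * Y1) * jac Q1 Y2.
    by rewrite -!jacM; apply: jac_mod => //; rewrite rel.
  move: j1; rewrite -j2 !jacMl // !jacM => j1.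
  have y2 := jac_sqr F3 mol (clR _ cv).
  have A2 := jac_sqr F3 mQ1 (cQ1R _ cu); have B2 := jac_sqr F3 mQ1 (cQ1R _ cv).
  have E2 := jac_sqr F3 mQ1 (cQ1R _ c2).
  move: j1 j3 y2 A2 B2 E2; set x := jac l _; set y := jac l _; set A := jac Q1 (c + a1 + _).
  set B := jac Q1 (c + a2 + _); set C := jac Q1 Y1; set E := jac Q1 Y2.
  move=> j1 j3 y2 A2 B2 E2.
  transitivity (x * y * A ^+ 2); first by rewrite A2 mulr1.
  transitivity (x * A * (A * y)); first by ring.
  rewrite j1; transitivity (y ^+ 2 * B * A); first by ring.
  rewrite y2 mul1r; transitivity (B * A * E ^+ 2); first by rewrite E2 mulr1.
  transitivity (A * (B * E) * E); first by ring.
  by rewrite -j3; transitivity (A ^+ 2 * C * E); [ring|rewrite A2 mul1r].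
have lY1 := clR _ Y1R; have lY2 := clR _ c2.
have both (e : clo F) : e = 1 \/ e = -1 -> jac Q1 (Y1 * Y2) = jac l (Y1 * Y2) * e.
  move=> he; have lD : (size l <= D)%N by slia.
  have [s [js ls l1s]] := character_values ok ml sl lD he.
  have [e' e'E] : exists e' : {poly F}, l %| (1 - s) * e' - 1.
    by apply: inv_mod; rewrite coprimep_sym.
  have [i iE] : exists i : {poly F}, l %| Y1 * Y2 * i - 1.
    by apply: inv_mod; rewrite coprimep_sym coprimepMr lY1.
  have le' : coprimep l e'.
    rewrite mi_coprime //; apply/negP => d'; have := e'E.
    rewrite dvdp_addr ?dvdp_mull // dvdpNr; exact/negP/negbT/mi_dvd1.
  pose k1 : {poly F} := ((delta * s * e' - (c + a2) * Y2) * i) %% l.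
  have sk1 : (size k1 < size l)%N by apply: sz_mod.
  pose U : {poly F} := c + a1 + k1 * Y2; pose V : {poly F} := c + a2 + k1 * Y1.
  have VE : l %| V * Y2 - delta * s * e'.
    set T := delta * s * e' - (c + a2) * Y2 in k1 sk1 U V *.
    have [t Et] : exists t : {poly F}, k1 = T * i - t * l.
      exists ((T * i) %/ l); apply/eqP; rewrite eq_sym subr_eq addrC; apply/eqP.
      exact: divp_eq.
    rewrite (_ : _ - _ = T * (Y1 * Y2 * i - 1) - t * (Y1 * Y2) * l); last first.
      by rewrite /V Et /T; ring.
    by rewrite dvdp_sub // dvdp_mull.
  have UE : l %| U * Y1 - delta * e'.
    rewrite (_ : _ - _ = V * Y2 - delta * s * e' - delta * ((1 - s) * e' - 1)); last first.
      by have := rel k1; rewrite -/U -/V => <-; ring.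
    by rewrite dvdp_sub // dvdp_mull.
  have lU : coprimep l U.
    have : coprimep l (U * Y1).
      by rewrite coprimep_sym (coprimep_congr UE) coprimep_sym coprimepMr ldelta.
    by rewrite coprimepMr => /andP[].
  have lV : coprimep l V.
    have : coprimep l (V * Y2).
      by rewrite coprimep_sym (coprimep_congr VE) coprimep_sym !coprimepMr ldelta ls.
    by rewrite coprimepMr => /andP[].
  have ok' A B : coprimep l A -> coprimep B R -> forall P, mi P -> P %| R -> P %| A -> P %| l * B -> False.
    move=> lA BR P mP dR dA; rewrite mi_dvdM // => /orP[|dB]; last exact: (mi_notboth mP BR).
    by rewrite mi_dvd_eq // => /eqP E; rewrite E in dA; move: lA; rewrite mi_coprime // dA.
  have [|k [sk cU cV]] := sieve R R U V (l * Y2) (l * Y1) R0 R0 _ (ok' _ _ lU c2) (ok' _ _ lV Y1R).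
    by slia.
  have EU : U + k * (l * Y2) = c + a1 + (k1 + k * l) * Y2 by rewrite /U; ring.
  have EV : V + k * (l * Y1) = c + a2 + (k1 + k * l) * Y1 by rewrite /V; ring.
  rewrite EU in cU; rewrite EV in cV.
  have skl : (size (k1 + k * l)%R < rho + size l)%N.
    by have := szD k1 (k * l); have := szM_leq k l; slia.
  rewrite -(tau _ skl cU cV) -EU -EV.
  have jY : jac l (Y1 * Y2) ^+ 2 = 1 by rewrite (jac_sqr F3) // coprimepMr lY1.
  apply: (mulIf (x := jac l (Y1 * Y2))).
    by rewrite jac_neq0 // coprimepMr lY1.
  rewrite -jacM (_ : jac l (Y1 * Y2) * e * _ = jac l (Y1 * Y2) ^+ 2 * e); last by ring.
  rewrite jY mul1r -js.
  rewrite (@jac_mod _ l _ ((delta * e') ^+ 2 * s)) //.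
    by rewrite jacM jacX (jac_sqr F3) ?mul1r // coprimepMr ldelta.
  rewrite (_ : _ - _ = (U * Y1 - delta * e') * (V * Y2) + delta * e' * (V * Y2 - delta * s * e')
     + l * (k * Y1 * Y2 * (Y1 * U + Y2 * V + k * l * Y1 * Y2))); last by ring.
  rewrite dvdp_add ?dvdp_mulr //.
  by apply: dvdp_add; [apply: dvdp_mulr|apply: dvdp_mull].
have j1 := both 1 (or_introl erefl); have jm1 := both (-1) (or_intror erefl).
have nz : jac l (Y1 * Y2) != 0 by rewrite jac_neq0 // coprimepMr lY1.
have := j1; rewrite jm1 => /(mulfI nz)/eqP; apply/negP; exact: clo_neq1N.
Qed.

(** If some vector of the lattice of Q is very short the symbol is not constant
    by comparison with the character of its first coordinate; if not, the
    lattices of Q and Q1 = Q / l differ in a moderately short vector. *)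
Lemma symbol_both_signs D rho d l Ro Q1 c (e : clo F) :
  sieve_ok F D rho -> character_ok F D (rho + rho) -> mi l -> (2 < size l)%N ->
  ~~ (l %| Ro) -> Ro != 0 -> Q1 \is monic -> sqf Q1 -> Q1 %| Ro ->
  (2 * size (l * Ro)%R + 2 * d + 10 <= D)%N ->
  (2 * size l + 5 * rho + 3 <= d)%N ->
  (2 * size (l * Q1)%R + 2 * size l + 9 * rho + 10 <= 5 * d)%N ->
  e = 1 \/ e = -1 ->
  exists a : {poly F}, [/\ (size a <= d)%N, coprimep (c + a) (l * Ro) & jac (l * Q1) (c + a) = e].
Proof.
move=> sieve ok ml sl lRo Ro0 mQ1 sQ1 Q1Ro budget rd mud he; apply: contrapT => none.
have l0 := mi_neq0 ml; have mol := mi_monic ml.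
pose Q : {poly F} := l * Q1; pose R : {poly F} := l * Ro.
have mQ : Q \is monic by rewrite monicMl.
have QR : Q %| R by rewrite dvdp_mul.
have R0 : R != 0 by rewrite mulf_neq0.
have clQ1 : coprimep l Q1.
  by rewrite mi_coprime //; apply: contra lRo => /dvdp_trans; apply.
have sqQ : sqf Q by apply: sqf_mul => //; exact: sqf_mi.
have Q0 := monic_neq0 mQ; have Q10 := monic_neq0 mQ1.
have const a : (size a <= d)%N -> coprimep (c + a) R -> jac Q (c + a) = - e.
  move=> sa ca; have cQ : coprimep Q (c + a).
    by rewrite coprimep_sym; apply: coprimep_dvdl ca.
  have ne : jac Q (c + a) <> e by move=> E; apply: none; exists a.
  by case: (jac_pm1 F3 mQ cQ) he ne => -> [] -> //; rewrite ?opprK.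
pose s0 := ((d - 5 * rho)./2)%N.
have [s01 s02] : (2 * s0 + 5 * rho <= d)%N /\ (d <= 2 * s0 + 5 * rho + 1)%N.
  by rewrite /s0; have := odd_double_half (d - 5 * rho); case: odd; rewrite -muln2; slia.
have sQE : (size Q).+1 = (size l + size Q1)%N.
  by rewrite /Q szM //; have := sz_gt0 l0; have := sz_gt0 Q10; slia.
have short N M : N != 0 -> Q %| c * N + M -> (size N <= s0)%N -> (size M < d + s0)%N -> False.
  move=> N0 QN sN sM.
  (* when Q itself is that short, N may share all its factors: take N = 1 *)
  have [Qs|Qs] := leqP (size Q) s0.
    have QN1 : Q %| c * 1 + (- c) %% Q.
      have -> : c * 1 + (- c) %% Q = - ((- c) %/ Q) * Q.
        by rewrite -[(- c) %% Q](addKr (((- c) %/ Q) * Q)) -divp_eq; ring.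
      exact: dvdp_mull.
    have sM1 : (size ((- c) %% Q)%R < d + s0)%N by have := sz_mod (- c) Q0; slia.
    have s1 : (size (1%R : {poly F}) <= s0)%N by rewrite size_poly1; slia.
    apply: (constant_symbol_small F3 sieve mQ QR R0 budget const (oner_neq0 _) QN1 s1 sM1 s01 ok ml).
    - by rewrite dvdp_mulr.
    - exact: sqQ.
    by rewrite mi_dvd1.
  move: Qs; rewrite ltnNge => /negP; apply; apply: (leq_trans _ sN); apply: (sz_dvd N0).
  apply: sqf_dvdp => // P mP dP; apply: contrapT => /negP nP.
  exact: (constant_symbol_small F3 sieve mQ QR R0 budget const N0 QN sN sM s01 ok mP dP (sqQ _ mP) nP).
have [|||| N [M [n [N0 Q1N nQN [sN sM] sn]]]] := vector_outside (Q := Q) (Q1 := Q1) (d := d) Q10 _ _ _ short.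
- by slia.
- by slia.
- by slia.
- by slia.
apply: (constant_symbol_large sieve ok ml sl lRo Ro0 mQ1 Q1Ro budget const N0 Q1N nQN clQ1 sN sM).
by rewrite -/Q in mud; slia.
Qed.

End BothSigns.

(** * The Moebius function on a family with controlled derivative *)

Section MoebiusFamily.
Variable F : finFieldType.
Local Notation q := #|F|.
Local Notation mi := (@monic_irreducible F).
Hypothesis F3 : exists e : nat, q = (3 ^ e)%N.
Implicit Types (A B C S P R Q w c a b l j H : {poly F}).

Lemma sqf_decomposition A : A \is monic -> exists Q w : {poly F},
  [/\ A = Q * w ^+ 2, Q \is monic, w \is monic & sqf Q].
Proof.
move: A; apply: monic_ind => [|P A mP mA [Q [w [-> mQ mw sQ]]]].
  by exists 1, 1; rewrite expr1n mulr1 !monic1; split => //; apply: sqf1.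
have [/dvdP[Q' EQ]|nP] := boolP (P %| Q).
  exists Q', (P * w); split.
  - by rewrite EQ; ring.
  - by move: mQ; rewrite EQ monicMr // mi_monic.
  - by rewrite monicMl // mi_monic.
  - by apply: (sqf_dvd sQ); rewrite EQ dvdp_mulr.
exists (P * Q), w; split => //; first by ring.
  by rewrite monicMl // mi_monic.
by apply: sqf_mul => //; [exact: sqf_mi | rewrite mi_coprime].
Qed.

Lemma cubefree_decomposition A : A \is monic -> exists C B S : {poly F},
  [/\ A = C ^+ 3 * B * S ^+ 2, C \is monic, B \is monic, S \is monic & sqf (B * S)].
Proof.
move: A; apply: monic_ind => [|P A mP mA [C [B [S [-> mC mB mS sBS]]]]].
  by exists 1, 1, 1; rewrite !expr1n !mulr1 !monic1; split => //; apply: sqf1.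
have mP' := mi_monic mP.
have [/dvdP[B' EB]|nB] := boolP (P %| B).
  exists C, B', (P * S); split => //.
  - by rewrite EB; ring.
  - by move: mB; rewrite EB monicMr.
  - by rewrite monicMl.
  - by rewrite mulrA -EB.
have [/dvdP[S' ES]|nS] := boolP (P %| S).
  exists (P * C), B, S'; split => //.
  - by rewrite ES; ring.
  - by rewrite monicMl.
  - by move: mS; rewrite ES monicMr.
  - by apply: (sqf_dvd sBS); rewrite dvdp_mul // ES dvdp_mulr.
exists C, (P * B), S; split => //; first by ring.
  by rewrite monicMl.
rewrite -mulrA; apply: sqf_mul => //; first exact: sqf_mi.
by rewrite mi_coprime // mi_dvdM // negb_or nB.
Qed.

Lemma moebius_mul A B : A \is monic -> sqf (A * B) ->
  moebius (A * B) = moebius A * moebius B.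
Proof.
move: A; apply: monic_ind => [_|P A mP mA IH]; first by rewrite moebius1 !mul1r.
rewrite -mulrA => s; have sAB : sqf (A * B) by apply: (sqf_dvd s); rewrite dvdp_mull.
have sPA : sqf (P * A) by apply: (sqf_dvd s); rewrite mulrA dvdp_mulr.
by rewrite (moebiusM mP s) (moebiusM mP sPA) IH // mulNr.
Qed.

Lemma moebius_sign A : sqf A -> moebius A = 1 \/ moebius A = -1.
Proof.
move=> s; rewrite /moebius; case: asboolP => [[P [mP d]]|_].
  by have := s _ mP; rewrite d.
by rewrite -signr_odd; case: odd; [right|left].
Qed.

Lemma deriv_cube A : (A ^+ 3)^`() = 0.
Proof. by rewrite deriv_exp -mulr_natr (pcharf0 (pchar3_poly F3)) mulr0. Qed.

Lemma jac_const A B (k : F) : A \is monic -> B \is monic -> size A = size B ->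
  jac A k%:P = jac B k%:P.
Proof.
have E C : C \is monic -> jac C k%:P = (emb F k ^+ (q.-1)./2) ^+ (size C).-1.
  move=> mC; rewrite /jac /resp -(size_rts mC).
  under eq_bigr => x _ do rewrite map_polyC hornerC.
  by rewrite big_const_seq count_predT iter_mulr_1 -!exprM mulnC.
by move=> mA mB sAB; rewrite !E // sAB.
Qed.

(** With S H = (S (b + a))^3 + J^3 + g^3 K, cubes having zero derivative,
    (S H)' = g^3 K' does not depend on a. So Pellet's formula expresses the
    Moebius function of H by symbols of the fixed polynomials S, g and K' modulo
    H; reciprocity turns them into symbols of H modulo these, where H is
    S^2 (c + a)^3. *)
Lemma moebius_family X S l Q w K b j (J : {poly F}) c R (k : F) i n :
  X \is monic -> sqf X -> S \is monic -> mi l -> Q \is monic -> w != 0 -> k != 0 ->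
  K^`() = k *: (Q * w ^+ 2) -> S * j = J ^+ 3 + (l ^+ (2 * i + 1)) ^+ 3 * K ->
  X %| R -> l %| R -> Q %| R -> (forall P, mi P -> P %| w -> P %| R) -> coprimep S R ->
  R %| S ^+ 2 * b ^+ 3 + j - S ^+ 2 * c ^+ 3 ->
  exists kappa : clo F, forall a, S ^+ 2 * (b + a) ^+ 3 + j \is monic ->
    size (S ^+ 2 * (b + a) ^+ 3 + j) = n -> coprimep (c + a) R ->
    sqf (X * (S ^+ 2 * (b + a) ^+ 3 + j)) /\
    (moebius (X * (S ^+ 2 * (b + a) ^+ 3 + j)))%:~R = kappa * jac (l * Q) (c + a).
Proof.
move=> mX sX mS ml mQ w0 k0 EK Ej XR lR QR wR SR Rc.
have mol := mi_monic ml; set g := l ^+ (2 * i + 1) in Ej.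
have [[H0 [mH0 sH0]]|none] := pselect (exists H, H \is monic /\ size H = n); last first.
  by exists 0 => a mH sH; case: none; exists (S ^+ 2 * (b + a) ^+ 3 + j).
exists ((moebius X)%:~R * ((-1) ^+ n.-1 * chim1 F ^+ 'C(n.-1, 2)) *
  (chim1 F ^+ (n.-1 * (size S).-1) * jac S j) *
  (chim1 F ^+ (n.-1 * (size l).-1)) * (chim1 F ^+ (n.-1 * (size Q).-1)) * jac H0 k%:P) => a.
set H := S ^+ 2 * (b + a) ^+ 3 + j => mH sH ca.
have HR : R %| H - S ^+ 2 * (c + a) ^+ 3.
  rewrite /H !(cubeD F3) (_ : _ - _ = S ^+ 2 * b ^+ 3 + j - S ^+ 2 * c ^+ 3) //; ring.
have cHR : coprimep H R.
  by rewrite (coprimep_congr HR) coprimepMl coprimep_expl // coprimep_expl.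
have dSH : S * H^`() + S^`() * H = g ^+ 3 * K^`().
  have -> : S * H^`() + S^`() * H = (S * H)^`() by rewrite derivM addrC.
  have -> : S * H = (S * (b + a)) ^+ 3 + (J ^+ 3 + g ^+ 3 * K).
    by rewrite -Ej /H; ring.
  by rewrite !derivD !deriv_cube derivM deriv_cube !add0r mul0r add0r.
have noR P : mi P -> P %| H -> P %| g ^+ 3 * K^`() -> False.
  move=> mP dH; have nR A : (P %| A -> P %| R) -> P %| A -> False.
    by move=> h dA; apply: (mi_notboth mP cHR dH); apply: h.
  rewrite EK -scalerAr dvdpZr // !mi_dvdM // !mi_dvdX //; last by rewrite addn1.
  rewrite !orbb => /or3P[].
  - by apply: nR => h; apply: dvdp_trans h lR.
  - by apply: nR => h; apply: dvdp_trans h QR.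
  by apply: nR; apply: wR.
have cHS : coprimep H S.
  apply: coprimep_mi => P mP dH dS; apply: (noR P) => //.
  by rewrite -dSH; apply: dvdp_add; [apply: dvdp_mulr|apply: dvdp_mull].
have sqH : sqf H.
  move=> P mP; apply/negP => /dvdP[C EC]; apply: (noR P) => //.
    by rewrite EC expr2 mulrA dvdp_mull.
  rewrite -dSH; apply: dvdp_add; apply: dvdp_mull; last by rewrite EC expr2 mulrA dvdp_mull.
  rewrite EC derivM expr2 derivM; apply: dvdp_add; first by rewrite mulrA dvdp_mull.
  by apply: dvdp_mull; apply: dvdp_add; [apply: dvdp_mull|apply: dvdp_mulr].
have sqXH : sqf (X * H).
  by apply: sqf_mul => //; rewrite coprimep_sym; apply: coprimep_dvdl cHR.
split => //; rewrite moebius_mul // rmorphM /= (pellet F3 mH sqH) sH.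
have cg A : jac A (c + a) ^+ 2 = 1 -> jac A ((c + a) ^+ 3) = jac A (c + a).
  by move=> h; rewrite jacX exprS h mulr1.
have jred A : A \is monic -> A %| R -> jac A H = jac A (c + a).
  move=> mA AR; rewrite (@jac_mod _ A H (S ^+ 2 * (c + a) ^+ 3)) //; last first.
    exact: dvdp_trans HR.
  have cA : coprimep A (c + a) by rewrite coprimep_sym; apply: coprimep_dvdl ca.
  have cAS : coprimep A S by rewrite coprimep_sym; apply: coprimep_dvdl SR.
  by rewrite jacM [jac A (S ^+ 2)]jacX (jac_sqr F3) // mul1r cg // (jac_sqr F3).
have wH : coprimep H w.
  by apply: coprimep_mi => P mP dH /(wR _ mP); apply: mi_notboth dH.
have e1 : jac H S * jac H H^`() = jac H g ^+ 3 * (jac H k%:P * jac H Q).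
  rewrite -jacM (@jac_mod _ H _ (g ^+ 3 * K^`())) //; last first.
    by rewrite -dSH opprD addNKr -mulNr dvdp_mull.
  rewrite EK -mul_polyC (jacM H (g ^+ 3)) (jacM H k%:P) (jacM H Q).
  by rewrite (jacX H g) (jacX H w) (jac_sqr F3 mH wH) mulr1.
have e2 : jac H g ^+ 3 = jac H l.
  have cHl : coprimep H l by apply: coprimep_dvdl cHR.
  by rewrite /g !jacX -exprM mulnDl mul1n exprD -mulnA exprM (jac_sqr F3) // expr1n mul1r exprS (jac_sqr F3) // mulr1.
have jS2 : jac H S ^+ 2 = 1 by rewrite (jac_sqr F3).
have e3 : jac H H^`() = jac H S * (jac H l * (jac H k%:P * jac H Q)).
  by rewrite -e2 -e1 mulrA -expr2 jS2 mul1r.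
rewrite e3 (jac_recip mH mS) (jac_recip mH mol) (jac_recip mH mQ) sH (jred l mol lR) (jred Q mQ QR).
rewrite (jac_const k mH mH0) ?sH0 // jacMl //.
rewrite (@jac_mod _ S H j) //; last first.
  by rewrite /H addrK exprS -mulrA dvdp_mulr.
ring.
Qed.

End MoebiusFamily.

(** * Assembling the family near a given polynomial *)

Section Assemble.
Variable F : finFieldType.
Local Notation q := #|F|.
Local Notation mi := (@monic_irreducible F).
Hypothesis F3 : exists e : nat, q = (3 ^ e)%N.
Implicit Types (A B C E G J S P R Q W X w c a b l j f g h : {poly F}).

(** A factor of T^rho + k for a k which makes it prime to W and to T^q - T, the
    product of all monic linear polynomials. *)
Lemma nonlinear_irreducible D rho W : sieve_ok F D rho -> W != 0 -> (0 < rho)%N ->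
  (size W + q + 5 <= D)%N ->
  exists l : {poly F}, [/\ mi l, (2 < size l)%N, (size l <= rho.+1)%N & ~~ (l %| W)].
Proof.
move=> sieve W0 rho0 sW.
have q1 := finNzRing_gt1 F.
have sV : size ('X^q - 'X : {poly F}) = q.+1.
  by rewrite size_polyDl ?size_polyXn // size_polyN size_polyX ltnS.
pose V : {poly F} := ('X^q - 'X) * W.
have V0 : V != 0 by rewrite mulf_neq0 // -size_poly_gt0 sV.
have [|||k [sk cV _]] := sieve V 1 'X^rho 0 1 0 V0 (oner_neq0 _).
- have := szM_leq ('X^q - 'X) W; rewrite sV size_poly1 -/V; slia.
- by move=> P mP _ _; rewrite mi_dvd1.
- by move=> P mP; rewrite mi_dvd1.
rewrite mulr1 in cV; have [mA sA] := monic_shift sk.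
have [|l ml lA] := @mi_factor F ('X^rho + k); first by rewrite sA; case: (rho) rho0.
have nV : ~~ (l %| V) by apply/negP => /(mi_notboth ml cV lA).
exists l; split => //.
- rewrite ltnNge; apply/negP => sl; case/negP: nV; rewrite dvdp_mulr //.
  have := mi_dvd_XqX F3 ml; have -> : (size l).-1 = 1%N by have := mi_size ml; slia.
  by rewrite expn1.
- by rewrite -sA; apply: sz_dvd => //; apply: monic_neq0.
by apply: contra nV => lW; rewrite dvdp_mull.
Qed.

(** Modulo the radical of G the polynomial A is a cube, so that A + t^3 is the
    cube of a shift by t. *)
Lemma shift_by_cube D rho A G : sieve_ok F D rho -> G != 0 -> (size G + 1 <= D)%N ->
  exists t : {poly F}, (size t <= rho)%N /\ coprimep (A + t ^+ 3) G.
Proof.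
move=> sieve G0 sG; have [R [mR sR RG hR]] := radical G0.
have [B [_ BE]] := cube_root_mod F3 A sR.
have [|||t [st cG _]] := sieve G 1 B 0 1 0 G0 (oner_neq0 _); rewrite ?size_poly1 //.
- by move=> P mP _ _; rewrite mi_dvd1.
- by move=> P mP; rewrite mi_dvd1.
exists t; split => //; apply: coprimep_mi => P mP dA dG; rewrite mulr1 in cG.
apply: (mi_notboth mP cG _ dG); rewrite -(mi_dvdX _ mP (isT : (0 < 3)%N)) (cubeD F3).
have PR : P %| R by rewrite -hR.
by rewrite -[X in _ %| X](subrK (A + t ^+ 3)) dvdp_add // opprD addrACA subrr addr0 (dvdp_trans PR).
Qed.

Lemma size_cube_leq A n : (size A <= n.+1)%N -> (size (A ^+ 3)%R <= (3 * n).+1)%N.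
Proof.
move=> sA; apply: (leq_trans (size_poly_exp_leq _ _)); rewrite ltnS mulnC leq_mul2l /=.
slia.
Qed.

(** In F_a = X1 (S^2 (b + a)^3 + j) the part X1 j has to approximate E. With
    S j = J^3 + g^3 K, K is the quotient of S E by X1 g^3 up to a short
    correction T t^3, and J restores divisibility by S. The power g of l
    absorbs the common leading part, so that K' is as small as the interval
    permits: deg K' is about deg E minus the length of the interval. *)
Lemma both_signs_near D rho f X b0 E dX e n : sieve_ok F D rho ->
  character_ok F D (rho + rho) -> (0 < rho)%N -> f \is monic -> f = X * b0 ^+ 3 + E ->
  X \is monic -> size X = dX.+1 -> (size E <= e)%N -> (n < size f)%N -> (e <= size f)%N ->
  (6 * e + 5 * dX + 200 * rho <= 11 * n)%N -> (dX + 100 * rho <= n)%N ->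
  (30 * size f + q + 30 <= D)%N ->
  exists g h : {poly F}, [/\ (size g <= n)%N, (size h <= n)%N,
    moebius (f + g) = 1 & moebius (f + h) = -1].
Proof.
move=> sieve ok rho0 mf Ef mX sX sE nf ef c1 c2 budget.
have [C [X1 [S [EX mC mX1 mS sXS]]]] := cubefree_decomposition mX.
have X10 := monic_neq0 mX1; have S0 := monic_neq0 mS; have X0 := monic_neq0 mX.
pose x := (size X1).-1; pose s := (size S).-1.
have xE : size X1 = x.+1 by have := sz_gt0 X10; rewrite /x; slia.
have sSE : size S = s.+1 by have := sz_gt0 S0; rewrite /s; slia.
clearbody x s.
have xs : (x + 2 * s <= dX)%N.
  have d : X1 * (S * S) %| X by rewrite EX -mulrA expr2 dvdp_mull.
  have := sz_dvd X0 d; rewrite sX !szM ?mulf_neq0 // xE sSE; slia.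
have sqX1 : sqf X1 by apply: (sqf_dvd sXS); rewrite dvdp_mulr.
have sqS : sqf S by apply: (sqf_dvd sXS); rewrite dvdp_mull.
have cSX1 : coprimep S X1 by rewrite coprimep_sym; apply: sqf_coprime.
have XS0 : X1 * S != 0 by rewrite mulf_neq0.
have [|l [ml l2 lrho nl]] := nonlinear_irreducible sieve XS0 rho0.
  by rewrite szM // xE sSE; slia.
have mol := mi_monic ml; have l0 := mi_neq0 ml.
move: nl; rewrite mi_dvdM // negb_or => /andP[lX1 lS].
pose la := (size l).-1.
have laE : size l = la.+1 by have := sz_gt0 l0; rewrite /la; slia.
clearbody la.
(* T bounds 3 deg g; i is the largest exponent that fits *)
pose T := (n + s + 1 - x - 3 * rho)%N; pose i := ((T - 3 * la) %/ (6 * la))%N.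
pose gam := (la * (2 * i + 1))%N.
have la0 : (0 < 6 * la)%N by slia.
have T3 : (3 * la <= T)%N by rewrite /T; slia.
have [gam1 gam2] : (3 * gam <= T)%N /\ (T < 3 * gam + 6 * la)%N.
  have E1 := divn_eq (T - 3 * la) (6 * la); have E2 := ltn_pmod (T - 3 * la) la0.
  have E3 : (3 * gam = i * (6 * la) + 3 * la)%N by rewrite /gam; ring.
  rewrite -/i in E1; rewrite E3; move: E1 E2 T3; set u := (i * _)%N; set v := (_ %% _)%N.
  by clearbody u v T; clear; lia.
rewrite /T in gam1 gam2.
set g : {poly F} := l ^+ (2 * i + 1).
have mg : g \is monic by rewrite monic_exp.
have g0 := monic_neq0 mg.
have sg : size g = gam.+1.
  have := size_exp l (2 * i + 1); have := sz_gt0 g0; rewrite laE -/g -/gam /=; slia.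
have sg3 : size (g ^+ 3) = (3 * gam).+1.
  by rewrite !exprS expr0 mulr1 !szM ?mulf_neq0 // sg; slia.
clearbody gam.
pose Z : {poly F} := X1 * g ^+ 3.
have Z0 : Z != 0 by rewrite mulf_neq0 // expf_neq0.
have sZ : size Z = (x + 3 * gam).+1 by rewrite szM ?expf_neq0 // xE sg3; slia.
pose fl : {poly F} := (S * E) %/ Z; pose re : {poly F} := (S * E) %% Z.
have Efl : S * E = fl * Z + re by apply: divp_eq.
have sre : (size re <= x + 3 * gam)%N by have := sz_mod (S * E) Z0; rewrite -/re sZ; slia.
have sSEE : (size (S * E)%R <= s + e)%N by have := szM_leq S E; rewrite sSE; slia.
have sfl : (size fl <= (s + e) - (x + 3 * gam))%N.
  have Efl' : S * E - re = fl * Z by rewrite Efl addrK.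
  by apply: (size_divM Z0 Efl' sZ); have := szB (S * E) re; slia.
have Sl0 : S * l != 0 by rewrite mulf_neq0.
have [|t [st ct]] := shift_by_cube fl^`() sieve Sl0.
  by rewrite szM // sSE laE; slia.
pose K : {poly F} := fl + 'X * t ^+ 3.
have EK' : K^`() = fl^`() + t ^+ 3.
  by rewrite derivD derivM (deriv_cube F3) mulr0 addr0 derivX mul1r.
rewrite -EK' in ct.
have K'0 : K^`() != 0.
  apply/eqP => K0; move: ct; rewrite K0 coprime0p => /eqp_size.
  by rewrite szM // sSE laE size_poly1; slia.
have st3 : (size (t ^+ 3)%R <= 3 * rho)%N.
  have st' : (size t <= rho.-1.+1)%N by rewrite prednK.
  by have := size_cube_leq st'; slia.
have sK' : (size K^`()%R <= maxn ((s + e) - (x + 3 * gam)) (3 * rho))%N.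
  rewrite EK'; have := szD fl^`() (t ^+ 3).
  have : (size fl^`()%R <= size fl)%N.
    by have [->|/lt_size_deriv/ltnW //] := eqVneq fl 0; rewrite deriv0.
  slia.
have [J [sJ JE]] := cube_root_mod F3 (- (g ^+ 3 * K)) sqS.
rewrite opprK sSE /= in sJ JE.
have [j Ej] : exists j : {poly F}, J ^+ 3 + g ^+ 3 * K = j * S by apply: dvdP.
have Ej' : S * j = J ^+ 3 + (l ^+ (2 * i + 1)) ^+ 3 * K by rewrite -/g Ej mulrC.
pose k := lead_coef K^`().
have k0 : k != 0 by rewrite lead_coef_eq0.
have mK : k^-1 *: K^`() \is monic by rewrite monicE lead_coefZ mulVf.
have [Q [w [EQ mQ mw sqQ]]] := sqf_decomposition mK.
have EK : K^`() = k *: (Q * w ^+ 2) by rewrite -EQ scalerA divff // scale1r.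
have QK : Q %| K^`() by rewrite EK dvdpZr // dvdp_mulr.
have wK : w %| K^`() by rewrite EK dvdpZr // dvdp_mull // expr2 dvdp_mulr.
have [SK lK] : coprimep K^`() S /\ coprimep K^`() l.
  by move: ct; rewrite coprimepMr => /andP.
have G0 : X1 * l * K^`() != 0 by rewrite !mulf_neq0.
have [R [mR sqR RG hR]] := radical G0.
have inR P : mi P -> (P %| X1) || (P %| l) || (P %| K^`()) -> P %| R.
  by move=> mP; rewrite -hR // !mi_dvdM.
have XR : X1 %| R by apply: sqf_dvdp => // P mP dP; apply: inR; rewrite ?dP.
have lR : l %| R by apply: inR; rewrite // dvdpp orbT.
have QR : Q %| R.
  by apply: sqf_dvdp => // P mP dP; apply: inR => //; rewrite (dvdp_trans dP QK) orbT.
have wR P : mi P -> P %| w -> P %| R.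
  by move=> mP dP; apply: inR => //; rewrite (dvdp_trans dP wK) orbT.
have SR : coprimep S R.
  apply: coprimep_mi => P mP dS; rewrite -hR // !mi_dvdM // => /orP[/orP[]|].
  - exact: mi_notboth dS.
  - by rewrite mi_dvd_eq // => /eqP El; case/negP: lS; rewrite -El.
  by move=> dK; apply: (mi_notboth mP SK dK dS).
have [Ro ER] : exists Ro : {poly F}, R = Ro * l by apply: dvdP.
have ER' : R = l * Ro by rewrite mulrC.
have R0 := monic_neq0 mR.
have Ro0 : Ro != 0 by apply: contraNneq R0 => h; rewrite ER h mul0r.
have lRo : ~~ (l %| Ro).
  by rewrite -mi_coprime //; apply: sqf_coprime; rewrite -ER'.
have QRo : Q %| Ro.
  have clQ : coprimep Q l by rewrite coprimep_sym; apply: (coprimep_dvdl QK); rewrite coprimep_sym.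
  by move: QR; rewrite ER Gauss_dvdpl.
pose b : {poly F} := C * b0.
have [u uE] : exists u : {poly F}, R %| S ^+ 2 * u - 1.
  by apply: inv_mod; rewrite coprimep_expl.
have [c [_ cE]] := cube_root_mod F3 (b ^+ 3 + j * u) sqR.
have Rc : R %| S ^+ 2 * b ^+ 3 + j - S ^+ 2 * c ^+ 3.
  rewrite (_ : _ - _ = - (S ^+ 2 * (c ^+ 3 - (b ^+ 3 + j * u))) - j * (S ^+ 2 * u - 1)); last ring.
  by rewrite dvdp_sub ?dvdpNr ?dvdp_mull.
(* the size of a for which X1 S^2 a^3 fits in the interval *)
pose d := ((n + 2 - x - 2 * s) %/ 3)%N.
have [d1 d2] : (x + 2 * s + 3 * d <= n + 2)%N /\ (n < x + 2 * s + 3 * d + 1)%N.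
  have := divn_eq (n + 2 - x - 2 * s) 3; have := ltn_pmod (n + 2 - x - 2 * s) (isT : (0 < 3)%N).
  rewrite -/d; slia.
clearbody d.
have sX1j : (size (X1 * j - E)%R <= n)%N.
  have E1 : X1 * J ^+ 3 + Z * ('X * t ^+ 3) - re = (X1 * j - E) * S.
    transitivity (X1 * (j * S) - S * E); last by ring.
    by rewrite -Ej Efl /Z /K; ring.
  apply: (size_divM S0 E1 sSE).
  have b1 : (size (X1 * J ^+ 3)%R <= n + s)%N.
    have h1 := szM_leq X1 (J ^+ 3).
    have h2 : (size (J ^+ 3)%R <= (3 * s).+1)%N by apply: size_cube_leq; slia.
    by move: h1 h2 xE xs c2 rho0; clear; slia.
  have b2 : (size (Z * ('X * t ^+ 3))%R <= n + s)%N.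
    have h1 := szM_leq Z ('X * t ^+ 3); have h2 := szM_leq 'X (t ^+ 3).
    have h3 : (size (t ^+ 3)%R <= (3 * rho.-1).+1)%N by apply: size_cube_leq; rewrite prednK.
    by rewrite size_polyX in h2; move: h1 h2 h3 sZ gam1 rho0 c2 xs; clear; slia.
  have h1 := szB (X1 * J ^+ 3 + Z * ('X * t ^+ 3)) re.
  have h2 := szD (X1 * J ^+ 3) (Z * ('X * t ^+ 3)).
  by move: h1 h2 b1 b2 sre gam1 rho0 xs c2; clear; slia.
pose H a : {poly F} := S ^+ 2 * (b + a) ^+ 3 + j.
have near a : (size a <= d)%N -> (size (X1 * H a - f)%R <= n)%N.
  move=> sa; have -> : X1 * H a - f = X1 * (S * S) * a ^+ 3 + (X1 * j - E).
    by rewrite /H (cubeD F3) Ef EX /b; ring.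
  have h1 := szD (X1 * (S * S) * a ^+ 3) (X1 * j - E).
  have h2 := szM_leq (X1 * (S * S)) (a ^+ 3).
  have h3 : (size (X1 * (S * S))%R = (x + 2 * s).+1)%N.
    by rewrite !szM ?mulf_neq0 // xE sSE; clear; slia.
  have h4 : (size (a ^+ 3)%R <= (3 * d.-1).+1)%N.
    by apply: size_cube_leq; move: sa; clear; slia.
  by move: h1 h2 h3 h4 d1 sX1j c2 xs rho0; clear; slia.
have [kappa kapE] := moebius_family F3 (size f - x) mX1 sqX1 mS ml mQ (monic_neq0 mw) k0 EK Ej' XR lR QR wR SR Rc.
have val (e' : clo F) : e' = 1 \/ e' = -1 -> exists a : {poly F},
    [/\ (size (X1 * H a - f)%R <= n)%N, sqf (X1 * H a) & (moebius (X1 * H a))%:~R = kappa * e'].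
  move=> he; have [|||a [sa ca ja]] := symbol_both_signs F3 c sieve ok ml l2 lRo Ro0 mQ sqQ QRo (d := d) _ _ _ he.
  - rewrite -ER'; have := sz_dvd G0 RG; have := szM_leq (X1 * l) K^`().
    have sXl : (size (X1 * l)%R = (x + la).+1)%N by rewrite szM // xE laE; clear; slia.
    by move: sXl sK' lrho laE c2 budget ef nf d1 xs rho0; clear; slia.
  - by move: laE lrho d2 xs c2 rho0; clear; slia.
  - have := sz_dvd K'0 QK; have := szM_leq l Q.
    by move: laE lrho d2 xs c1 c2 gam2 sK' rho0; clear; slia.
  have na := near a sa; have f0 := monic_neq0 mf.
  have lt : (size (X1 * H a - f)%R < size f)%N by apply: leq_ltn_trans nf.
  have EF : X1 * H a = f + (X1 * H a - f) by rewrite addrC subrK.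
  have mF : X1 * H a \is monic by rewrite EF monicE lead_coefDl // (monicP mf).
  have sF : size (X1 * H a) = size f by rewrite EF size_polyDl.
  have mH : H a \is monic by move: mF; rewrite monicMl.
  have sH : size (H a) = (size f - x)%N.
    have := szM X10 (monic_neq0 mH); rewrite sF xE; have := sz_gt0 (monic_neq0 mH); clear; slia.
  have [|sq mu] := kapE a mH sH; first by rewrite ER'.
  by exists a; split => //; rewrite mu ja.
have [a [na sa mua]] := val 1 (or_introl erefl).
have [a' [na' sa' mua']] := val (-1) (or_intror erefl).
rewrite mulr1 in mua; rewrite mulrN1 -mua in mua'.
have Ef' B : f + (B - f) = B by rewrite addrC subrK.
have n1 := clo_neq1N F3.
case: (moebius_sign sa) (moebius_sign sa') => ma [] ma'; last 3 first.
- by exists (X1 * H a - f), (X1 * H a' - f); rewrite !Ef'.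
- by exists (X1 * H a' - f), (X1 * H a - f); rewrite !Ef'.
- by move/eqP: mua'; rewrite ma ma' rmorphN rmorph1 opprK (negPf n1).
by move/eqP: mua'; rewrite ma ma' rmorph1 eq_sym (negPf n1).
Qed.

End Assemble.

(** * Approximating a polynomial by a small multiple of a cube *)

Section CubeApproximation.
Variable F : finFieldType.
Local Notation q := #|F|.
Hypothesis F3 : exists e : nat, q = (3 ^ e)%N.
Implicit Types (A B E R X f u phi a b : {poly F}).

Lemma cube_root_const (x : F) : exists y, x = y ^+ 3.
Proof.
have [[|e] qE] := F3; first by have := finNzRing_gt1 F; rewrite qE.
by exists (x ^+ (3 ^ e)); rewrite -exprM -expnSr -qE expf_card.
Qed.

(** Splitting a polynomial by exponents modulo 3, the part with the leading
    term first. *)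
Lemma cube_components A : A != 0 -> exists (phi a b : {poly F}) (i : nat),
  [/\ (i < 3)%N, phi != 0, size A = (3 * (size phi).-1 + i).+1,
     lead_coef A = lead_coef phi ^+ 3 &
     A = 'X^i * phi ^+ 3 + 'X^((i + 1) %% 3) * a ^+ 3 + 'X^((i + 2) %% 3) * b ^+ 3].
Proof.
elim/poly_ind: A => [|A c IH]; first by rewrite eqxx.
have [y cE] := cube_root_const c.
have cE' : c%:P = y%:P ^+ 3 by rewrite cE polyC_exp.
have [->|A0 _] := eqVneq A 0.
  rewrite mul0r add0r => c0; exists y%:P, 0, 0, 0%N; split => //.
  - by rewrite polyC_eq0; apply: contraNneq c0 => y0; rewrite cE y0 expr0n.
  - by rewrite !size_polyC; move: c0; rewrite polyC_eq0 cE expf_eq0 /= => ->.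
  - by rewrite !lead_coefC cE.
  by rewrite cE' !expr0n /= !mulr0 !addr0 mul1r.
have [phi [a [b [i [i3 p0 sA lA EA]]]]] := IH A0.
have sp := sz_gt0 p0.
have sAX : size (A * 'X + c%:P) = (size A).+1.
  by rewrite size_MXaddC (negPf A0).
have lAX : lead_coef (A * 'X + c%:P) = lead_coef phi ^+ 3.
  rewrite lead_coefDl ?lead_coefMX // size_mulX // size_polyC.
  by have := sz_gt0 A0; case: (c == 0) => /=; slia.
case: i i3 sA EA => [|[|[|//]]] _ sA EA.
- exists phi, a, ('X * b + y%:P), 1%N; split => //; first by rewrite sAX sA; clear; slia.
  by rewrite EA cE' (cubeD F3) /=; ring.
- exists phi, ('X * a + y%:P), b, 2%N; split => //; first by rewrite sAX sA; clear; slia.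
  by rewrite EA cE' (cubeD F3) /=; ring.
have lt : (size (y%:P)%R < size ('X * phi)%R)%N.
  by rewrite mulrC size_mulX // size_polyC; case: (y == 0) => /=; slia.
exists ('X * phi + y%:P), a, b, 0%N; split => //.
- by rewrite -size_poly_gt0 size_polyDl // mulrC size_mulX.
- by rewrite sAX sA size_polyDl // mulrC size_mulX //; slia.
- by rewrite lAX lead_coefDl // mulrC lead_coefMX.
by rewrite EA cE' (cubeD F3) /=; ring.
Qed.

(** Simultaneous approximation with denominator u: pigeonhole on the top
    coefficients of the two residues. *)
Lemma simultaneous_residues phi a b n c : phi != 0 -> (0 < n)%N -> (2 * (size phi).-1 < n + 2 * c)%N ->
  exists u : {poly F}, [/\ u \is monic, (size u <= n)%N, (size ((a * u) %% phi)%R <= c)%N &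
                           (size ((b * u) %% phi)%R <= c)%N].
Proof.
move=> p0 n0 lt; set m := (size phi).-1 in lt; set r := (m - c)%N.
have sp := sz_gt0 p0.
have szm A : (size (A %% phi)%R <= m)%N by have := sz_mod A p0; rewrite /m; slia.
pose f (u : {poly_n F}) : {poly_r F} * {poly_r F} :=
  (npolyp r (drop_poly c ((a * val u) %% phi)), npolyp r (drop_poly c ((b * val u) %% phi))).
have lt2 : (r + r < n)%N by rewrite /r; slia.
have [u [v [uv E]]] : exists u v : {poly_n F}, u <> v /\ f u = f v.
  apply: contrapT => nh; have inj : injective f.
    by move=> u v E; apply: contrapT => uv; apply: nh; exists u, v.
  have := leq_card _ inj; rewrite card_prod !card_npoly -expnD leq_exp2l ?finNzRing_gt1 //.
  by rewrite leqNgt lt2.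
pose w : {poly F} := val u - val v.
have w0 : w != 0 by rewrite subr_eq0; apply/eqP => /val_inj.
have sw : (size w <= n)%N.
  by apply: (leq_trans (szB _ _)); rewrite geq_max; apply/andP; split; exact: size_npoly.
have res A : npolyp r (drop_poly c ((A * val u) %% phi)) = npolyp r (drop_poly c ((A * val v) %% phi)) ->
    (size ((A * w) %% phi)%R <= c)%N.
  have sd B : (size (drop_poly c (B %% phi)) <= r)%N.
    by rewrite size_drop_poly leq_sub2r.
  move/(congr1 val); rewrite /= !npolypK // => Ed.
  rewrite /w mulrBr modpD modpN; apply/leq_sizeP => i ci.
  have := congr1 (fun p : {poly F} => p`_(i - c)) Ed; rewrite !coef_drop_poly subnK // => Ei.
  by rewrite coefB; apply/eqP; rewrite subr_eq0; apply/eqP; exact: Ei.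
case: E => Ea Eb.
have l0 : (lead_coef w)^-1 != 0 by rewrite invr_eq0 lead_coef_eq0.
exists ((lead_coef w)^-1 *: w); split.
- by rewrite monicE lead_coefZ mulVf // lead_coef_eq0.
- by rewrite size_scale.
- by rewrite -scalerAr modpZl size_scale // res.
- by rewrite -scalerAr modpZl size_scale // res.
Qed.

Lemma size_cube_pos A n : (size A <= n)%N -> (size (A ^+ 3)%R <= 3 * n - 2)%N.
Proof.
case: n => [|n] sA; first by move: sA; rewrite leqn0 size_poly_eq0 => /eqP ->; rewrite expr0n size_poly0.
by have := size_cube_leq sA; slia.
Qed.

(** If phi is the leading component and u the common denominator, f u^3 differs
    from a multiple X phi^3 by a short polynomial; b is the quotient of phi by
    u, and replacing phi by b u costs X times the cube of the remainder. *)
Lemma cube_approximation f N c n : f \is monic -> size f = N.+1 ->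
  (0 < n)%N -> (3 * c <= N)%N -> (2 * (N %/ 3) < n + 2 * c)%N ->
  exists (X b E : {poly F}) (h : nat),
  [/\ f = X * b ^+ 3 + E, X \is monic, (size X <= 3 * h + 3)%N, (h < n)%N &
      (size E <= maxn (3 * c - 3 * h) (3 * h))%N].
Proof.
move=> mf sf n0 cN lt; have f0 := monic_neq0 mf.
have [phi [a [b [i [i3 p0 sfE lf Ef]]]]] := cube_components f0.
have mphi : phi \is monic.
  have l3 : ((lead_coef phi)%:P - 1%:P) ^+ 3 = 0 :> {poly F}.
    by rewrite (cubeB F3) -!polyC_exp -lf (monicP mf) expr1n subrr.
  by rewrite monicE -subr_eq0 -polyC_eq0 polyCB; move/eqP: l3; rewrite expf_eq0.
pose m := (size phi).-1; have sphi : size phi = m.+1 by have := sz_gt0 p0; rewrite /m; slia.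
clearbody m; rewrite sf sphi /= in sfE; case: sfE => NE.
have Nm : (N %/ 3 = m)%N by rewrite NE mulnC divnMDl // divn_small // addn0.
have [|u [mu su sa sb]] := @simultaneous_residues phi a b n c p0 n0.
  by rewrite sphi -Nm.
have u0 := monic_neq0 mu; pose h := (size u).-1.
have suE : size u = h.+1 by have := sz_gt0 u0; rewrite /h; slia.
clearbody h.
set ra := (a * u) %% phi in sa; set rb := (b * u) %% phi in sb.
pose qa : {poly F} := (a * u) %/ phi; pose qb : {poly F} := (b * u) %/ phi.
have Ea : a * u = qa * phi + ra by apply: divp_eq.
have Eb : b * u = qb * phi + rb by apply: divp_eq.
pose i1 := ((i + 1) %% 3)%N; pose i2 := ((i + 2) %% 3)%N.
have i13 : (i1 <= 2)%N by rewrite -ltnS ltn_pmod.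
have i23 : (i2 <= 2)%N by rewrite -ltnS ltn_pmod.
pose X : {poly F} := 'X^i * u ^+ 3 + 'X^i1 * qa ^+ 3 + 'X^i2 * qb ^+ 3.
pose E' : {poly F} := 'X^i1 * ra ^+ 3 + 'X^i2 * rb ^+ 3.
have fu : f * u ^+ 3 = X * phi ^+ 3 + E'.
  transitivity ('X^i * (phi * u) ^+ 3 + 'X^i1 * (a * u) ^+ 3 + 'X^i2 * (b * u) ^+ 3).
    by rewrite [in LHS]Ef -/i1 -/i2; ring.
  by rewrite Ea Eb !(cubeD F3) /X /E'; ring.
have sE' : (size E' <= 3 * c)%N.
  have h1 := szD ('X^i1 * ra ^+ 3) ('X^i2 * rb ^+ 3).
  have h2 := szM_leq 'X^i1 (ra ^+ 3); have h3 := szM_leq 'X^i2 (rb ^+ 3).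
  have h4 := size_cube_pos sa; have h5 := size_cube_pos sb.
  rewrite !size_polyXn in h2 h3; case: (posnP c) => [c0|c0].
    move: sa sb; rewrite c0 !leqn0 !size_poly_eq0 => /eqP ra0 /eqP rb0.
    by rewrite /E' ra0 rb0 expr0n /= !mulr0 addr0.
  by rewrite -/E' in h1; move: h1 h2 h3 h4 h5 i13 i23 c0; clear; slia.
have su3 : size (u ^+ 3) = (3 * h).+1.
  by rewrite !exprS expr0 mulr1 !szM ?mulf_neq0 // suE; clear; slia.
have sp3 : size (phi ^+ 3) = (3 * m).+1.
  by rewrite !exprS expr0 mulr1 !szM ?mulf_neq0 // sphi; clear; slia.
have EX : X * phi ^+ 3 = f * u ^+ 3 - E' by rewrite fu addrK.
have mfu : f * u ^+ 3 \is monic by rewrite monicMl ?monic_exp.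
have sfu : size (f * u ^+ 3) = (N + 3 * h).+1.
  by rewrite szM ?expf_neq0 // sf su3; clear; slia.
have ltE : (size (- E')%R < size (f * u ^+ 3)%R)%N.
  by rewrite size_polyN sfu; move: sE' cN; clear; slia.
have mX : X \is monic.
  have : X * phi ^+ 3 \is monic by rewrite EX monicE lead_coefDl // (monicP mfu).
  by rewrite monicMr // monic_exp.
have X0 := monic_neq0 mX.
have sX : (size X <= 3 * h + 3)%N.
  have := szM X0 (expf_neq0 3 p0); rewrite EX size_polyDl // sfu sp3 NE.
  by have := sz_gt0 X0; move: i3; clear; slia.
pose ro : {poly F} := phi %% u; pose bq : {poly F} := phi %/ u.
have Eq : phi = bq * u + ro by apply: divp_eq.
have sro : (size ro <= h)%N by have := sz_mod phi u0; rewrite -/ro suE; clear; slia.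
exists X, bq, (f - X * bq ^+ 3), h; split => //.
- by rewrite addrC subrK.
- by move: su; rewrite suE.
have EE : E' + X * ro ^+ 3 = (f - X * bq ^+ 3) * u ^+ 3.
  have -> : ro = phi - bq * u by rewrite {1}Eq addrC addKr.
  rewrite (cubeB F3) mulrBl fu; ring.
apply: (size_divM (expf_neq0 3 u0) EE su3).
have h1 := szD E' (X * ro ^+ 3); have h2 := szM_leq X (ro ^+ 3).
have h3 := size_cube_pos sro.
case: (posnP h) => [h0|h0].
  have ro0 : ro = 0 by apply/eqP; rewrite -size_poly_eq0 -leqn0 -h0.
  by rewrite ro0 expr0n mulr0 addr0; move: sE'; clear; slia.
by move: h1 h2 h3 sE' sX h0; clear; slia.
Qed.

End CubeApproximation.

(** * Choice of parameters *)

Section DegreeCount.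
Variable F : finFieldType.
Local Notation q := #|F|.
Hypothesis F3 : exists e : nat, q = (3 ^ e)%N.

Lemma pow3_quadratic e : (6 <= e)%N -> (8 * (e + 1) * (e + 1) < 3 ^ e)%N.
Proof.
elim: e => // e IH; rewrite leq_eqVlt => /orP[/eqP <- //|h].
have := IH h; rewrite expnS; nia.
Qed.

(** The interval has degree slightly above 3N/7. With c about 11n/18 the degree h
    of the denominator is at most 2(N/3 - c), hence at most about n/3. Then both
    bounds 3c - 3h and 3h for the error of the cube approximation satisfy
    6 deg E + 5 deg X <= 11n, where deg X is about 3h; for the second one this is
    33h <= 11n, an equality in the limit N : n : h = 7 : 3 : 1. *)
Lemma both_signs_degree (f : {poly F}) N L : f \is monic -> size f = N.+1 ->
  (30 * N + q + 60 <= L.+1 * q ^ L.+1)%N ->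
  (12 < q ^ L.+1 + L.+1)%N -> (400 * (q ^ L.+1 + L.+1) + 100 <= N)%N ->
  exists g h : {poly F},
  [/\ (size g <= (3 * N + 300 * (q ^ L.+1 + L.+1) + 26) %/ 7)%N,
      (size h <= (3 * N + 300 * (q ^ L.+1 + L.+1) + 26) %/ 7)%N,
    moebius (f + g) = 1 & moebius (f + h) = -1].
Proof.
move=> mf sf; set rho := (q ^ L.+1 + L.+1)%N; set D := (30 * N + q + 60)%N => DL r12 rN.
have sieve : sieve_ok F D rho by apply: (sieve_okP F3 DL).
have qL : (q ^ L.+1 <= rho)%N by rewrite /rho leq_addr.
have Lr : (L.+1 <= rho)%N by rewrite /rho leq_addl.
have Drho : (D <= rho * rho)%N by apply: (leq_trans DL); apply: leq_mul.
have q3 : (3 <= q)%N.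
  have [[|e] qE] := F3; have := finNzRing_gt1 F; rewrite qE // => _.
  by rewrite expnS leq_pmulr // expn_gt0.
clearbody rho.
have ok : character_ok F D (rho + rho).
  pose e := (rho./2)%N.
  have [e1 e2] : (2 * e <= rho)%N /\ (rho <= 2 * e + 1)%N.
    by rewrite /e; have := odd_double_half rho; case: odd; rewrite -muln2; lia.
  have e6 : (6 <= e)%N by lia.
  have De : (2 * D + 2 < 3 ^ e)%N.
    apply: leq_ltn_trans (pow3_quadratic e6).
    have : (rho * rho <= (2 * e + 1) * (2 * e + 1))%N by apply: leq_mul.
    move: Drho; clear; nia.
  apply: (character_okP F3 (e := e)); first by lia.
  apply: (@leq_trans (3 ^ (rho + rho))); last first.
    by rewrite leq_exp2r //; lia.
  apply: (@leq_trans (3 ^ (e + (e + (e + 2))))); last by rewrite leq_exp2l //; lia.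
  rewrite expnD leq_mul2l; apply/orP; right; rewrite expnD.
  have E2 : (3 ^ (e + 2) = 9 * 3 ^ e)%N by rewrite expnD mulnC.
  have : (3 ^ e * (D + 2) <= 3 ^ e * 3 ^ e)%N by rewrite leq_mul2l; apply/orP; right; lia.
  have : (3 ^ e * 1 <= 3 ^ e * 3 ^ e)%N by rewrite leq_mul2l expn_gt0 orbT.
  rewrite E2; move: De; set t := (3 ^ e)%N; clear; nia.
set n := ((3 * N + 300 * rho + 26) %/ 7)%N.
have [n1 n2] : (7 * n <= 3 * N + 300 * rho + 26)%N /\ (3 * N + 300 * rho + 20 <= 7 * n)%N.
  by rewrite /n; clear; split; lia.
clearbody n.
pose c := ((11 * n - 200 * rho - 10) %/ 18)%N.
have [c1 c2] : (18 * c + 200 * rho + 10 <= 11 * n)%N /\ (11 * n <= 18 * c + 200 * rho + 27)%N.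
  by rewrite /c; move: n2 rN; clear; split; lia.
clearbody c.
pose kap := (2 * (N %/ 3) + 1 - 2 * c)%N.
have [k1 k2] : (3 * c <= N)%N /\ (c <= N %/ 3)%N.
  by move: c1 c2 n1 n2 rN; clear; split; lia.
have [|||X [b [E [h [Ef mX sX hk sE]]]]] := cube_approximation F3 (n := kap) (c := c) mf sf.
- by rewrite /kap; lia.
- by [].
- by rewrite /kap; lia.
have hk' : (h + 2 * c <= 2 * (N %/ 3))%N by move: hk; rewrite /kap; lia.
have hN : (3 * h + 6 * c <= 2 * N)%N by lia.
have sX0 := sz_gt0 (monic_neq0 mX).
have sXE : size X = (size X).-1.+1 by rewrite prednK.
apply: (both_signs_near F3 sieve ok _ mf Ef mX sXE sE); rewrite ?sf.
- by lia.
- by lia.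
- by lia.
- move: sX; clear -hN c1 c2 n1 n2 r12; slia.
- move: sX; clear -hN c1 c2 n1 n2 r12; slia.
- by rewrite /D; lia.
Qed.

End DegreeCount.

(** L is the largest integer for which q^(L+1) is a small proportion of N, so
    that L tends to infinity with N. *)
Lemma interval_parameters q M : (2 < q)%N -> (0 < M)%N -> exists N0, forall N, (N0 <= N)%N ->
  exists L, [/\ (30 * N + q + 60 <= L.+1 * q ^ L.+1)%N,
    (12 < q ^ L.+1 + L.+1)%N, (400 * (q ^ L.+1 + L.+1) + 100 <= N)%N &
    (M * (300 * (q ^ L.+1 + L.+1) + 19) <= N)%N].
Proof.
move=> q2 M0; pose A := (1000 * M)%N.
pose T := ((90 + q) * (A * q))%N.
have q1 : (1 < q)%N by apply: ltnW.
exists (A * q ^ T)%N => N hN.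
have A0 : (0 < A)%N by rewrite muln_gt0.
have T0 : (13 <= T)%N by rewrite /T; nia.
have NA : (q ^ T <= N %/ A)%N by rewrite leq_divRL // mulnC.
have NA0 : (0 < N %/ A)%N by apply: leq_trans NA; rewrite expn_gt0 (ltnW q1).
pose t := trunc_log q (N %/ A).
have [t1 t2] : (q ^ t <= N %/ A)%N /\ (N %/ A < q ^ t.+1)%N by apply/andP/trunc_log_bounds.
have tT : (T <= t)%N by apply: trunc_log_max.
case: t t1 t2 tT => [|L] t1 t2 tT; first by lia.
have LL : (L.+1 < q ^ L.+1)%N by apply: ltn_expl.
move: t1; rewrite leq_divRL // => t1; move: t2; rewrite ltn_divLR // expnS => t2.
exists L; set s := (q ^ L.+1)%N in LL t1 t2 *.
have s0 : (0 < s)%N by lia.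
split.
- have N1 : (30 * N + q + 60 <= (90 + q) * N)%N.
    have : (1 <= N)%N by nia.
    nia.
  apply: (leq_trans N1); apply: (@leq_trans ((90 + q) * (A * q * s))).
    by rewrite leq_mul2l; apply/orP; right; nia.
  by rewrite mulnA -/T leq_mul2r tT orbT.
- by lia.
- have h : (s * 1000 <= s * A)%N by rewrite leq_mul2l /A leq_pmulr // orbT.
  by move: (leq_trans h t1) LL s0; clear; lia.
apply: (leq_trans _ t1); rewrite [(s * A)%N]mulnC /A -mulnA mulnCA leq_mul2l.
by apply/orP; right; move: LL s0; clear; lia.
Qed.

(** * The theorem *)

Lemma pnorm_le_powR (R : realType) (F : finFieldType) (eta : R) (f g : {poly F}) m :
  f != 0 -> (size g <= m.+1)%N -> m%:R <= eta * (size f).-1%:R ->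
  (pnorm g)%:R <= powR (pnorm f)%:R eta.
Proof.
move=> f0 sg me; have q1 := finNzRing_gt1 F.
have qR : 1 <= #|F|%:R :> R by rewrite ler1n ltnW.
apply: (@le_trans _ _ (#|F| ^ m)%:R).
  rewrite ler_nat /pnorm; case: eqP => // _; rewrite leq_exp2l //; slia.
rewrite /pnorm (negPf f0) !natrX -!powR_mulrn ?ler0n // -powRrM.
by rewrite ler_powR // mulrC.
Qed.


Theorem theorem1p11 (R : realType) (q : nat) (hq : exists k : nat, q = (3 ^ k)%N)
    (eta : R) (heta : 3 / 7 < eta < 1) :
  exists N : R, forall (F : finFieldType), #|F| = q ->
    forall f : {poly F}, f \is monic -> N <= (pnorm f)%:R ->
      exists g h : {poly F},
        [/\ (pnorm g)%:R <= powR (pnorm f)%:R eta,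
            (pnorm h)%:R <= powR (pnorm f)%:R eta,
            moebius (f + g) = 1
          & moebius (f + h) = -1].
Proof.
have [q2|q2] := leqP q 2.
  exists 0 => F qE; have := finNzRing_gt1 F; rewrite qE.
  by case: hq q2 => -[|k] ->; rewrite // expnS; case: (3 ^ k)%N (expn_gt0 3 k) => [|j]; lia.
have d0 : 0 < 7 * eta - 3 by lra.
pose M := Num.bound (7 * eta - 3)^-1.
have hM : 1 < (7 * eta - 3) * M%:R.
  rewrite -ltr_pdivrMl // mulr1; apply: archi_boundP.
  by rewrite invr_ge0 ltW.
have M0 : (0 < M)%N.
  by rewrite lt0n; apply: contraTneq hM => ->; rewrite mulr0 ltr10.
have [N0 hN0] := interval_parameters q2 M0.
exists (q ^ N0)%:R => F qE f mf hf.
have F3 : exists e : nat, #|F| = (3 ^ e)%N by rewrite qE.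
have f0 := monic_neq0 mf; pose N := (size f).-1.
have sf : size f = N.+1 by rewrite prednK // sz_gt0.
have NN0 : (N0 <= N)%N.
  by move: hf; rewrite ler_nat /pnorm (negPf f0) qE leq_exp2l //; lia.
have [L [p1 p2 p3 p4]] := hN0 N NN0.
rewrite -qE in p1 p2 p3 p4.
have [g [h [sg sh mg mh]]] := both_signs_degree F3 mf sf p1 p2 p3.
set rho := (#|F| ^ L.+1 + L.+1)%N in sg sh p2 p3 p4.
set n := ((3 * N + 300 * rho + 26) %/ 7)%N in sg sh.
have n0 : (7 * n.-1 <= 3 * N + (300 * rho + 19))%N by rewrite /n; clear; lia.
have main : n.-1%:R <= eta * N%:R.
  have e1 : 7 * n.-1%:R <= 3 * N%:R + (300 * rho + 19)%:R :> R.
    by rewrite -!natrM -natrD ler_nat.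
  have e2 : (300 * rho + 19)%:R <= (7 * eta - 3) * N%:R.
    apply: (@le_trans _ _ ((7 * eta - 3) * (M * (300 * rho + 19))%:R)).
      by rewrite natrM mulrA ler_peMl ?ler0n // ltW.
    by rewrite ler_pM2l // ler_nat.
  move: e1 e2; set u := (300 * rho + 19)%:R; set v : R := n.-1%:R; set w : R := N%:R.
  by move=> *; lra.
have nS : (n <= n.-1.+1)%N by case: (n).
by exists g, h; split => //; apply: (pnorm_le_powR f0 _ main); apply: leq_trans nS.
Qed.
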